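(* Let $W=(W_t)_{t\ge0}$ be a standard Brownian motion, let $n\ge1$ be an integer, and let $f:(0,\infty)\times\mathbb{R}\to\mathbb{R}$ be a continuous function such that $f(t,W_t)$ is integrable for every $t>0$. Put $g(t)=E f(t,W_t)$. Then the process $M_t=f(t,W_t)-g(t)$, $t>0$, is a martingale satisfying the condition (C) for some constant $C>0$ the process $\langle M\rangle_t-C\int_0^t(1+s+W_s^2)^{n-1}\,ds$ is non-increasing, if and only if $f(t,x)=P(t,x)+c(t)$ for all $t>0$, $x\in\mathbb{R}$, for some heat polynomial $P$ of degree at most $n$ and some deterministic function $c(t)$.
   Context: $W$ is a standard Brownian motion on a complete probability space $(\Omega,\mathcal{F},P)$, and $(\mathcal{F}_t)$ is the filtration generated by $W$; ''martingale'' means martingale with respect to this filtration. $\langle M\rangle$ denotes the quadratic variation process of the martingale $M$. A heat polynomial is a polynomial $P(t,x)$ in the two variables $t,x$ which solves the (backward) heat equation $\partial_t P+\tfrac12\partial_{xx}P=0$. *)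

(* Defs.v *)
From HB Require Import structures.
From mathcomp Require Import all_boot all_order all_algebra.
From mathcomp Require Import all_classical all_reals all_analysis.
Set Implicit Arguments. Unset Strict Implicit. Unset Printing Implicit Defensive.
Import Order.TTheory GRing.Theory Num.Theory.
Import numFieldNormedType.Exports.
Local Open Scope classical_set_scope.
Local Open Scope ring_scope.

Definition nat_filtration {R : realType} d (Om : measurableType d)
  (W : R -> Om -> R) (s : R) : set (set Om) :=
  <<s [set A | exists u (B : set R), [/\ 0 <= u, u <= s, measurable B &
                                           A = W u @^-1` B] ] >>.

Definition is_std_BM {R : realType} d (Om : measurableType d)
  (P : probability Om R) (W : R -> Om -> R) : Prop :=
  [/\ (forall t, 0 <= t -> measurable_fun setT (W t)),
      {ae P, forall w, W 0 w = 0 /\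
                       {within `[0, +oo[, continuous (fun t => W t w)}},
      (forall s t, 0 <= s -> s < t -> forall B : set R, measurable B ->
         P ((fun w => W t w - W s w) @^-1` B) =
         normal_prob 0 (Num.sqrt (t - s)) B) &
      (forall s t, 0 <= s -> s < t -> forall (A : set Om) (B : set R),
         nat_filtration W s A -> measurable B ->
         P (A `&` (fun w => W t w - W s w) @^-1` B) =
         (P A * P ((fun w => (W t w - W s w)%R) @^-1` B))%E)].

Definition is_martingale_pos {R : realType} d (Om : measurableType d)
  (P : probability Om R) (F : R -> set (set Om)) (M : R -> Om -> R) : Prop :=
  [/\ (forall t, 0 < t -> P.-integrable setT (fun w => (M t w)%:E)),
      (forall t, 0 < t -> forall B : set R, measurable B -> F t (M t @^-1` B)) &
      (forall s t, 0 < s -> s <= t -> forall A, F s A ->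
         (\int[P]_(w in A) (M t w)%:E = \int[P]_(w in A) (M s w)%:E)%E)].

Definition qv_sum {R : realType} (Om : Type) (M : R -> Om -> R) (s t : R)
  (k : nat) (w : Om) : R :=
  \sum_(i < 2 ^ k)
    (M (s + (t - s) * (i.+1)%:R / (2 ^ k)%:R) w
     - M (s + (t - s) * (i : nat)%:R / (2 ^ k)%:R) w) ^+ 2.

Definition cvg_in_prob {R : realType} d (Om : measurableType d)
  (P : probability Om R) (X : nat -> Om -> R) (Y : Om -> R) : Prop :=
  forall e : R, 0 < e ->
    (fun k => P [set w | e < `|X k w - Y w|]) @ \oo --> 0%E.

(* <M>_t - <M>_s, the quadratic variation of M over [s,t], is the limit in
   probability of the sums of squared increments; condition (C):
   for some C > 0, <M>_t - C \int_0^t (1 + u + W_u^2)^(n-1) du is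
   non-increasing, i.e. for all 0 < s <= t,
   <M>_t - <M>_s <= C \int_s^t (1 + u + W_u^2)^(n-1) du  a.s. *)
Definition condition_C {R : realType} d (Om : measurableType d)
  (P : probability Om R) (W : R -> Om -> R) (n : nat) (M : R -> Om -> R)
  : Prop :=
  exists C : R, 0 < C /\
    forall s t, 0 < s -> s <= t ->
      exists V : Om -> R,
        [/\ measurable_fun setT V,
            cvg_in_prob P (qv_sum M s t) V &
            {ae P, forall w, V w <= C * Rintegral lebesgue_measure `[s, t]
                       (fun u => (1 + u + W u w ^+ 2) ^+ n.-1)}].

(* Polynomials in two variables (t, x): p : {poly {poly R}}, the outer
   variable is x, the coefficients are polynomials in t:
   P(t, x) = \sum_i (p`_i).[t] * x ^ i. *)
Definition bipoly_eval {R : realType} (p : {poly {poly R}}) (t x : R) : R :=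
  (p.[x%:P]).[t].

Definition heat_poly {R : realType} (p : {poly {poly R}}) : Prop :=
  map_poly (@deriv R) p + (2^-1 : R)%:P *: p^`(2) = 0.

Definition bideg_le {R : realType} (p : {poly {poly R}}) (n : nat) : Prop :=
  forall i j : nat, (p`_i)`_j != 0 -> (i + j <= n)%N.

(* Main.v *)
Require Import Defs.
From HB Require Import structures.
From mathcomp Require Import all_boot all_order all_algebra.
From mathcomp Require Import all_classical all_reals all_analysis.
From mathcomp Require Import measurable_realfun qpoly.
From mathcomp Require Import ring lra.
Set Implicit Arguments. Unset Strict Implicit. Unset Printing Implicit Defensive.
Import Order.TTheory GRing.Theory Num.Theory.
Import numFieldNormedType.Exports.
Local Open Scope classical_set_scope.
Local Open Scope ring_scope.

(* Put F(t,x) = f(t,x) - g(t). By the independence of the increments, M is a martingale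
   iff F has the mean value property F(s,x) = E F(t, x + N(0,t-s)) for all s < t; the
   passage from almost every x to every x uses continuity and the full support of Gaussian
   laws. The mean value property represents F by the heat kernel, so F has a first order
   expansion in x, with slope D, whose remainder is locally of the size of (dx)^2 + |dt|;
   since almost every Brownian path has quadratic variation dt along dyadic subdivisions,
   the sums of squared increments of M over [s,t] converge almost surely to the integral
   of D(u,W_u)^2. Condition (C) is therefore the pointwise bound D(t,x)^2 <= C
   (1+t+x^2)^(n-1).

   For a heat polynomial of degree n this bound holds because its derivative has parabolic
   degree n-1. Conversely the bound and E F(t,W_t) = 0 give |F(t,x)| <= C' (1 + sqrt t +
   |x|)^n. Tilting the Gaussian law turns the mean value property on [s, s+v] into
   e^(x^2/2v) F(s,x) = E[F(s+v,Y) e^(xY/v)], where Y is N(0,v); the Taylor polynomial of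
   degree n of the right-hand side approximates it up to an error which tends to 0 as v
   tends to infinity, so each F(s,.) is a polynomial of degree at most n. The mean value
   property then writes F on (0,T) as the heat polynomial with final value F(T,.), and
   these heat polynomials agree for all T. *)

(** * Gaussian integrals *)

(** No stochastic integral appears. All the smoothness of F that the quadratic variation requires is
    contained in one inequality, [local_expansion], after which the sums of squared increments are
    studied path by path; in that step Brownian motion enters only through continuity and quadratic
    variation of its paths. Condition (C) sees only the slope in x, so it leaves F(t,0) free; the
    centring by g is what controls F(t,0) in the growth estimate. The degree n is critical in the
    tilting step. With v = sg^2, F has size sg^n where |y| is of order sg, while the Taylor
    remainder of order n+1 in x y / sg^2 has size sg^-(n+1): the error is of order 1/sg, and one
    term less would not suffice. Everything lives on t > 0, without an initial value, hence the
    construction of the heat polynomial backwards from a final time. The gap between 0 and s serves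
    as an integrability margin: integrability against the wider Gaussian law of an earlier time
    dominates all kernels used on [s,t]. *)

Local Notation mu := lebesgue_measure.

(** Since (n+k)! >= k!, the tail from rank n on is at most |u|^n times the exponential series of
    |u|. The bound holds for partial sums and passes to the limit. *)
Lemma expR_taylor (R : realType) (n : nat) (u : R) :
  `|expR u - \sum_(0 <= k < n) u ^+ k / k`!%:R| <= `|u| ^+ n * expR `|u|.
Proof.
have cv (x : R) : series (exp_coeff x) @ \oo --> expR x.
  exact: is_cvg_series_exp_coeff.
have E (x : R) k : exp_coeff x k = x ^+ k / k`!%:R by [].
have ub (x : R) N : 0 <= x -> series (exp_coeff x) N <= expR x.
  move=> x0; apply: nondecreasing_cvgn_le; last exact: is_cvg_series_exp_coeff.
  by apply: nondecreasing_series => k _ _; apply: exp_coeff_ge0.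
have c1 : (fun N => `|series (exp_coeff u) (n + N)%N - \sum_(0 <= k < n) u ^+ k / k`!%:R|)
   @ \oo --> `|expR u - \sum_(0 <= k < n) u ^+ k / k`!%:R|.
  apply: cvg_norm; apply: cvgB; last exact: cvg_cst.
  by under eq_fun do rewrite addnC; move: (cv u); rewrite -(cvg_shiftn n).
apply: (closed_cvg (fun y => y <= `|u| ^+ n * expR `|u|) _ _ _ c1).
  exact: closed_le.
near=> N.
rewrite /series /= (@big_cat_nat _ _ _ n 0)//= ?leq_addr// addrAC subrr add0r.
apply: le_trans (ler_norm_sum _ _ _) _.
rewrite -{1}[n]add0n big_addn addKn.
apply: le_trans (ler_wpM2l _ (ub `|u| N _)) => //; rewrite ?exprn_ge0//.
rewrite /series/= mulr_sumr; apply: ler_sum => k _.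
rewrite !E normrM normrX exprD mulrCA mulrA [_ * `|u| ^+ n]mulrC.
rewrite ler_wpM2l ?mulr_ge0 ?exprn_ge0// ger0_norm ?invr_ge0//.
rewrite lef_pV2 ?posrE ?ltr0n ?fact_gt0// ler_nat.
by apply: leq_fact; rewrite leq_addr.
Unshelve. all: by end_near. Qed.

(** The Radon-Nikodym derivative of [normal_prob] is almost everywhere [normal_pdf], because both
    have the same integral over every measurable set. *)
Lemma ge0_integral_normal (R : realType) (m s : R) (f : R -> \bar R) :
  measurable_fun setT f -> (forall x, 0 <= f x)%E ->
  (\int[normal_prob m s]_x f x = \int[mu]_x (f x * (normal_pdf m s x)%:E))%E.
Proof.
move=> mf f0.
rewrite -(Radon_Nikodym_SigmaFinite.change_of_variables (normal_prob_dominates m s))//.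
have fint := Radon_Nikodym_SigmaFinite.f_integrable (normal_prob_dominates m s).
apply: ae_eq_integral => //.
- by apply: emeasurable_funM => //; apply: (measurable_int mu fint).
- apply: emeasurable_funM => //=; apply/measurableT_comp => //=.
  exact: measurable_normal_pdf.
- apply: ae_eqe_mul2l => /=.
  apply: integral_ae_eq => //=.
  + by apply/measurableT_comp =>//; exact: measurable_normal_pdf.
  + move=> E _ mE; rewrite -Radon_Nikodym_SigmaFinite.f_integral//.
    exact: normal_prob_dominates.
Qed.

Definition gauss (R : realType) (m s : R) : set R -> \bar R := normal_prob m s.

Section gauss_measure.
Variables (R : realType) (m s : R).

Let gauss0 : gauss m s set0 = 0%E.
Proof. exact: (measure0 (normal_prob m s)). Qed.

Let gauss_ge0 (A : set R) : (0 <= gauss m s A)%E.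
Proof. exact: (measure_ge0 (normal_prob m s)). Qed.

Let gauss_sigma_additive : semi_sigma_additive (gauss m s).
Proof. exact: (@measure_semi_sigma_additive _ _ _ (normal_prob m s)). Qed.

HB.instance Definition _ := isMeasure.Build _ _ _
  (gauss m s) gauss0 gauss_ge0 gauss_sigma_additive.

Let gauss_setT : gauss m s setT = 1%E.
Proof. exact: (@probability_setT _ _ _ (normal_prob m s)). Qed.

HB.instance Definition _ :=
  @Measure_isProbability.Build _ _ R (gauss m s) gauss_setT.

End gauss_measure.

(* [R] and [measurableTypeR R] carry the same sigma-algebra under two different displays,
   so [gauss] is a copy of [normal_prob] on [R]. *)
Lemma ge0_integral_gauss (R : realType) (m s : R) (f : R -> \bar R) :
  measurable_fun setT f -> (forall x, 0 <= f x)%E ->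
  (\int[gauss m s]_x f x = \int[mu]_x (f x * (normal_pdf m s x)%:E))%E.
Proof.
move=> mf f0.
pose idR (x : measurableTypeR R) : R := x.
have mid : measurable_fun setT idR by move=> _ A mA; rewrite setTI.
transitivity (\int[pushforward (normal_prob m s) idR]_x f x)%E.
  exact: eq_measure_integral.
by rewrite (ge0_integral_pushforward mid)// ge0_integral_normal.
Qed.

Lemma integrable_gaussP (R : realType) (m s : R) (f : R -> R) :
  measurable_fun setT f ->
  (gauss m s).-integrable setT (EFin \o f) <->
  mu.-integrable setT (fun x => (f x * normal_pdf m s x)%:E).
Proof.
move=> mf.
have E : (\int[gauss m s]_x `|(f x)%:E| =
    \int[mu]_x `|(f x * normal_pdf m s x)%:E|)%E.
  rewrite ge0_integral_gauss//; last first.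
    by do 2 apply: measurableT_comp => //.
  by apply: eq_integral => x _; rewrite EFinM abseM/= (ger0_norm (normal_pdf_ge0 _ _ _)).
split => /integrableP [_ fin]; apply/integrableP; split => //.
- apply/measurable_EFinP/measurable_funM => //.
  exact: measurable_normal_pdf.
- by rewrite -E.
- exact/measurable_EFinP.
- by rewrite E.
Qed.

Lemma integral_gauss (R : realType) (m s : R) (f : R -> R) :
  (gauss m s).-integrable setT (EFin \o f) ->
  (\int[gauss m s]_x (f x)%:E = \int[mu]_x (f x * normal_pdf m s x)%:E)%E.
Proof.
move=> fi.
have mf : measurable_fun setT (EFin \o f) by case/integrableP: fi.
rewrite [LHS]integralE [RHS]integralE; congr (_ - _)%E.
- rewrite ge0_integral_gauss//; last exact: measurable_funepos.
  apply: eq_integral => x _; rewrite !funeposE/= -!EFin_max -EFinM.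
  by rewrite maxr_pMl ?normal_pdf_ge0// mul0r.
- rewrite ge0_integral_gauss//; last exact: measurable_funeneg.
  apply: eq_integral => x _; rewrite !funenegE/= -!EFin_max -EFinM.
  by rewrite maxr_pMl ?normal_pdf_ge0// mul0r mulNr.
Qed.

Lemma lebesgue_measure_translation (R : realType) (a : R) (A : set R) :
  measurable A ->
  pushforward mu ((fun x => a + x) : _ -> measurableTypeR R) A = mu A.
Proof.
have ma : measurable_fun setT (fun x : measurableTypeR R => (a + x : measurableTypeR R)).
  by apply: measurable_funD.
move=> mA; apply/esym; apply: (@lebesgue_measure_unique _ (pushforward mu (fun x : measurableTypeR R => (a + x : measurableTypeR R)))) => //= _ [[x y]] _ <-.
rewrite /pushforward/=.
have -> : (fun t : R => a + t) @^-1` `]x, y]%classic = `]x - a, y - a]%classic.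
  by apply/seteqP; split => z /=; rewrite !in_itv/= ltrBlDl lerBrDl.
by rewrite !lebesgue_measure_itv/= !lte_fin ltrD2r -!EFinB opprB addrA subrK.
Qed.

Lemma normal_pdf_translation (R : realType) (m s x : R) : s != 0 ->
  normal_pdf m s (m + x) = normal_pdf 0 s x.
Proof.
by move=> s0; rewrite /normal_pdf (negbTE s0) /normal_fun subr0 addrAC subrr add0r.
Qed.

Lemma normal_prob_translation (R : realType) (m s : R) (A : set R) : s != 0 ->
  measurable A -> normal_prob 0 s ((fun x => m + x) @^-1` A) = normal_prob m s A.
Proof.
move=> s0 mA.
have ma : measurable_fun setT (fun x : R => m + x) by apply: measurable_funD.
rewrite /normal_prob.
pose phi (x : measurableTypeR R) : measurableTypeR R := m + x.
have mphi : measurable_fun setT phi by exact: ma.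
transitivity (\int[pushforward mu phi]_(x in A) (normal_pdf m s x)%:E)%E.
  rewrite (ge0_integral_pushforward mphi)//.
  - by apply: eq_integral => x _ /=; rewrite normal_pdf_translation.
  - by apply/measurable_EFinP/measurable_funTS; exact: measurable_normal_pdf.
  - by move=> x _; rewrite lee_fin normal_pdf_ge0.
apply: eq_measure_integral => B mB _; exact: lebesgue_measure_translation.
Qed.

Section gauss_shift.
Variables (R : realType) (m s : R) (f : R -> R).
Hypothesis s0 : s != 0.
Hypothesis mf : measurable_fun setT f.

Let phi (x : R) : R := m + x.

Let mphi : measurable_fun setT phi.
Proof. by apply: measurable_funD. Qed.

Let gauss_shiftE (h : R -> \bar R) :
  (\int[gauss m s]_x h x = \int[pushforward (gauss 0 s) phi]_x h x)%E.
Proof.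
apply: eq_measure_integral => A mA _.
exact/esym/(normal_prob_translation m s0 mA).
Qed.

(** Increments have centred laws, whereas the kernel formulas centre the law at the starting point;
    this section passes from one form to the other. *)
Lemma integrable_gauss_shift :
  (gauss 0 s).-integrable setT (fun y => (f (m + y))%:E) <->
  (gauss m s).-integrable setT (EFin \o f).
Proof.
have E : (\int[gauss m s]_x `|(f x)%:E| = \int[gauss 0 s]_y `|(f (m + y))%:E|)%E.
  rewrite gauss_shiftE (ge0_integral_pushforward mphi)//.
  by do 2 apply: measurableT_comp => //.
split => /integrableP [_ fin]; apply/integrableP; split.
- exact/measurable_EFinP.
- by rewrite E.
- by apply/measurable_EFinP; exact: (measurableT_comp mf mphi).
- by rewrite -E.
Qed.

Lemma integral_gauss_shift :
  (gauss m s).-integrable setT (EFin \o f) ->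
  (\int[gauss 0 s]_y (f (m + y))%:E = \int[gauss m s]_x (f x)%:E)%E.
Proof.
move=> fi; rewrite gauss_shiftE (integral_pushforward mphi)//.
- exact/measurable_EFinP.
- exact/integrable_gauss_shift.
Qed.

End gauss_shift.

Section gaussian_exponential.
Variables (R : realType) (s : R).
Hypothesis s0 : s != 0.

(** Completion of the square. It gives the moment generating function here and the tilting of the
    mean value property later. *)
Lemma normal_pdf_tilt (m x : R) :
  expR (m * x) * normal_pdf 0 s x =
  expR (m ^+ 2 * s ^+ 2 / 2) * normal_pdf (m * s ^+ 2) s x.
Proof.
rewrite /normal_pdf (negbTE s0) /normal_fun mulrCA [RHS]mulrCA -!expRD; congr (_ * expR _).
by rewrite subr0 -mulr_natr; field.
Qed.

Let measurable_expRM (m : R) : measurable_fun setT (fun x : R => expR (m * x)).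
Proof. by apply: measurableT_comp => //; exact: measurable_funM. Qed.

Lemma gauss_mgf (m : R) :
  (\int[gauss 0 s]_x (expR (m * x))%:E = (expR (m ^+ 2 * s ^+ 2 / 2))%:E)%E.
Proof.
rewrite ge0_integral_gauss; [|exact/measurable_EFinP|by move=> x; rewrite lee_fin expR_ge0].
under eq_integral do rewrite -EFinM normal_pdf_tilt EFinM.
rewrite integralZl//; last exact: integrable_normal_pdf.
by rewrite integral_normal_pdf mule1.
Qed.

Lemma gauss_integrable_expR (m : R) :
  (gauss 0 s).-integrable setT (fun x => (expR (m * x))%:E).
Proof.
apply/integrableP; split.
  exact/measurable_EFinP.
under eq_integral do rewrite gee0_abs ?lee_fin ?expR_ge0//.
by rewrite gauss_mgf ltry.
Qed.

Lemma expR_norm_le (c x : R) : 0 <= c -> expR (c * `|x|) <= expR (c * x) + expR (- c * x).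
Proof.
move=> c0; have [x0|x0] := lerP 0 x.
  by rewrite (ger0_norm x0) ler_wpDr ?expR_ge0.
by rewrite (ltr0_norm x0) mulrN mulNr ler_wpDl ?expR_ge0.
Qed.

Lemma gauss_integrable_expR_norm (c : R) : 0 <= c ->
  (gauss 0 s).-integrable setT (fun x => (expR (c * `|x|))%:E).
Proof.
move=> c0.
apply: (@le_integrable _ _ _ (gauss 0 s) _ _ _
   (fun x => (expR (c * x))%:E + (expR (- c * x))%:E)%E) => //.
- apply/measurable_EFinP/measurableT_comp => //; apply: measurable_funM => //.
- move=> x _; rewrite -EFinD !abse_EFin lee_fin.
  by rewrite (ger0_norm (expR_ge0 _)) (ger0_norm (addr_ge0 (expR_ge0 _) (expR_ge0 _))) expR_norm_le.
- by apply: integrableD => //; exact: gauss_integrable_expR.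
Qed.

Lemma gauss_expR_norm_le (c : R) : 0 <= c ->
  (\int[gauss 0 s]_x (expR (c * `|x|))%:E <= (2 * expR (c ^+ 2 * s ^+ 2 / 2))%:E)%E.
Proof.
move=> c0.
apply: (@le_trans _ _ (\int[gauss 0 s]_x ((expR (c * x))%:E + (expR (- c * x))%:E))%E).
  apply: le_integral => //.
  - exact: gauss_integrable_expR_norm.
  - by apply: integrableD => //; exact: gauss_integrable_expR.
  - by move=> x _; rewrite -EFinD lee_fin expR_norm_le.
rewrite integralD//; [|exact: gauss_integrable_expR..].
by rewrite !gauss_mgf -EFinD sqrrN lee_fin mulr2n mulrDl !mul1r.
Qed.

End gaussian_exponential.

(** * Moments of Gaussian laws *)

Lemma exprn_le_expR (R : realType) (n : nat) (x : R) : 0 <= x -> x ^+ n <= n`!%:R * expR x.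
Proof.
move=> x0; rewrite mulrC -ler_pdivrMr ?ltr0n ?fact_gt0//.
case: n => [|n].
  by rewrite expr0 fact0 divr1 -expR0 ler_expR.
by apply: le_trans (expR_ge1Dxn n x0); rewrite lerDr.
Qed.

Lemma horner_norm_le (R : realType) (p : {poly R}) (x : R) : `|x| <= 1 ->
  `|p.[x]| <= \sum_(i < size p) `|p`_i|.
Proof.
move=> x1; rewrite horner_coef; apply: le_trans (ler_norm_sum _ _ _) _.
apply: ler_sum => i _; rewrite normrM normrX ler_piMr//.
by rewrite exprn_ile1.
Qed.

(** Uniqueness of Taylor coefficients: the constant term must vanish, and dividing by x lowers N. It
    identifies the Gaussian moments, and with C = 0 it shows that a polynomial vanishing on ]0, 1]
    is zero. *)
Lemma poly_eq0_small (R : realType) (N : nat) (p : {poly R}) (C : R) :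
  (size p <= N)%N -> (forall x, 0 < x -> x <= 1 -> `|p.[x]| <= C * x ^+ N) -> p = 0.
Proof.
elim: N p C => [|N IH] p C; first by rewrite size_poly_leq0 => /eqP.
move=> sp pC.
have [->//|pN0] := eqVneq p 0.
pose q := \poly_(i < N) p`_i.+1.
have pE : p = q * 'X + (p`_0)%:P.
  apply/polyP => i; rewrite coefD coefMX coefC; case: i => [|i] /=; first by rewrite add0r.
  rewrite addr0 /q coef_poly; case: ltnP => // Ni.
  by rewrite nth_default// (leq_trans sp).
have p0 : p`_0 = 0.
  apply/eqP/negPn/negP => p00.
  pose B := \sum_(i < size q) `|q`_i|.
  have B0 : 0 <= B by apply: sumr_ge0.
  have C0 : 0 <= C.
    by have := pC 1 ltr01 (lexx _); rewrite expr1n mulr1; apply: le_trans.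
  have K x : 0 < x -> x <= 1 -> `|p`_0| <= x * (B + C).
    move=> x0 x1; have -> : p`_0 = p.[x] - q.[x] * x.
      by rewrite {2}pE !hornerE; ring.
    apply: le_trans (ler_normB _ _) _; rewrite mulrDr addrC lerD//.
      rewrite normrM (gtr0_norm x0) mulrC ler_wpM2l ?(ltW x0)//.
      by apply: horner_norm_le; rewrite gtr0_norm.
    apply: le_trans (pC _ x0 x1) _; rewrite mulrC ler_wpM2r//.
    by rewrite exprS ler_piMr ?(ltW x0)// exprn_ile1// ltW.
  have a0 : 0 < `|p`_0| by rewrite normr_gt0.
  (* Chosen so that x (B + C + |p_0|) = |p_0| / 2, which contradicts |p_0| <= x (B + C); the extra
     |p_0| in the denominator keeps it positive and x <= 1. *)
  pose x := `|p`_0| / (B + C + `|p`_0|) / 2.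
  have D0 : 0 < B + C + `|p`_0| by rewrite ltr_wpDl// addr_ge0.
  have x0 : 0 < x by rewrite !divr_gt0.
  have x1 : x <= 1.
    rewrite ler_pdivrMr// ler_pdivrMr// mul1r; nra.
  have := K _ x0 x1; rewrite leNgt => /negP; apply.
  have xD : x * (B + C + `|p`_0|) = `|p`_0| / 2.
    by rewrite /x; field; rewrite gt_eqF.
  nra.
move: pE; rewrite p0 addr0 => pE.
suff q0 : q = 0 by rewrite pE q0 mul0r.
apply: (IH q C); first exact: size_poly.
move=> x x0 x1; have := pC x x0 x1.
rewrite {1}pE hornerMX normrM (gtr0_norm x0) exprSr mulrA.
by rewrite ler_pM2r.
Qed.

Section gauss_moments.
Variables (R : realType) (s : R).
Hypothesis s0 : s != 0.

Lemma gauss_integrable_dominated (f : R -> R) (C c : R) : measurable_fun setT f ->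
  0 <= c -> (forall x, `|f x| <= C * expR (c * `|x|)) ->
  (gauss 0 s).-integrable setT (EFin \o f).
Proof.
move=> mf c0 fC.
apply: (@le_integrable _ _ _ (gauss 0 s) _ _ _ (fun x => (C%:E * (expR (c * `|x|))%:E)%E)) => //.
- exact/measurable_EFinP.
- move=> x _; rewrite -EFinM !abse_EFin lee_fin.
  by apply: le_trans (fC x) _; exact: ler_norm.
- by apply: integrableZl => //; exact: gauss_integrable_expR_norm.
Qed.

Lemma gauss_integrable_exprn (k : nat) :
  (gauss 0 s).-integrable setT (fun y => (y ^+ k)%:E).
Proof.
apply: (@gauss_integrable_dominated (fun y => y ^+ k) k`!%:R 1) => // x.
by rewrite mul1r normrX exprn_le_expR.
Qed.

Definition gauss_moment (k : nat) : R := (\int[gauss 0 s]_y (y ^+ k))%R.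

Lemma gauss_moment_EFin (k : nat) :
  (\int[gauss 0 s]_y (y ^+ k)%:E = (gauss_moment k)%:E)%E.
Proof.
by rewrite /gauss_moment /Rintegral fineK//; apply: integrable_fin_num => //; exact: gauss_integrable_exprn.
Qed.

End gauss_moments.

Lemma integrable_RZl d (T : measurableType d) (R : realType)
    (m : {measure set T -> \bar R}) (D : set T) (k : R) (f : T -> R) :
  measurable D -> m.-integrable D (fun x => (f x)%:E) ->
  m.-integrable D (fun x => (k * f x)%:E).
Proof.
by move=> mD fi; under eq_fun do rewrite EFinM; exact: integrableZl.
Qed.

Lemma integrable_Rsum d (T : measurableType d) (R : realType)
    (m : {measure set T -> \bar R}) (D : set T) (I : Type) (r : seq I) (f : I -> T -> R) :
  measurable D -> (forall i, m.-integrable D (fun x => (f i x)%:E)) ->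
  m.-integrable D (fun x => (\sum_(i <- r) f i x)%:E).
Proof.
move=> mD fi; elim: r => [|i r IH].
  by under eq_fun do rewrite big_nil; exact: integrable0.
under eq_fun do rewrite big_cons EFinD.
exact: integrableD.
Qed.

Lemma Rintegral_sum d (T : measurableType d) (R : realType)
    (m : {measure set T -> \bar R}) (D : set T) (I : Type) (r : seq I) (f : I -> T -> R) :
  measurable D -> (forall i, m.-integrable D (fun x => (f i x)%:E)) ->
  (\int[m]_(x in D) (\sum_(i <- r) f i x) = \sum_(i <- r) \int[m]_(x in D) f i x)%R.
Proof.
move=> mD fi; elim: r => [|i r IH].
  rewrite big_nil; under eq_Rintegral do rewrite big_nil.
  by rewrite Rintegral_cst// mul0r.
rewrite big_cons -IH -RintegralD//; last 2 first.
- exact: fi.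
- exact: (integrable_Rsum r mD fi).
by apply: eq_Rintegral => x _; rewrite big_cons.
Qed.

Lemma Rintegral_dist_le d (T : measurableType d) (R : realType)
    (m : {measure set T -> \bar R}) (f g h : T -> R) :
  m.-integrable setT (EFin \o f) -> m.-integrable setT (EFin \o g) ->
  m.-integrable setT (EFin \o h) -> (forall x, `|f x - g x| <= h x) ->
  `|\int[m]_x f x - \int[m]_x g x| <= \int[m]_x h x.
Proof.
move=> fi gi hi H; rewrite -RintegralB//.
have bi : m.-integrable setT (EFin \o (fun x => f x - g x)).
  by apply: eq_integrable (integrableB measurableT fi gi) => // x _ /=; rewrite EFinB.
apply: le_trans (le_normr_Rintegral measurableT bi) _.
apply: le_Rintegral => //.
exact: (integrable_norm bi).
Qed.

Section gauss_moment_value.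
Variables (R : realType) (s : R).
Hypothesis s0 : s != 0.

Lemma gauss_Rmgf (x : R) : (\int[gauss 0 s]_y expR (x * y) = expR (x ^+ 2 * s ^+ 2 / 2))%R.
Proof. by rewrite /Rintegral gauss_mgf. Qed.

(** Coefficient of x^k in the power series of exp (x^2 s^2 / 2), the moment generating function. *)
Let c (k : nat) : R := if odd k then 0 else s ^+ k / (2 ^+ k./2 * k./2`!%:R).

Let sum_c K (x : R) : \sum_(0 <= k < K.*2) c k * x ^+ k =
  \sum_(0 <= j < K) (x ^+ 2 * s ^+ 2 / 2) ^+ j / j`!%:R.
Proof.
elim: K => [|K IH]; first by rewrite !big_geq.
rewrite doubleS !big_nat_recr//= IH /c /= odd_double/= doubleK mul0r addr0.
congr (_ + _); rewrite -mul2n !exprM; move: (x ^+ 2) (s ^+ 2) => X S.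
by rewrite !exprMn exprVn invfM; ring.
Qed.

Let integrable_expn_expR k :
  (gauss 0 s).-integrable setT (fun y => (`|y| ^+ k * expR `|y|)%:E).
Proof.
apply: (@gauss_integrable_dominated _ _ s0 _ k`!%:R 2) => //.
  apply: measurable_funM; last exact: measurableT_comp.
  by apply: measurable_funX; exact: normr_measurable.
move=> x; rewrite ger0_norm ?mulr_ge0 ?exprn_ge0 ?expR_ge0//.
have -> : expR (2 * `|x|) = expR `|x| * expR `|x| by rewrite -expRD; congr expR; ring.
by rewrite mulrA ler_wpM2r ?expR_ge0// exprn_le_expR.
Qed.

Let moment_sum K (x : R) : 0 < x -> x <= 1 ->
  `|\sum_(0 <= k < K) gauss_moment s k / k`!%:R * x ^+ k - expR (x ^+ 2 * s ^+ 2 / 2)|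
  <= (\int[gauss 0 s]_y (`|y| ^+ K * expR `|y|))%R * x ^+ K.
Proof.
move=> x0 x1.
have I1 k : (gauss 0 s).-integrable setT (fun y => (x ^+ k / k`!%:R * y ^+ k)%:E).
  by apply: integrable_RZl => //; exact: gauss_integrable_exprn.
rewrite (_ : \sum_(0 <= k < K) _ =
   (\int[gauss 0 s]_y (\sum_(0 <= k < K) x ^+ k / k`!%:R * y ^+ k))%R); last first.
  rewrite Rintegral_sum//; apply: eq_bigr => k _.
  rewrite RintegralZl//; last exact: gauss_integrable_exprn.
  by rewrite /gauss_moment; ring.
rewrite -gauss_Rmgf -RintegralZr//; last exact: integrable_expn_expR.
apply: Rintegral_dist_le.
- exact: integrable_Rsum.
- exact: gauss_integrable_expR.
- under eq_fun do rewrite mulrC.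
  by apply: integrable_RZl => //.
move=> y; rewrite distrC.
under eq_bigr do rewrite mulrAC -exprMn.
apply: le_trans (expR_taylor _ _) _.
rewrite normrM (gtr0_norm x0) exprMn -mulrA mulrC ler_wpM2r ?exprn_ge0 ?(ltW x0)//.
rewrite ler_wpM2l ?exprn_ge0// ler_expR.
by rewrite ler_piMl.
Qed.

(** Near 0+, both the polynomial with coefficients E Y^i / i! and the one with coefficients [c i]
    differ from the moment generating function by O(x^(2K)). Their difference has size at most 2K,
    so [poly_eq0_small] makes them equal. *)
Lemma gauss_momentE (k : nat) :
  gauss_moment s k = if odd k then 0 else k`!%:R * s ^+ k / (2 ^+ k./2 * k./2`!%:R).
Proof.
pose K := k.+1.
pose p := \poly_(i < K.*2) (gauss_moment s i / i`!%:R - c i).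
have p0 : p = 0.
  pose C1 := (\int[gauss 0 s]_y (`|y| ^+ K.*2 * expR `|y|))%R.
  pose C2 := (s ^+ 2 / 2) ^+ K * expR (s ^+ 2 / 2).
  apply: (@poly_eq0_small _ K.*2 _ (C1 + C2)); first exact: size_poly.
  move=> x x0 x1.
  have -> : p.[x] = (\sum_(0 <= i < K.*2) gauss_moment s i / i`!%:R * x ^+ i
      - expR (x ^+ 2 * s ^+ 2 / 2)) + (expR (x ^+ 2 * s ^+ 2 / 2)
      - \sum_(0 <= j < K) (x ^+ 2 * s ^+ 2 / 2) ^+ j / j`!%:R).
    rewrite /p horner_poly -sum_c addrA subrK -sumrB big_mkord.
    by apply: eq_bigr => i _; rewrite mulrBl.
  apply: le_trans (ler_normD _ _) _; rewrite mulrDl lerD//.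
    exact: moment_sum.
  apply: le_trans (expR_taylor _ _) _.
  have s2 : 0 <= s ^+ 2 / 2 by rewrite divr_ge0 ?sqr_ge0.
  rewrite -mulrA normrM (ger0_norm s2) (ger0_norm (sqr_ge0 x)).
  rewrite exprMn -exprM mul2n -mulrA mulrC ler_wpM2r ?exprn_ge0 ?(ltW x0)//.
  rewrite ler_wpM2l ?exprn_ge0// ler_expR ler_piMl//.
  by rewrite exprn_ile1// ltW.
have : p`_k = 0 by rewrite p0 coef0.
rewrite coef_poly ifT; last by rewrite /K -addnn addSn ltnS leq_addr.
move/eqP; rewrite subr_eq0 => /eqP/(congr1 (fun z => z * k`!%:R)).
rewrite divfK ?pnatr_eq0 -?lt0n ?fact_gt0// => ->.
by rewrite /c; case: odd; rewrite ?mul0r// mulrC mulrA.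
Qed.

End gauss_moment_value.

Lemma sum_even (R : nmodType) (F : nat -> R) (K : nat) :
  (forall k, odd k -> F k = 0) ->
  \sum_(0 <= k < K.*2) F k = \sum_(0 <= j < K) F j.*2.
Proof.
move=> F0; elim: K => [|K IH]; first by rewrite !big_geq.
by rewrite doubleS !big_nat_recr//= IH (F0 K.*2.+1) ?addr0//= odd_double.
Qed.

(** The heat semigroup exp (s^2/2 d^2/dx^2) on polynomials: in the Taylor expansion at x the odd
    moments vanish, and the factor (2j)! of the moment of order 2j cancels that of the Taylor
    coefficient. *)
Lemma gauss_poly (R : realType) (s : R) (r : {poly R}) (x : R) (K : nat) : s != 0 ->
  (size r <= K.*2)%N ->
  (\int[gauss 0 s]_y r.[x + y])%R =
  \sum_(0 <= j < K) (s ^+ 2 / 2) ^+ j / j`!%:R * r^`(j.*2).[x].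
Proof.
move=> s0 sr.
under eq_Rintegral do rewrite (nderiv_taylor_wide (mulrC _ _) sr) -(big_mkord xpredT (fun i => r^`N(i).[x] * _ ^+ i)).
rewrite Rintegral_sum//; last first.
  by move=> i; apply: integrable_RZl => //; exact: gauss_integrable_exprn.
pose F k := if odd k then 0 else (s ^+ 2 / 2) ^+ k./2 / k./2`!%:R * r^`(k).[x].
transitivity (\sum_(0 <= k < K.*2) F k).
  apply: eq_bigr => k _; rewrite RintegralZl//; last exact: gauss_integrable_exprn.
  rewrite -/(gauss_moment s k) gauss_momentE// /F.
  have [|ek] := boolP (odd k); first by rewrite mulr0.
  rewrite nderivn_def hornerMn -mulr_natl.
  have -> : s ^+ k = (s ^+ 2) ^+ k./2.
    by rewrite -exprM mul2n -[in LHS](odd_double_half k) (negbTE ek).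
  move: (s ^+ 2) => S.
  by rewrite exprMn exprVn invfM; ring.
rewrite sum_even; last by move=> k ok; rewrite /F ok.
by apply: eq_bigr => j _; rewrite /F odd_double doubleK.
Qed.

Lemma gauss_integrable_poly (R : realType) (s : R) (r : {poly R}) (x : R) : s != 0 ->
  (gauss 0 s).-integrable setT (fun y => (r.[x + y])%:E).
Proof.
move=> s0; under eq_fun do rewrite (nderiv_taylor _ (mulrC _ _)) -(big_mkord xpredT (fun i => r^`N(i).[x] * _ ^+ i)).
apply: integrable_Rsum => // i.
by apply: integrable_RZl => //; exact: gauss_integrable_exprn.
Qed.

(** * Heat polynomials *)

Section heat_polynomials.
Variable R : realType.
Implicit Types (p : {poly {poly R}}) (r : {poly R}) (s t x : R).

Lemma bipoly_evalE p t x : bipoly_eval p t x = (map_poly (horner_eval t) p).[x].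
Proof.
rewrite /bipoly_eval -[x in RHS](hornerC x t) -/(horner_eval t x%:P).
by rewrite horner_map.
Qed.

Lemma coef_map_deriv p i : (map_poly (@deriv R) p)`_i = (p`_i)^`().
Proof. by rewrite coef_map_id0// linear0. Qed.

Lemma heat_coef p i : heat_poly p ->
  p`_i.+2 *+ (i.+2 * i.+1) = (- 2) *: (p`_i)^`().
Proof.
rewrite /heat_poly => /(congr1 (fun q : {poly {poly R}} => q`_i)); rewrite coefD coef_map_deriv coefZ coef0.
rewrite coef_derivn /= => /eqP; rewrite addr_eq0 => /eqP ->.
rewrite add2n ffactnS ffactn1 scalerN scaleNr opprK mul_polyC.
by rewrite scalerA divff ?scale1r// pnatr_eq0.
Qed.

(** Iterates the rule that two derivatives in x amount to -2 times one derivative in t. *)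
Lemma heat_derivn p (j i : nat) : heat_poly p ->
  (p^`(j.*2))`_i = (- 2) ^+ j *: (p`_i)^`(j).
Proof.
move=> hp; elim: j i => [|j IH] i; first by rewrite expr0 scale1r.
rewrite doubleS !derivnS !coef_deriv IH -mulrnA scalerMnr -derivnMn.
by rewrite heat_coef// derivnZ -derivSn scalerA exprSr.
Qed.

(** In the expansion [gauss_poly] at time t, each pair of derivatives in x becomes -2 times a
    derivative in t; what results is the Taylor expansion in time of p(., x) from t to s. *)
Lemma gauss_heat_poly p (s t x : R) : heat_poly p -> s < t ->
  (\int[gauss 0 (Num.sqrt (t - s))]_y bipoly_eval p t (x + y))%R = bipoly_eval p s x.
Proof.
move=> hp st.
have s0 : Num.sqrt (t - s) != 0 by rewrite gt_eqF// sqrtr_gt0 subr_gt0.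
under eq_Rintegral do rewrite bipoly_evalE.
(* Large enough for both expansions: the one in x through [size p], the one in t through [size
   p.[x%:P]]. *)
pose K := (size p + size p.[x%:P])%N.
rewrite (@gauss_poly _ _ _ _ K)//; last first.
  rewrite (leq_trans (size_poly _ _))// -addnn -addnA leq_addr//.
rewrite sqr_sqrtr; last by rewrite subr_ge0 ltW.
have dE j : (map_poly (horner_eval t) p)^`(j.*2).[x] = (- 2) ^+ j * (p.[x%:P])^`(j).[t].
  have pxE : p.[x%:P] = \sum_(i < size p) x ^+ i *: p`_i.
    by rewrite horner_coef; apply: eq_bigr => i _; rewrite -rmorphXn/= mulrC mul_polyC.
  rewrite derivn_map (@horner_coef_wide _ (size p)); last first.
    apply/leq_sizeP => i pi; rewrite coef_map/= coef_derivn nth_default ?mul0rn//=.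
      by rewrite horner_evalE horner0.
    by rewrite (leq_trans pi)// leq_addl.
  rewrite pxE raddf_sum/= horner_sum mulr_sumr; apply: eq_bigr => i _.
  by rewrite coef_map/= heat_derivn// horner_evalE derivnZ !hornerZ; ring.
under eq_bigr do rewrite dE.
rewrite /bipoly_eval; set q := p.[x%:P] in K *.
have -> : q.[s] = q.[t + (s - t)] by congr (_.[_]); ring.
rewrite (@nderiv_taylor_wide _ K)//; [|exact: mulrC|by rewrite leq_addl].
rewrite big_mkord; apply: eq_bigr => j _.
rewrite nderivn_def hornerMn -(mulr_natl q^`N(j).[t]).
have -> : (s - t) ^+ j = ((t - s) / 2) ^+ j * (- 2) ^+ j.
  by rewrite -exprMn; congr (_ ^+ _); field.
have : (j`!%:R : R) != 0 by rewrite pnatr_eq0 -lt0n fact_gt0.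
by move: (j`!%:R) (((t - s) / 2) ^+ j) ((- 2) ^+ j) => F A B F0; field.
Qed.

Lemma gauss_integrable_heat_poly p (s t x : R) : s < t ->
  (gauss 0 (Num.sqrt (t - s))).-integrable setT (fun y => (bipoly_eval p t (x + y))%:E).
Proof.
move=> st; under eq_fun do rewrite bipoly_evalE.
by apply: gauss_integrable_poly; rewrite gt_eqF// sqrtr_gt0 subr_gt0.
Qed.

(* exp ((t0 - t) / 2 * d^2/dx^2) applied to [r] *)
Definition heat_extension (t0 : R) (r : {poly R}) : {poly {poly R}} :=
  \sum_(j < size r) ((t0%:P - 'X) ^+ j * ((2 ^+ j * j`!%:R)^-1)%:P) *: map_poly polyC r^`(j.*2).

Lemma bipoly_eval_heat_extension (t0 : R) r (s x : R) :
  bipoly_eval (heat_extension t0 r) s x =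
  \sum_(0 <= j < size r) ((t0 - s) / 2) ^+ j / j`!%:R * r^`(j.*2).[x].
Proof.
rewrite /bipoly_eval /heat_extension !horner_sum big_mkord; apply: eq_bigr => j _.
rewrite hornerZ horner_map/= !hornerE exprMn exprVn invfM.
by move: (_ ^+ j) (_ ^+ j) => A B; ring.
Qed.

Lemma coef_heat_extension (t0 : R) r i :
  (heat_extension t0 r)`_i =
  \sum_(j < size r) (r^`(j.*2)`_i / (2 ^+ j * j`!%:R)) *: (t0%:P - 'X) ^+ j.
Proof.
rewrite /heat_extension coef_sum; apply: eq_bigr => j _.
by rewrite coefZ coef_map/= -mulrA -polyCM mulrC mul_polyC mulrC.
Qed.

Lemma heat_extension_heat (t0 : R) r : heat_poly (heat_extension t0 r).
Proof.
rewrite /heat_poly; apply/polyP => i; rewrite coefD coef_map_deriv coefZ coef0.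
rewrite coef_derivn /= add2n !coef_heat_extension.
pose c j : R := r^`(j.*2)`_i / (2 ^+ j * j`!%:R) * j%:R.
(* The j-th term contributes [- G j] to the derivative in t and [G j.+1] to half the second
   derivative in x, so the sum telescopes. [G 0] vanishes through the factor [j%:R], and
   [G (size r)] because r is differentiated beyond its degree. *)
pose G j : {poly R} := c j *: (t0%:P - 'X) ^+ j.-1.
have dX : (t0%:P - 'X)^`() = -1 :> {poly R} by rewrite derivB derivC derivX sub0r.
have F0 j : (j`!%:R : R) != 0 by rewrite pnatr_eq0 -lt0n fact_gt0.
rewrite raddf_sum/= -sumrMnl mulr_sumr -big_split/=.
rewrite (eq_bigr (fun j : 'I_(size r) => G j.+1 - G j)); last first.
  move=> j _; rewrite addrC; congr (_ + _).
    rewrite ffactnS ffactn1 mul_polyC scalerMnl scalerA /G /=; congr (_ *: _).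
    rewrite /c doubleS !derivnS !coef_deriv -mulrnA -!(mulr_natr r^`(j.*2)`_i.+2).
    rewrite -(mulr_natr (_ / _)) factS (natrM _ j.+1) exprS.
    have : (j.+1%:R : R) != 0 by rewrite pnatr_eq0.
    have := F0 j; have : (2 ^+ j : R) != 0 by rewrite expf_neq0// pnatr_eq0.
    move: (j.+1%:R : R) (j`!%:R : R) (2 ^+ j : R) ((i.+2 * i.+1)%N%:R : R) => a b d e d0 b0 a0.
    by field; rewrite a0 b0 d0.
  rewrite derivZ deriv_exp dX mulN1r mulNrn scalerN; congr (- _).
  by rewrite /G /c -[RHS]scalerA scaler_nat.
have := telescope_sumr G (leq0n (size r)); rewrite big_mkord => ->.
rewrite /G /c mulr0 scale0r subr0 coef_derivn nth_default ?mul0rn ?mul0r ?scale0r//.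
by rewrite -addnn -addnA leq_addr.
Qed.

Lemma heat_extension_bideg (t0 : R) r n : (size r <= n.+1)%N ->
  bideg_le (heat_extension t0 r) n.
Proof.
move=> sr i k; apply: contraNT; rewrite -ltnNge => nik.
rewrite coef_heat_extension coef_sum; apply/eqP; apply: big1 => j _.
rewrite coefZ; have [kj|jk] := leqP k j; last first.
  rewrite [X in _ * X]nth_default ?mulr0//.
  apply: leq_trans (size_exp_leq _ _) _.
  rewrite -opprB size_opp size_XsubC mul1n//.
rewrite coef_derivn nth_default ?mul0rn ?mul0r//.
rewrite (leq_trans sr)// (leq_trans nik)// addnC leq_add2r.
by rewrite (leq_trans kj)// -addnn leq_addr.
Qed.

End heat_polynomials.

(** * Parabolic degree *)

Section parabolic_degree.
Variable R : realType.
Implicit Types (p q : {poly {poly R}}) (t x : R).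

(** The heat equation makes the coefficient of x^(i+2) t^j a non-zero multiple of that of x^i
    t^(j+1). Trading every power of t for two powers of x ends at a monomial of total degree i + 2j,
    where the degree bound applies. *)
Lemma heat_parabolic p n : heat_poly p -> bideg_le p n ->
  forall i j : nat, (p`_i)`_j != 0 -> (i + j.*2 <= n)%N.
Proof.
move=> hp bp i j; elim: j i => [|j IH] i; first exact: bp.
move=> pij; have : (p`_i.+2)`_j != 0.
  apply: contra pij => /eqP p0.
  have := congr1 (fun r : {poly R} => r`_j) (heat_coef i hp).
  rewrite coefMn p0 mul0rn coefZ coef_deriv => /esym/eqP.
  by rewrite mulf_eq0 oppr_eq0 pnatr_eq0/= mulrn_eq0.
by move/IH; rewrite doubleS !addSn !addnS.
Qed.

(** With S = sqrt (1 + t + x^2) one has S >= 1, |x| <= S and t <= S^2, so each monomial present is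
    at most S^(i + 2j) <= S^m. *)
Lemma parabolic_bound q m :
  (forall i j : nat, (q`_i)`_j != 0 -> (i + j.*2 <= m)%N) ->
  exists2 C, 0 <= C & forall t x, 0 <= t ->
    `|bipoly_eval q t x| <= C * Num.sqrt (1 + t + x ^+ 2) ^+ m.
Proof.
move=> qm; exists (\sum_(i < size q) \sum_(j < size (q`_i)) `|(q`_i)`_j|).
  by apply: sumr_ge0 => i _; apply: sumr_ge0.
move=> t x t0; set S := Num.sqrt _.
have S20 : 0 <= 1 + t + x ^+ 2 by rewrite !addr_ge0// sqr_ge0.
have S2 : S ^+ 2 = 1 + t + x ^+ 2 by rewrite sqr_sqrtr.
have S1 : 1 <= S by rewrite -sqrtr1 ler_wsqrtr// -addrA lerDl addr_ge0// sqr_ge0.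
have xS : `|x| <= S by rewrite -sqrtr_sqr ler_wsqrtr// lerDr addr_ge0.
rewrite bipoly_evalE (@horner_coef_wide _ (size q)); last exact: size_poly.
apply: le_trans (ler_norm_sum _ _ _) _.
apply: le_trans (_ : _ <= \sum_(i < size q) (\sum_(j < size (q`_i)) `|(q`_i)`_j| * S ^+ m)) _; last first.
  by rewrite mulr_suml; apply: ler_sum => i _; rewrite mulr_suml.
apply: ler_sum => i _.
rewrite coef_map/= horner_evalE horner_coef mulr_suml.
apply: le_trans (ler_norm_sum _ _ _) _; apply: ler_sum => j _.
rewrite -mulrA normrM.
have [->|qij] := eqVneq ((q`_i)`_j) 0; first by rewrite normr0 !mul0r.
rewrite ler_wpM2l// normrM !normrX (ger0_norm t0).
apply: le_trans (_ : _ <= S ^+ (i + j.*2)) _; last by rewrite ler_weXn2l// qm.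
rewrite addnC exprD -mul2n exprM ler_pM ?exprn_ge0//.
  rewrite lerXn2r ?nnegrE ?exprn_ge0 ?(le_trans ler01 S1)// S2.
  by rewrite [1 + t]addrC -addrA lerDl addr_ge0// sqr_ge0.
by rewrite lerXn2r ?nnegrE// (le_trans ler01).
Qed.

Lemma heat_poly_deriv_bound p n : heat_poly p -> bideg_le p n -> (0 < n)%N ->
  exists2 C, 0 < C & forall t x, 0 <= t ->
    bipoly_eval p^`() t x ^+ 2 <= C * (1 + t + x ^+ 2) ^+ n.-1.
Proof.
move=> hp bp n0.
have [|C C0 HC] := @parabolic_bound p^`() n.-1.
  move=> i j; rewrite coef_deriv coefMn mulrn_eq0/= => pij.
  have := heat_parabolic hp bp pij; rewrite addSn => H.
  by rewrite -ltnS prednK.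
exists (C ^+ 2 + 1); first by rewrite ltr_wpDl// sqr_ge0.
move=> t x t0; have S20 : 0 <= 1 + t + x ^+ 2 by rewrite !addr_ge0// sqr_ge0.
apply: le_trans (_ : _ <= C ^+ 2 * (1 + t + x ^+ 2) ^+ n.-1) _; last first.
  by rewrite ler_wpM2r ?exprn_ge0// lerDl.
rewrite -(real_normK (num_real (bipoly_eval _ _ _))).
rewrite -[X in X ^+ n.-1](sqr_sqrtr S20) exprAC -exprMn.
by rewrite lerXn2r ?nnegrE ?mulr_ge0 ?exprn_ge0// HC.
Qed.

Lemma bipoly_eval_derive p t x : is_derive x 1 (bipoly_eval p t) (bipoly_eval p^`() t x).
Proof.
have -> : bipoly_eval p t = horner (map_poly (horner_eval t) p).
  by apply/funext => y; rewrite bipoly_evalE.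
rewrite bipoly_evalE -deriv_map.
exact: is_derive_poly.
Qed.

End parabolic_degree.

(** * Quadratic variation along a path *)

Lemma within_itv_continuousP (R : realType) (a b : R) (f : R -> R) :
  {within `[a, b], continuous f} <->
  (forall x, a <= x <= b -> forall e, 0 < e -> exists2 d, 0 < d &
     forall u, a <= u <= b -> `|u - x| < d -> `|f u - f x| < e).
Proof.
split.
- move=> /subspace_continuousP cf x xab e e0.
  have /cf /cvgrPdist_lt /(_ _ e0) : `[a, b]%classic x by rewrite /= in_itv.
  rewrite near_withinE => /nbhs_ballP[d d0 dP]; exists d => // u uab ux.
  rewrite distrC; apply: dP; last by rewrite /= in_itv.
  by rewrite /ball/= distrC.
- move=> H; apply/subspace_continuousP => x; rewrite /= in_itv/= => xab.
  apply/cvgrPdist_lt => e e0; have [d d0 dP] := H x xab e e0.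
  rewrite near_withinE; apply/nbhs_ballP; exists d => //= u.
  rewrite /ball/= => ux; rewrite in_itv/= => uab.
  by rewrite distrC; apply: dP => //; rewrite distrC.
Qed.

Definition halve (R : realType) (I : R * R) (c : bool) : R * R :=
  let m := (I.1 + I.2) / 2 in if c then (m, I.2) else (I.1, m).

Definition dyadic_sub (R : realType) (I : R * R) (l : seq bool) : R * R := foldl (@halve R) I l.

Lemma dyadic_sub_rcons (R : realType) (I : R * R) l c :
  dyadic_sub I (rcons l c) = halve (dyadic_sub I l) c.
Proof. by rewrite /dyadic_sub -cats1 foldl_cat. Qed.

Lemma dyadic_sub_bound (R : realType) (a b : R) l : a < b ->
  [/\ a <= (dyadic_sub (a, b) l).1, (dyadic_sub (a, b) l).2 <= b,
     (dyadic_sub (a, b) l).1 < (dyadic_sub (a, b) l).2 &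
     (dyadic_sub (a, b) l).2 - (dyadic_sub (a, b) l).1 = (b - a) / 2 ^+ size l].
Proof.
move=> ab; elim/last_ind: l => [|l c [IH1 IH2 IH3 IH4]].
  by rewrite /dyadic_sub/= expr0 divr1; split.
rewrite dyadic_sub_rcons size_rcons exprS invfM mulrA mulrAC -IH4.
by rewrite /halve; case: c => /=; split; lra.
Qed.

(* Compactness of the segment, in the form of nested halving. *)
Lemma dyadic_cousin (R : realType) (a b : R) (Q : R -> R -> Prop) : a < b ->
  (forall l, let I := dyadic_sub (a, b) l in
     Q (halve I false).1 (halve I false).2 -> Q (halve I true).1 (halve I true).2 -> Q I.1 I.2) ->
  (forall x, a <= x <= b -> exists2 d, 0 < d & forall l, let I := dyadic_sub (a, b) l in
     I.1 <= x -> x <= I.2 -> I.2 - I.1 < d -> Q I.1 I.2) ->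
  Q a b.
Proof.
move=> ab join loc; apply: contrapT => nQ.
pose bad l := ~ Q (dyadic_sub (a, b) l).1 (dyadic_sub (a, b) l).2.
(* The existential stands before the implication, so that a choice of half is defined on every list,
   bad or not. *)
have step l : exists c, bad l -> bad (rcons l c).
  have [b1|nb1] := pselect (bad (rcons l false)); first by exists false.
  exists true => bl b2; apply: bl; apply: join.
    by move/contrapT: nb1; rewrite dyadic_sub_rcons.
  by move: b2; rewrite dyadic_sub_rcons.
pose ch l := projT1 (cid (step l)).
have chP l : bad l -> bad (rcons l (ch l)) := projT2 (cid (step l)).
pose L n := iter n (fun l => rcons l (ch l)) [::].
have badL n : bad (L n) by elim: n => [|n IH] //; exact: chP.
have sL n : size (L n) = n by elim: n => [|n IH] //=; rewrite size_rcons IH.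
pose u n := (dyadic_sub (a, b) (L n)).1; pose v n := (dyadic_sub (a, b) (L n)).2.
have uv n : u n < v n by have [] := dyadic_sub_bound (L n) ab.
have uvS n : u n <= u n.+1 /\ v n.+1 <= v n.
  have := uv n; rewrite /u /v /L /= dyadic_sub_rcons /halve; case: (ch _) => /= H; split => //; lra.
have ndu : nondecreasing_seq u by apply/nondecreasing_seqP => n; have [] := uvS n.
have niv : nonincreasing_seq v by apply/nonincreasing_seqP => n; have [] := uvS n.
have ulev n m : u n <= v m.
  have [nm|mn] := leqP n m.
    by apply: le_trans (ltW (uv m)); apply: ndu.
  by apply: le_trans (ltW (uv n)) _; apply: niv; exact: ltnW.
have cu : cvgn u.
  apply: nondecreasing_is_cvgn => //; exists b => _ [n _ <-].
  by have [_ ? _ _] := dyadic_sub_bound (L 0) ab; apply: le_trans (ulev n 0) _.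
pose x := limn u.
have ux n : u n <= x by apply: nondecreasing_cvgn_le.
have xv n : x <= v n.
  by apply: limr_le => //; near=> m; exact: ulev.
have xab : a <= x <= b.
  have [? ? _ _] := dyadic_sub_bound (L 0) ab.
  by apply/andP; split; [apply: le_trans (ux 0)|apply: le_trans (xv 0) _].
have [d d0 dP] := loc x xab.
have [n nd] : exists n, (b - a) / 2 ^+ n < d.
  have : (fun n => (b - a) * (2^-1) ^+ n) @ \oo --> (b - a) * 0.
    by apply: cvgMr; apply: cvg_expr; rewrite ger0_norm// invf_lt1// ltr1n.
  rewrite mulr0 => /cvgrPdist_lt /(_ d d0) [n _ /(_ n (leqnn n))].
  rewrite sub0r normrN ger0_norm ?mulr_ge0 ?exprn_ge0 ?subr_ge0 ?(ltW ab)// exprVn => H.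
  by exists n.
apply: (badL n); apply: dP; [exact: ux|exact: xv|].
by have [_ _ _ ->] := dyadic_sub_bound (L n) ab; rewrite sL.
Unshelve. all: by end_near. Qed.

(** Pathwise form of [qv_sum]; for a fixed outcome the two are convertible. *)
Definition path_qv (R : realType) (w : R -> R) (s t : R) (k : nat) : R :=
  \sum_(i < 2 ^ k)
    (w (s + (t - s) * (i.+1)%:R / (2 ^ k)%:R) - w (s + (t - s) * (i : nat)%:R / (2 ^ k)%:R)) ^+ 2.

(** Dyadic subdivisions of a segment restrict to dyadic subdivisions of its halves; this is the
    joining step that [dyadic_cousin] asks for. *)
Lemma path_qv_halves (R : realType) (w : R -> R) (s t : R) (k : nat) :
  path_qv w s t k.+1 = path_qv w s ((s + t) / 2) k + path_qv w ((s + t) / 2) t k.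
Proof.
rewrite /path_qv expnS mul2n -addnn.
pose G (i : nat) := (w (s + (t - s) * (i.+1)%:R / (2 ^ k + 2 ^ k)%:R) - w (s + (t - s) * i%:R / (2 ^ k + 2 ^ k)%:R)) ^+ 2.
rewrite -(big_mkord xpredT G) (@big_cat_nat _ _ _ (2 ^ k))//= ?leq_addr//; congr (_ + _).
  rewrite big_mkord; apply: eq_bigr => i _; rewrite /G natrD.
  have N0 : ((2 ^ k)%:R : R) != 0 by rewrite pnatr_eq0 expn_eq0.
  by congr ((w _ - w _) ^+ 2); field; rewrite N0 -mulr2n mulrn_eq0.
rewrite -{1}[(2 ^ k)%N]add0n big_addn addnK big_mkord; apply: eq_bigr => i _; rewrite /G natrD.
rewrite -addSn !natrD.
have N0 : ((2 ^ k)%:R : R) != 0 by rewrite pnatr_eq0 expn_eq0.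
by congr ((w _ - w _) ^+ 2); field; rewrite N0 -mulr2n mulrn_eq0.
Qed.

(* Local uniformity is what lets the remainders be summed along a path; differentiability
   in [t] is not needed. *)
Definition local_expansion (R : realType) (F D : R -> R -> R) (s t : R) : Prop :=
  forall K, 0 <= K -> exists2 L, 0 <= L & forall u v x y,
    s <= u <= t -> s <= v <= t -> `|x| <= K -> `|y| <= K ->
    `|F v y - F u x - D u x * (y - x)| <= L * ((y - x) ^+ 2 + `|v - u|).

Section local_expansion.
Variables (R : realType) (F D : R -> R -> R) (s t : R).
Hypothesis FD : local_expansion F D s t.

(** In x, adding the expansions from x to y and from y to x gives a Lipschitz bound. In t, the
    slopes at u and v are compared through difference quotients with step e = sqrt |v - u|, where
    four errors of size L e^2, divided by e, leave 4 L e. Hence D is Lipschitz in x and Hölder of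
    exponent 1/2 in t. *)
Lemma local_expansion_modulus (K : R) : 0 <= K -> exists2 L, 0 <= L & forall u v x y,
  s <= u <= t -> s <= v <= t -> `|v - u| <= 1 -> `|x| <= K -> `|y| <= K ->
  `|D v y - D u x| <= L * (`|y - x| + Num.sqrt `|v - u|).
Proof.
move=> K0; have [L L0 FL] := FD (addr_ge0 K0 ler01).
have wK (z : R) : `|z| <= K -> `|z| <= K + 1 by move/le_trans; apply; rewrite lerDl.
have Dx u x y : s <= u <= t -> `|x| <= K -> `|y| <= K -> `|D u y - D u x| <= 2 * L * `|y - x|.
  move=> ut xK yK; have [->|xy] := eqVneq y x; first by rewrite !subrr normr0 mulr0.
  have A := FL u u x y ut ut (wK _ xK) (wK _ yK).
  have B := FL u u y x ut ut (wK _ yK) (wK _ xK).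
  have p0 : 0 < `|y - x| by rewrite normr_gt0 subr_eq0.
  rewrite -(ler_pM2r p0) -normrM -[leRHS]mulrA -expr2 real_normK ?num_real//.
  rewrite !subrr !normr0 !addr0 -(opprB y x) sqrrN in A B.
  apply: le_trans (_ : _ <= L * (y - x) ^+ 2 + L * (y - x) ^+ 2) _; last by lra.
  apply: le_trans (lerD A B).
  by apply: le_trans (ler_normD _ _); rewrite le_eqVlt; apply/orP; left; apply/eqP; congr `|_|; ring.
have Dt u v x : s <= u <= t -> s <= v <= t -> `|v - u| <= 1 -> `|x| <= K ->
    `|D v x - D u x| <= 4 * L * Num.sqrt `|v - u|.
  move=> ut vt uv1 xK; have [->|uv] := eqVneq v u.
    by rewrite !subrr normr0 sqrtr0 mulr0.
  set e := Num.sqrt `|v - u|.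
  have e0 : 0 < e by rewrite sqrtr_gt0 normr_gt0 subr_eq0.
  have ee : e ^+ 2 = `|v - u| by rewrite sqr_sqrtr.
  have e1 : e <= 1 by rewrite -sqrtr1 ler_wsqrtr.
  have xeK : `|x + e| <= K + 1.
    by apply: le_trans (ler_normD _ _) _; rewrite (gtr0_norm e0) lerD.
  have A := FL v v x (x + e) vt vt (wK _ xK) xeK.
  have B := FL u u x (x + e) ut ut (wK _ xK) xeK.
  have C1 := FL u v (x + e) (x + e) ut vt xeK xeK.
  have C2 := FL u v x x ut vt (wK _ xK) (wK _ xK).
  rewrite !subrr !normr0 ?addr0 ?expr0n ?mulr0 ?subr0 ?add0r -?ee (addrC x) addrK in A B C1 C2.
  rewrite -(ler_pM2r e0) -{1}(gtr0_norm e0) -normrM.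
  have -> : (D v x - D u x) * e = (F v (e + x) - F u (e + x)) - (F v x - F u x)
     + (F u (e + x) - F u x - D u x * e) - (F v (e + x) - F v x - D v x * e) by ring.
  apply: le_trans (ler_normB _ _) _; apply: le_trans (lerD (ler_normD _ _) A) _.
  apply: le_trans (lerD (lerD (ler_normB _ _) B) (lexx _)) _.
  apply: le_trans (lerD (lerD (lerD C1 C2) (lexx _)) (lexx _)) _.
  by rewrite le_eqVlt; apply/orP; left; apply/eqP; ring.
exists (4 * L); first by rewrite mulr_ge0.
move=> u v x y ut vt uv1 xK yK; rewrite -(subrK (D v x) (D v y)) -addrA.
apply: le_trans (ler_normD _ _) _; rewrite mulrDr lerD ?Dt//.
apply: le_trans (Dx _ _ _ vt xK yK) _.
by rewrite ler_wpM2r//; lra.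
Qed.

Lemma local_expansion_derive (u x : R) : s <= u <= t -> is_derive x 1 (F u) (D u x).
Proof.
move=> ut; have [L L0 FL] := FD (addr_ge0 (normr_ge0 x) ler01).
have C : (fun h => h^-1 *: (F u (h + x) - F u x)) @ 0^' --> D u x.
  apply/cvgrPdist_le => e e0; near=> h.
  have h0 : h != 0 by near: h; exact: nbhs_dnbhs_neq.
  have h1 : `|h| <= 1 by near: h; apply: dnbhs0_le.
  have hL : L * `|h| <= e.
    have hd : `|h| <= e / (L + 1) by near: h; apply: dnbhs0_le; rewrite divr_gt0// ltr_wpDl.
    apply: le_trans (_ : _ <= (L + 1) * `|h|) _; first by rewrite ler_wpM2r// lerDl.
    by rewrite mulrC -ler_pdivlMr// ltr_wpDl.
  have xh : `|h + x| <= `|x| + 1 by rewrite addrC (le_trans (ler_normD _ _))// lerD2l.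
  have x1 : `|x| <= `|x| + 1 by rewrite lerDl.
  have := FL u u x (h + x) ut ut x1 xh.
  rewrite subrr normr0 addr0 addrK => A.
  have -> : D u x - h^-1 *: (F u (h + x) - F u x) = - h^-1 * (F u (h + x) - F u x - D u x * h).
    by rewrite /GRing.scale/=; field.
  rewrite normrM normrN normfV mulrC ler_pdivrMr ?normr_gt0//.
  apply: le_trans A _; rewrite -(real_normK (num_real h)) expr2 mulrA.
  by rewrite ler_wpM2r.
have E : (fun h : R => h^-1 *: ((F u \o shift x) (h *: (1 : R)) - F u x)) =
    (fun h => h^-1 *: (F u (h + x) - F u x)).
  by apply/funext => h /=; rewrite [h *: 1]mulr1.
apply: DeriveDef.
- by apply/cvg_ex; exists (D u x); rewrite E.
- by rewrite /derive E; apply: cvg_lim C.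
Unshelve. all: by end_near. Qed.

End local_expansion.

Section continuous_on_segment.
Context {R : realType}.
Implicit Types (a b m : R) (f : R -> R).

Lemma within_continuous_bounded a b f : a <= b -> {within `[a, b], continuous f} ->
  exists2 K, 0 <= K & forall u, a <= u <= b -> `|f u| <= K.
Proof.
move=> ab cf.
have cnf : {within `[a, b], continuous (fun u => `|f u|)}.
  apply/within_itv_continuousP => x xab e e0.
  have [d d0 dP] := (within_itv_continuousP a b f).1 cf x xab e e0.
  by exists d => // u uab ux; apply: le_lt_trans (ler_dist_dist _ _) (dP u uab ux).
by have [c _ cP] := EVT_max ab cnf; exists `|f c|.
Qed.

Lemma within_continuous_integrable a b f : {within `[a, b], continuous f} ->
  mu.-integrable `[a, b] (EFin \o f).
Proof. by move=> cf; apply: continuous_compact_integrable => //; exact: segment_compact. Qed.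

Lemma Rintegral_segment_cat a m b f : a <= m -> m <= b -> {within `[a, b], continuous f} ->
  \int[mu]_(x in `[a, b]) f x = \int[mu]_(x in `[a, m]) f x + \int[mu]_(x in `[m, b]) f x.
Proof.
move=> am mb cf; have fi := within_continuous_integrable cf.
apply/eqP; rewrite addrC -subr_eq; apply/eqP.
rewrite (@Rintegral_itvB _ f (BLeft a) (BRight b) m)// ?bnd_simp//.
rewrite Rintegral_itv_obnd_cbnd//.
apply: integrableS fi => //; apply: subset_itv; rewrite bnd_simp//.
Qed.

Lemma Rintegral_segment_close a b f (c e : R) : a <= b -> {within `[a, b], continuous f} ->
  (forall u, a <= u <= b -> `|f u - c| <= e) ->
  `|\int[mu]_(x in `[a, b]) f x - c * (b - a)| <= e * (b - a).
Proof.
move=> ab cf fc; have fi := within_continuous_integrable cf.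
have mE : fine (mu `[a, b]%classic) = b - a.
  by rewrite lebesgue_measure_itv/= lte_fin; case: ltgtP ab => // ->; rewrite subrr.
have ci (k : R) : mu.-integrable `[a, b] (EFin \o (fun=> k)).
  by apply: within_continuous_integrable => x; exact: cvg_cst.
rewrite -mE -!(Rintegral_cst mu)// -RintegralB//.
apply: le_trans (le_normr_Rintegral _ _) _ => //.
  by apply: eq_integrable (integrableB _ fi (ci c)) => // x _ /=; rewrite EFinB.
apply: le_Rintegral => //.
apply: (@integrable_norm _ _ _ mu `[a, b]%classic (fun t => f t - c)).
by apply: eq_integrable (integrableB _ fi (ci c)) => // x _ /=; rewrite EFinB.
Qed.

End continuous_on_segment.

Section path_quadratic_variation.
Context {R : realType}.
Variables (F D : R -> R -> R) (w : R -> R).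

(** Here c is a frozen value of D^2. For an increment X = d Y + r of F along the path, X^2 - c Y^2 =
    (d^2 - c) Y^2 + 2 d Y r + r^2, with |r| <= L q and q = Y^2 + dl; the three terms give the three
    parts of the coefficient. *)
Lemma path_qv_block (s t L B c e : R) (k : nat) : s < t -> 0 <= L -> 0 <= e ->
  (forall u v, s <= u <= t -> s <= v <= t -> `|w v - w u| <= e /\
    `|F v (w v) - F u (w u) - D u (w u) * (w v - w u)| <= L * ((w v - w u) ^+ 2 + `|v - u|)) ->
  (forall u, s <= u <= t -> `|D u (w u)| <= B /\ `|D u (w u) ^+ 2 - c| <= e) ->
  `|path_qv (fun u => F u (w u)) s t k - c * path_qv w s t k| <=
  (e + 2 * B * L * e + L ^+ 2 * (e ^+ 2 + (t - s))) * (path_qv w s t k + (t - s)).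
Proof.
move=> st L0 e0 wF Dc; set kappa := _ + L ^+ 2 * _.
pose T (i : nat) := s + (t - s) * i%:R / (2 ^ k)%:R.
have N0 : 0 < ((2 ^ k)%:R : R) by rewrite ltr0n expn_gt0.
pose dl := (t - s) / (2 ^ k)%:R.
have dl0 : 0 <= dl by rewrite divr_ge0 ?(ltW N0)// subr_ge0 ltW.
have dlst : dl <= t - s.
  by rewrite ler_pdivrMr// ler_peMr ?subr_ge0 ?(ltW st)// ler1n expn_gt0.
have Tst (i : nat) : (i <= 2 ^ k)%N -> s <= T i <= t.
  move=> ik; rewrite /T lerDl mulr_ge0 ?invr_ge0 ?(ltW N0) ?mulr_ge0 ?subr_ge0 ?(ltW st)//=.
  by rewrite -lerBrDl ler_pdivrMr// ler_wpM2l ?ler_nat// subr_ge0 ltW.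
have TS i : T i.+1 - T i = dl.
  by rewrite /T /dl -natr1; field; rewrite gt_eqF.
have -> : path_qv w s t k + (t - s) = \sum_(i < 2 ^ k) ((w (T i.+1) - w (T i)) ^+ 2 + dl).
  rewrite big_split/=; congr (_ + _).
  by rewrite sumr_const card_ord -mulr_natr /dl divfK// gt_eqF.
rewrite /path_qv mulr_sumr -sumrB mulr_sumr.
apply: le_trans (ler_norm_sum _ _ _) _; apply: ler_sum => i _.
rewrite -!/(T _); set u := T i; set v := T i.+1.
have ust : s <= u <= t by apply: Tst; exact: ltnW.
have vst : s <= v <= t by exact: Tst.
have [we Fe] := wF u v ust vst; have [DB De] := Dc u ust.
rewrite TS (ger0_norm dl0) in Fe.
move: (F v (w v) - F u (w u)) (w v - w u) (D u (w u)) we Fe DB De => X Y d Ye Xd dB dc.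
have B0 : 0 <= B by apply: le_trans dB.
set r := X - d * Y in Xd.
have -> : X ^+ 2 - c * Y ^+ 2 = (d ^+ 2 - c) * Y ^+ 2 + (2 * d * Y * r + r ^+ 2).
  by rewrite /r; ring.
set q := Y ^+ 2 + dl in Xd *.
have q0 : 0 <= q by rewrite addr_ge0// sqr_ge0.
have Y2 : Y ^+ 2 <= e ^+ 2 by rewrite -(real_normK (num_real Y)) lerXn2r ?nnegrE.
apply: le_trans (ler_normD _ _) _; apply: le_trans (lerD (lexx _) (ler_normD _ _)) _.
have -> : kappa * q = e * q + (2 * B * L * e * q + L ^+ 2 * (e ^+ 2 + (t - s)) * q).
  by rewrite /kappa; ring.
rewrite lerD//; first last.
  apply: lerD.
    rewrite !normrM (ger0_norm (ler0n _ 2)).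
    apply: le_trans (_ : _ <= 2 * B * e * (L * q)) _; last by rewrite le_eqVlt; apply/orP; left; apply/eqP; ring.
    by rewrite !ler_pM// ?mulr_ge0.
  rewrite normrX; apply: le_trans (_ : _ <= (L * q) ^+ 2) _.
    by rewrite lerXn2r ?nnegrE ?mulr_ge0.
  rewrite exprMn -[leRHS]mulrA ler_wpM2l ?sqr_ge0// expr2 ler_wpM2r//.
  by rewrite /q lerD.
rewrite normrM (ger0_norm (sqr_ge0 Y)) ler_pM ?sqr_ge0//.
by rewrite /q lerDl.
Qed.

Variables (a b : R).
Hypotheses (ab : a < b) (FD : local_expansion F D a b).
Hypothesis cw : {within `[a, b], continuous w}.

Lemma path_derivative_continuous : {within `[a, b], continuous (fun u => D u (w u))}.
Proof.
have [K K0 wK] := within_continuous_bounded (ltW ab) cw.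
have [L L0 DL] := local_expansion_modulus FD K0.
apply/within_itv_continuousP => x xab e e0.
pose e1 := e / (2 * (L + 1)).
have L1 : 0 < L + 1 by rewrite ltr_wpDl.
have e10 : 0 < e1 by rewrite divr_gt0// mulr_gt0.
have [d d0 dP] := (within_itv_continuousP a b w).1 cw x xab e1 e10.
exists (Num.min d (Num.min 1 (e1 ^+ 2))).
  by rewrite !lt_min d0 ltr01 exprn_gt0.
move=> u uab; rewrite !lt_min => /andP[ud /andP[u1 ue]].
apply: le_lt_trans (DL _ _ _ _ xab uab (ltW u1) (wK _ xab) (wK _ uab)) _.
have s1 : Num.sqrt `|u - x| <= e1.
  by apply: le_trans (ler_wsqrtr (ltW ue)) _; rewrite sqrtr_sqr (gtr0_norm e10).
have e1E : 2 * (L + 1) * e1 = e by rewrite /e1; field; rewrite gt_eqF.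
have w1 := dP u uab ud.
apply: le_lt_trans (_ : _ <= L * (e1 + e1)) _.
  by rewrite ler_wpM2l// lerD// ltW.
nra.
Qed.

Hypothesis qvw : forall l, let I := dyadic_sub (a, b) l in
  path_qv w I.1 I.2 @ \oo --> I.2 - I.1.

(** The error allowed on a segment is proportional to its length, hence additive under halving, so
    by [dyadic_cousin] only short dyadic segments around each point matter. There D^2 is almost
    constant, and the quadratic variation of w tends to the length. *)
Lemma path_qv_cvg : path_qv (fun u => F u (w u)) a b @ \oo -->
  \int[mu]_(u in `[a, b]) (D u (w u) ^+ 2).
Proof.
have cd := path_derivative_continuous.
have [K K0 wK] := within_continuous_bounded (ltW ab) cw.
have [B B0 dB] := within_continuous_bounded (ltW ab) cd.
have [L L0 FL] := FD K0.
pose c u := D u (w u) ^+ 2.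
have cc : {within `[a, b], continuous c}.
  move=> x; have := cd x; move=> H; exact: (continuousM H H).
have subc s t : a <= s -> t <= b -> {within `[s, t], continuous c}.
  by move=> as_ tb; apply: continuous_subspaceW cc; apply: subset_itv; rewrite bnd_simp.
apply/cvgrPdist_le => e e0.
pose e' := e / (b - a).
have ba0 : 0 < b - a by rewrite subr_gt0.
have e'0 : 0 < e' by rewrite divr_gt0.
pose Q s t := exists N, forall k, (N <= k)%N ->
  `|path_qv (fun u => F u (w u)) s t k - \int[mu]_(u in `[s, t]) c u| <= e' * (t - s).
suff [N NP] : Q a b.
  exists N => // k /= Nk; rewrite distrC; apply: le_trans (NP k Nk) _.
  by rewrite /e' divfK// gt_eqF.
apply: (dyadic_cousin ab).
- move=> l I [N1 P1] [N2 P2]; exists (maxn N1 N2).+1 => -[//|k].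
  rewrite ltnS geq_max => /andP[k1 k2].
  have [I1 I2 I3 _] := dyadic_sub_bound l ab; rewrite -/I in I1 I2 I3.
  have {P1} := P1 k k1; have {P2} := P2 k k2; rewrite /halve/= => P2 P1.
  set m := (I.1 + I.2) / 2 in P1 P2 *.
  have m1 : I.1 <= m by rewrite /m; lra.
  have m2 : m <= I.2 by rewrite /m; lra.
  rewrite path_qv_halves (Rintegral_segment_cat m1 m2 (subc _ _ I1 I2)) opprD addrACA.
  apply: le_trans (ler_normD _ _) _; apply: le_trans (lerD P1 P2) _.
  by rewrite -mulrDr addrC subrKA.
move=> x xab.
(* [e1 * k0] bounds the coefficient of [path_qv_block] when e1 <= 1 and the segment is shorter than
   e1. In the denominator of e1, the factor 3 comes from q + length <= 3 length, while [B ^+ 2] and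
   1 pay for replacing q by the length and the integral by its frozen value. *)
pose k0 := 1 + 2 * B * L + 2 * L ^+ 2.
pose e1 := Num.min 1 (e' / (3 * k0 + B ^+ 2 + 1)).
have k00 : 0 <= k0 by rewrite /k0 !addr_ge0 ?mulr_ge0 ?sqr_ge0.
have den0 : 0 < 3 * k0 + B ^+ 2 + 1 by rewrite ltr_wpDl// addr_ge0 ?sqr_ge0 ?mulr_ge0.
have e10 : 0 < e1 by rewrite lt_min ltr01 divr_gt0.
have e11 : e1 <= 1 by rewrite ge_min lexx.
have e1e : e1 * (3 * k0 + B ^+ 2 + 1) <= e'.
  by rewrite -ler_pdivlMr// ge_min lexx orbT.
have e120 : 0 < e1 / 2 by rewrite divr_gt0.
have [d1 d10 d1P] := (within_itv_continuousP a b w).1 cw x xab _ e120.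
have [d2 d20 d2P] := (within_itv_continuousP a b c).1 cc x xab _ e120.
exists (Num.min e1 (Num.min d1 d2)).
  by rewrite lt_min; apply/andP; split=> //; rewrite lt_min d10.
move=> l I Ix xI; rewrite lt_min => /andP[Ie]; rewrite lt_min => /andP[Id1 Id2].
have [I1 I2 I3 _] := dyadic_sub_bound l ab; rewrite -/I in I1 I2 I3.
have sub u : I.1 <= u <= I.2 -> a <= u <= b.
  by move=> /andP[? ?]; apply/andP; split; [apply: le_trans I1 _|apply: le_trans I2].
have dist u : I.1 <= u <= I.2 -> `|u - x| <= I.2 - I.1.
  move=> /andP[? ?]; rewrite ler_norml opprB; apply/andP; split; apply: lerB => //.
have I11 : I.1 <= I.1 <= I.2 by rewrite lexx ltW.
have oscw u v : I.1 <= u <= I.2 -> I.1 <= v <= I.2 -> `|w v - w u| <= e1.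
  move=> uI vI; have A := d1P u (sub u uI) (le_lt_trans (dist u uI) Id1).
  have C := d1P v (sub v vI) (le_lt_trans (dist v vI) Id1).
  by rewrite (splitr e1) (le_trans (ler_distD (w x) _ _))// lerD ?(ltW C)// distrC ltW.
have oscc u : I.1 <= u <= I.2 -> `|c u - c I.1| <= e1.
  move=> uI; have A := d2P u (sub u uI) (le_lt_trans (dist u uI) Id2).
  have C := d2P I.1 (sub _ I11) (le_lt_trans (dist _ I11) Id2).
  by rewrite (splitr e1) (le_trans (ler_distD (c x) _ _))// lerD ?(ltW A)// distrC ltW.
have dI0 : 0 < I.2 - I.1 by rewrite subr_gt0.
have edI : 0 < e1 * (I.2 - I.1) by rewrite mulr_gt0.
have qvl : path_qv w I.1 I.2 @ \oo --> I.2 - I.1 := @qvw l.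
have /cvgrPdist_le /(_ _ edI) [N _ NP] := qvl.
exists N => k Nk; have {NP} := NP k Nk; rewrite -/I distrC.
set q := path_qv w I.1 I.2 k => qI.
have int : `|\int[mu]_(u in `[I.1, I.2]) c u - c I.1 * (I.2 - I.1)| <= e1 * (I.2 - I.1).
  by apply: Rintegral_segment_close; [exact: ltW|exact: subc|].
have blk : `|path_qv (fun u => F u (w u)) I.1 I.2 k - c I.1 * q| <=
    (e1 + 2 * B * L * e1 + L ^+ 2 * (e1 ^+ 2 + (I.2 - I.1))) * (q + (I.2 - I.1)).
  apply: path_qv_block => //; first exact: ltW.
    by move=> u v uI vI; split; [exact: oscw|apply: FL; rewrite ?sub ?wK ?sub].
  by move=> u uI; split; [exact: dB (sub _ uI)|exact: oscc].
have cB : `|c I.1| <= B ^+ 2.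
  by rewrite normrX lerXn2r ?nnegrE// dB// sub.
have q2 : q <= 2 * (I.2 - I.1).
  move: qI; rewrite ler_distl => /andP[_ H]; apply: le_trans H _.
  by rewrite mulr2n mulrDl mul1r lerD2l// ler_piMl// ltW.
have -> : path_qv (fun u => F u (w u)) I.1 I.2 k - \int[mu]_(u in `[I.1, I.2]) c u =
  (path_qv (fun u => F u (w u)) I.1 I.2 k - c I.1 * q) + c I.1 * (q - (I.2 - I.1))
  - (\int[mu]_(u in `[I.1, I.2]) c u - c I.1 * (I.2 - I.1)) by ring.
apply: le_trans (ler_normB _ _) _; apply: le_trans (lerD (ler_normD _ _) int) _.
apply: le_trans (lerD (lerD blk (lexx _)) (lexx _)) _.
apply: le_trans (_ : _ <= (e1 * k0) * (3 * (I.2 - I.1)) + B ^+ 2 * (e1 * (I.2 - I.1)) + e1 * (I.2 - I.1)) _; last first.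
  apply: le_trans (_ : _ <= (e1 * (3 * k0 + B ^+ 2 + 1)) * (I.2 - I.1)) _; last by rewrite ler_wpM2r// ltW.
  by rewrite le_eqVlt; apply/orP; left; apply/eqP; ring.
rewrite lerD2r lerD//; last by rewrite normrM ler_pM.
have q0 : 0 <= q by apply: sumr_ge0 => i _; exact: sqr_ge0.
apply: ler_pM => //.
- by rewrite !addr_ge0 ?mulr_ge0 ?sqr_ge0 ?(ltW e10) ?(ltW dI0)// addr_ge0 ?sqr_ge0 ?(ltW dI0).
- by rewrite addr_ge0 ?(ltW dI0).
- have e12 : e1 ^+ 2 <= e1 by rewrite expr2 ler_piMl// ltW.
  have Lq : L ^+ 2 * (e1 ^+ 2 + (I.2 - I.1)) <= L ^+ 2 * (e1 + e1).
    by rewrite ler_wpM2l ?sqr_ge0// lerD// ltW.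
  apply: le_trans (lerD (lexx _) Lq) _.
  by rewrite le_eqVlt /k0; apply/orP; left; apply/eqP; ring.
- apply: le_trans (lerD q2 (lexx _)) _.
  by rewrite le_eqVlt; apply/orP; left; apply/eqP; ring.
Qed.

End path_quadratic_variation.

(** * The heat kernel *)

Section gauss_kernel.
Variable R : realType.
Implicit Types (b x y : R).

Lemma expR_sub_le (p q r : R) : r <= p -> r <= q ->
  `|expR (- p) - expR (- q)| <= `|p - q| * expR (- r).
Proof.
wlog pq : p q / p <= q => [H|].
  case: (leP p q) => [/H//|/ltW qp] rp rq.
  by rewrite distrC (distrC p); apply: H.
move=> rp rq; rewrite ger0_norm ?subr_ge0 ?ler_expR ?lerN2// distrC ger0_norm ?subr_ge0//.
have -> : expR (- p) - expR (- q) = (1 - expR (- (q - p))) * expR (- p).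
  by rewrite mulrBl mul1r -expRD; congr (_ - expR _); ring.
rewrite ler_pM ?expR_ge0 ?ler_expR ?lerN2//.
  by rewrite subr_ge0 -expR0 ler_expR oppr_le0 subr_ge0.
by have := expR_ge1Dx (- (q - p)); lra.
Qed.

Lemma expR_order2 (v : R) : `|expR v - 1 - v| <= v ^+ 2 * expR `|v|.
Proof.
have := expR_taylor 2 v.
by rewrite !big_nat_recr//= big_geq// add0r expr0 expr1 fact0 !divr1 opprD addrA real_normK ?num_real.
Qed.

Variables (b0 b1 K : R).
Hypotheses (b00 : 0 <= b0) (K0 : 0 <= K).

Let c := 2 + 4 * b1 * K + 2 * b1 * K.

(** A single majorant in y for all kernels with b in [b0, b1] and |x| <= K, and for their expansion
    errors. Of the terms of [c], 2 absorbs polynomial factors, 4 b1 K the exponential of the change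
    of exponent, and 2 b1 K the cross term of (y - x)^2. *)
Definition kernel_bound y := expR (c * (`|y| + 2 * K)) * expR (- (b0 * y ^+ 2)).

Lemma kernel_le b x y : b0 <= b -> b <= b1 -> `|x| <= K ->
  expR (- (b * (y - x) ^+ 2)) <= expR (2 * b1 * K * `|y|) * expR (- (b0 * y ^+ 2)).
Proof.
move=> bb bb1 xK; rewrite -expRD ler_expR.
have A : b0 * (y - x) ^+ 2 <= b * (y - x) ^+ 2 by rewrite ler_wpM2r// sqr_ge0.
apply: le_trans (_ : _ <= - (b0 * (y - x) ^+ 2)) _; first by rewrite lerN2.
have -> : - (b0 * (y - x) ^+ 2) = b0 * (2 * (x * y)) - b0 * x ^+ 2 - b0 * y ^+ 2 by ring.
rewrite lerD2r; apply: le_trans (_ : _ <= b0 * (2 * (x * y))) _.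
  by rewrite gerBl mulr_ge0// sqr_ge0.
apply: le_trans (_ : _ <= b1 * (2 * (K * `|y|))) _; last first.
  by rewrite le_eqVlt; apply/orP; left; apply/eqP; ring.
apply: le_trans (_ : _ <= b0 * (2 * (K * `|y|))) _.
  rewrite ler_wpM2l// ler_wpM2l//; apply: le_trans (ler_norm _) _.
  by rewrite normrM ler_wpM2r.
by rewrite ler_wpM2r ?mulr_ge0// (le_trans bb).
Qed.

Lemma kernel_poly_le b x y : b0 <= b -> b <= b1 -> `|x| <= K ->
  expR (2 * (`|y| + 2 * K)) * expR (- (b * (y - x) ^+ 2)) <= kernel_bound y.
Proof.
move=> bb bb1 xK; rewrite /kernel_bound.
apply: le_trans (ler_wpM2l (expR_ge0 _) (kernel_le y bb bb1 xK)) _.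
rewrite mulrA ler_wpM2r ?expR_ge0// -expRD ler_expR.
have Y0 := normr_ge0 y; have b10 : 0 <= b1 by rewrite (le_trans b00)// (le_trans bb).
have bK : 0 <= b1 * K by rewrite mulr_ge0.
have bKY : 0 <= b1 * K * `|y| by rewrite mulr_ge0.
have bKK : 0 <= b1 * K * K by rewrite mulr_ge0.
rewrite /c; nra.
Qed.

Lemma sqr_le_expR (z : R) : 0 <= z -> z ^+ 2 <= expR (2 * z).
Proof.
move=> z0; have z1 : z <= expR z by apply: le_trans (expR_ge1Dx z); rewrite lerDr.
have -> : expR (2 * z) = expR z ^+ 2 by rewrite expRM_natl.
by rewrite lerXn2r ?nnegrE ?expR_ge0.
Qed.

(** The parameters are changed one at a time. [P1] moves b at the point x', where a Lipschitz bound
    suffices; [P2] moves x at fixed b, where the exponent changes by v and the exponential is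
    expanded to second order in v. *)
Lemma kernel_expansion b b' x x' y : b0 <= b -> b <= b1 -> b0 <= b' -> b' <= b1 ->
  `|x| <= K -> `|x'| <= K ->
  `|expR (- (b' * (y - x') ^+ 2)) - expR (- (b * (y - x) ^+ 2))
     - 2 * b * (y - x) * expR (- (b * (y - x) ^+ 2)) * (x' - x)|
  <= ((x' - x) ^+ 2 + `|b' - b|) * ((1 + b1 + 4 * b1 ^+ 2) * kernel_bound y).
Proof.
move=> bb bb1 bb' bb1' xK xK'.
have b10 : 0 <= b1 by rewrite (le_trans b00)// (le_trans bb).
have b0' : 0 <= b by rewrite (le_trans b00).
set Y := `|y|; have Y0 : 0 <= Y by exact: normr_ge0.
have yx z : `|z| <= K -> `|y - z| <= Y + K.
  by move=> zK; rewrite (le_trans (ler_normB _ _))// lerD2l.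
set k := expR (- (b * (y - x) ^+ 2)).
have -> : expR (- (b' * (y - x') ^+ 2)) - k - 2 * b * (y - x) * k * (x' - x) =
  (expR (- (b' * (y - x') ^+ 2)) - expR (- (b * (y - x') ^+ 2))) +
  (expR (- (b * (y - x') ^+ 2)) - k - 2 * b * (y - x) * k * (x' - x)) by ring.
have P1 : `|expR (- (b' * (y - x') ^+ 2)) - expR (- (b * (y - x') ^+ 2))|
    <= `|b' - b| * kernel_bound y.
  apply: le_trans (expR_sub_le (r := b0 * (y - x') ^+ 2) _ _) _; rewrite ?ler_wpM2r ?sqr_ge0//.
  rewrite -mulrBl normrM (ger0_norm (sqr_ge0 _)) -mulrA ler_wpM2l//.
  apply: le_trans (kernel_poly_le y (lexx b0) (le_trans bb bb1) xK').
  rewrite ler_wpM2r ?expR_ge0//; apply: le_trans (sqr_le_expR _); rewrite ?addr_ge0 ?mulr_ge0//.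
  rewrite -(real_normK (num_real (y - x'))) lerXn2r ?nnegrE ?addr_ge0 ?mulr_ge0//.
  by apply: le_trans (yx _ xK') _; rewrite lerD2l ler_peMl// ler1n.
have P2 : `|expR (- (b * (y - x') ^+ 2)) - k - 2 * b * (y - x) * k * (x' - x)| <=
    (x' - x) ^+ 2 * ((b1 + 4 * b1 ^+ 2) * kernel_bound y).
  set dl := x' - x; pose v := 2 * b * (y - x) * dl - b * dl ^+ 2.
  have -> : expR (- (b * (y - x') ^+ 2)) = k * expR v.
    by rewrite /k -expRD; congr expR; rewrite /v /dl; ring.
  have -> : k * expR v - k - 2 * b * (y - x) * k * dl = k * ((expR v - 1 - v) - b * dl ^+ 2).
    by rewrite /v; ring.
  have dlK : `|dl| <= 2 * K by rewrite (le_trans (ler_normB _ _))//; lra.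
  set Z := Y + 2 * K; have Z0 : 0 <= Z by rewrite addr_ge0 ?mulr_ge0.
  have vE : v = b * dl * (2 * (y - x) - dl) by rewrite /v; ring.
  have vz : `|2 * (y - x) - dl| <= 2 * Z.
    apply: le_trans (ler_normB _ _) _; rewrite normrM (ger0_norm (ler0n _ 2)).
    have := yx _ xK; rewrite /Z; lra.
  have v2 : v ^+ 2 <= dl ^+ 2 * (4 * b1 ^+ 2 * expR (2 * Z)).
    have -> : v ^+ 2 = dl ^+ 2 * (b ^+ 2 * (2 * (y - x) - dl) ^+ 2) by rewrite vE; ring.
    rewrite ler_wpM2l ?sqr_ge0//.
    rewrite (_ : 4 * b1 ^+ 2 * expR (2 * Z) = b1 ^+ 2 * (4 * expR (2 * Z))); last by ring.
    apply: ler_pM; rewrite ?sqr_ge0//; first by rewrite lerXn2r ?nnegrE.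
    apply: (@le_trans _ _ (4 * Z ^+ 2)); last by rewrite ler_wpM2l// sqr_le_expR.
    rewrite -(real_normK (num_real (2 * (y - x) - dl))).
    have -> : 4 * Z ^+ 2 = (2 * Z) ^+ 2 by ring.
    by rewrite lerXn2r ?nnegrE ?mulr_ge0.
  have va : `|v| <= 4 * b1 * K * Z.
    rewrite vE !normrM (ger0_norm b0').
    apply: le_trans (_ : _ <= b1 * (2 * K) * (2 * Z)) _; last by rewrite le_eqVlt; apply/orP; left; apply/eqP; ring.
    by rewrite !ler_pM ?mulr_ge0.
  rewrite normrM (ger0_norm (expR_ge0 _)).
  have D0 : 0 <= dl ^+ 2 by exact: sqr_ge0.
  have N : `|expR v - 1 - v - b * dl ^+ 2| <= dl ^+ 2 * ((b1 + 4 * b1 ^+ 2) * expR ((2 + 4 * b1 * K) * Z)).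
    apply: le_trans (ler_normB _ _) _; rewrite mulrDl mulrDr addrC lerD//.
      rewrite normrM (ger0_norm b0') (ger0_norm D0) mulrC ler_wpM2l//.
      rewrite -[leLHS]mulr1 ler_pM// -expR0 ler_expR mulr_ge0// addr_ge0 ?mulr_ge0//.
    apply: le_trans (expR_order2 v) _.
    apply: le_trans (ler_pM (sqr_ge0 _) (expR_ge0 _) v2 (_ : _ <= expR (4 * b1 * K * Z))) _.
      by rewrite ler_expR.
    rewrite (_ : expR ((2 + 4 * b1 * K) * Z) = expR (2 * Z) * expR (4 * b1 * K * Z)).
      by rewrite le_eqVlt; apply/orP; left; apply/eqP; ring.
    by rewrite -expRD; congr expR; ring.
  apply: le_trans (ler_wpM2l (expR_ge0 _) N) _.
  rewrite mulrCA ler_wpM2l// mulrCA ler_wpM2l ?addr_ge0 ?mulr_ge0 ?sqr_ge0//.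
  apply: le_trans (ler_wpM2r (expR_ge0 _) (kernel_le y bb bb1 xK)) _.
  rewrite /kernel_bound mulrAC ler_wpM2r ?expR_ge0// -expRD ler_expR -/Y -/Z.
  have YZ : 2 * b1 * K * Y <= 2 * b1 * K * Z.
    by rewrite ler_wpM2l ?mulr_ge0// /Z lerDl mulr_ge0.
  rewrite (_ : c * Z = (2 + 4 * b1 * K) * Z + 2 * b1 * K * Z); last by rewrite /c; ring.
  by rewrite addrC; exact: (lerD (lexx _) YZ).
apply: le_trans (ler_normD _ _) _; apply: le_trans (lerD P1 P2) _.
have KB : 0 <= kernel_bound y by rewrite mulr_ge0 ?expR_ge0.
move: (`|b' - b|) (normr_ge0 (b' - b)) ((x' - x) ^+ 2) (sqr_ge0 (x' - x)) (b1 ^+ 2) (sqr_ge0 b1) (kernel_bound y) KB.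
move=> p p0 q q0 r r0 kb kb0.
have H1 : 0 <= p * (b1 + 4 * r) * kb by rewrite !mulr_ge0// addr_ge0// mulr_ge0.
have H2 : 0 <= q * kb by rewrite mulr_ge0.
nra.
Qed.

Lemma kernel_bound_ge0 y : 0 <= kernel_bound y.
Proof. by rewrite mulr_ge0 ?expR_ge0. Qed.

Lemma kernel_le_bound b x y : b0 <= b -> b <= b1 -> `|x| <= K ->
  expR (- (b * (y - x) ^+ 2)) <= kernel_bound y.
Proof.
move=> bc cb xK; apply: le_trans (kernel_poly_le y bc cb xK).
rewrite -[leLHS]mul1r ler_wpM2r ?expR_ge0// -expR0 ler_expR.
by rewrite mulr_ge0// addr_ge0// mulr_ge0.
Qed.

(** The strict gap b0 - b' is what absorbs the factor exp (c |y|) of the majorant. *)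
Lemma kernel_bound_integrable (h : R -> R) (b' : R) : measurable_fun setT h -> b' < b0 ->
  lebesgue_measure.-integrable setT (fun y => (h y * expR (- (b' * y ^+ 2)))%:E) ->
  lebesgue_measure.-integrable setT (fun y => (`|h y| * kernel_bound y)%:E).
Proof.
move=> mh bb fi; pose e := b0 - b'.
have e0 : 0 < e by rewrite subr_gt0.
(* c^2 / (4 e) is the maximum of c |y| - e y^2. *)
pose M := expR (c ^+ 2 / (4 * e) + c * (2 * K)).
have mk : measurable_fun setT kernel_bound.
  apply: measurable_funM; apply: measurableT_comp => //.
    by apply: measurable_funM => //; apply: measurable_funD => //; exact: normr_measurable.
  by apply: measurable_funN; apply: measurable_funM => //.
apply: (@le_integrable _ _ _ lebesgue_measure _ _ _ (fun y => (M * `|h y * expR (- (b' * y ^+ 2))|)%:E)) => //.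
- apply/measurable_EFinP/measurable_funM => //.
  by apply: measurableT_comp; [exact: normr_measurable|exact: mh].
- move=> y _; rewrite !abse_EFin lee_fin normrM normr_id [leRHS]normrM normr_id.
  rewrite [X in _ * X <= _]ger0_norm ?kernel_bound_ge0//.
  rewrite [`|M|]ger0_norm ?expR_ge0// [X in _ <= _ * X]normrM.
  rewrite [X in _ <= _ * (_ * X)]ger0_norm ?expR_ge0// [leRHS]mulrCA ler_wpM2l//.
  rewrite /kernel_bound /M -!expRD ler_expR -/c.
  have -> : b0 = b' + e by rewrite /e addrC subrK.
  rewrite -subr_ge0.
  have -> : c ^+ 2 / (4 * e) + c * (2 * K) - b' * y ^+ 2 -
    (c * (`|y| + 2 * K) - (b' + e) * y ^+ 2) = e * (`|y| - c / (2 * e)) ^+ 2.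
    by rewrite -(real_normK (num_real y)); field; rewrite gt_eqF.
  by rewrite mulr_ge0 ?sqr_ge0// ltW.
- apply: integrable_RZl => //; exact: (integrable_norm fi).
Qed.

End gauss_kernel.

Lemma normal_pdf_kernel (R : realType) (v x y : R) : 0 < v ->
  normal_pdf x (Num.sqrt v) y =
  normal_peak (Num.sqrt v) * expR (- ((2 * v)^-1 * (y - x) ^+ 2)).
Proof.
move=> v0; rewrite normal_pdfE ?gt_eqF ?sqrtr_gt0// /normal_fun sqr_sqrtr ?(ltW v0)//.
congr (_ * expR _); rewrite -mulr_natr; field.
by rewrite gt_eqF.
Qed.

(** Integrability belongs to the property because [Rintegral] sends an infinite integral to 0. *)
Definition heat_mean_value (R : realType) (F : R -> R -> R) : Prop :=
  forall s t x : R, 0 < s -> s < t ->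
    (gauss 0 (Num.sqrt (t - s))).-integrable setT (fun y => (F t (x + y))%:E) /\
    (\int[gauss 0 (Num.sqrt (t - s))]_y F t (x + y))%R = F s x.

(** * Local expansion from the heat kernel representation *)

Section heat_kernel_representation.
Variables (R : realType) (F : R -> R -> R).
Hypothesis mF : forall t, 0 < t -> measurable_fun setT (F t).
Hypothesis hF : heat_mean_value F.

Section window.
Variables (s t : R).
Hypotheses (s0 : 0 < s) (st : s <= t).

(** One terminal time represents F on the whole window. Its distance 1 from the window keeps the
    kernels away from their singularity and makes [b] Lipschitz with constant 1. *)
Let T := t + 1.
Let b (u : R) : R := (2 * (T - u))^-1.
Let A (u : R) : R := normal_peak (Num.sqrt (T - u)).
Let k (c x y : R) : R := expR (- (c * (y - x) ^+ 2)).

Let T0 : 0 < T. Proof. by rewrite addr_gt0// (lt_le_trans s0). Qed.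

Let pdfE u x y : u < T -> normal_pdf x (Num.sqrt (T - u)) y = A u * k (b u) x y.
Proof.
by move=> uT; rewrite normal_pdf_kernel ?subr_gt0.
Qed.

Let A2 u : u < T -> A u ^+ 2 = b u / pi.
Proof.
move=> uT; have Tu : 0 < T - u by rewrite subr_gt0.
rewrite /A /normal_peak exprVn !sqr_sqrtr ?(ltW Tu)//; last first.
  by rewrite mulrn_wge0// mulr_ge0 ?(ltW Tu)// pi_ge0.
rewrite /b -mulr_natr; have := pi_gt0 R; move: pi => p p0.
by field; rewrite !gt_eqF.
Qed.

Let representation u x : 0 < u -> u < T ->
  mu.-integrable setT (fun y => (F T y * k (b u) x y)%:E) /\
  F u x = A u * (\int[mu]_y (F T y * k (b u) x y))%R.
Proof.
move=> u0 uT; have Tu : 0 < T - u by rewrite subr_gt0.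
have sT : Num.sqrt (T - u) != 0 by rewrite gt_eqF// sqrtr_gt0.
have A0 : A u != 0 by rewrite gt_eqF// normal_peak_gt0.
have [hi hE] := @hF _ _ x u0 uT.
have gi := (integrable_gauss_shift x sT (mF T0)).1 hi.
have li := (integrable_gaussP x (Num.sqrt (T - u)) (mF T0)).1 gi.
have ki : mu.-integrable setT (fun y => (F T y * k (b u) x y)%:E).
  have := @integrable_RZl _ _ _ mu _ (A u)^-1 _ measurableT li.
  apply: eq_integrable => // y _; congr EFin; rewrite pdfE//.
  by rewrite mulrCA mulKf.
split => //; rewrite -hE -RintegralZl// /Rintegral (integral_gauss_shift sT (mF T0) gi).
rewrite integral_gauss//; congr fine; apply: eq_integral => y _.
by rewrite pdfE// mulrCA.
Qed.

Variable K : R.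
Hypothesis K0 : 0 <= K.

Let b_le u v : u <= v -> v < T -> b u <= b v.
Proof.
move=> uv vT; rewrite /b lef_pV2 ?posrE ?mulr_gt0 ?subr_gt0 ?(le_lt_trans uv)//.
by rewrite ler_wpM2l// lerD2l lerN2.
Qed.

Let tT : t < T. Proof. by rewrite /T ltrDl. Qed.
Let sT : s < T. Proof. exact: le_lt_trans tT. Qed.
Let b00 u : u < T -> 0 <= b u. Proof. by move=> uT; rewrite invr_ge0 mulr_ge0// subr_ge0 ltW. Qed.

Let kb := kernel_bound (b s) (b t) K.

Let kb_integrable : mu.-integrable setT (fun y => (`|F T y| * kb y)%:E).
Proof.
(* The representation at the earlier time s/2 gives integrability against a strictly wider Gaussian,
   the gap that [kernel_bound_integrable] requires. *)
have s20 : 0 < s / 2 by rewrite divr_gt0.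
have s2s : s / 2 < s by rewrite ltr_pdivrMr// ltr_pMr// ltr1n.
have s2T : s / 2 < T by exact: lt_trans s2s sT.
have [fi _] := representation 0 s20 s2T.
apply: (kernel_bound_integrable (b' := b (s / 2)) (b t) K _ _) => //.
- exact: mF.
- by rewrite /b ltf_pV2 ?posrE ?mulr_gt0 ?subr_gt0// ltr_pM2l// ltrD2l ltrN2.
- by move: fi; rewrite /k; under eq_fun do rewrite subr0.
Qed.

Let kb0 y : 0 <= kb y. Proof. exact: kernel_bound_ge0. Qed.

Let H c x := (\int[mu]_y (F T y * k c x y))%R.
Let Hx c x := (\int[mu]_y (F T y * (2 * c * (y - x) * k c x y)))%R.
Let L2 := (\int[mu]_y (`|F T y| * kb y))%R.

Let L20 : 0 <= L2.
Proof. by apply: Rintegral_ge0 => y _; rewrite mulr_ge0. Qed.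

Let b1 := b t.
Let C1 := 1 + b1 + 4 * b1 ^+ 2.

Let mk c x : measurable_fun setT (k c x).
Proof.
apply: measurableT_comp => //; apply: measurable_funN; apply: measurable_funM => //.
by apply: measurable_funX; exact: measurable_funB.
Qed.

Let poly_k_integrable (C : R) (g : R -> R) : measurable_fun setT g -> 0 <= C ->
  (forall y, `|g y| <= C * kb y) ->
  mu.-integrable setT (fun y => (F T y * g y)%:E).
Proof.
move=> mg C0 gC.
apply: (@le_integrable _ _ _ mu _ _ _ (fun y => (C * (`|F T y| * kb y))%:E)) => //.
- by apply/measurable_EFinP/measurable_funM => //; exact: mF.
- move=> y _; rewrite !abse_EFin lee_fin normrM [leRHS]ger0_norm ?mulr_ge0//.
  by rewrite [leRHS]mulrCA ler_wpM2l.
- exact: integrable_RZl.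
Qed.

Let k_kb c x y : b s <= c -> c <= b1 -> `|x| <= K -> `|k c x y| <= 1 * kb y.
Proof.
move=> bc cb xK; rewrite mul1r ger0_norm ?expR_ge0//.
by apply: kernel_le_bound => //; exact: b00 sT.
Qed.

Let kx_kb c x y : b s <= c -> c <= b1 -> `|x| <= K ->
  `|2 * c * (y - x) * k c x y| <= (2 * b1) * kb y.
Proof.
move=> bc cb xK; have c0 : 0 <= c by rewrite (le_trans _ bc)// b00.
rewrite !normrM (ger0_norm (ler0n _ 2)) (ger0_norm c0) (ger0_norm (expR_ge0 _)) -mulrA.
rewrite ler_pM ?mulr_ge0 ?expR_ge0 ?ler_wpM2l//.
apply: le_trans (kernel_poly_le (b00 sT) K0 y bc cb xK).
rewrite ler_wpM2r ?expR_ge0//.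
apply: le_trans (ler_normB _ _) _.
apply: le_trans (_ : _ <= 2 * (`|y| + 2 * K)) _; last first.
  by apply: le_trans (expR_ge1Dx _); rewrite lerDr.
have := normr_ge0 y; have := K0; lra.
Qed.

Let H_le c x : b s <= c -> c <= b1 -> `|x| <= K -> `|H c x| <= L2.
Proof.
move=> bc cb xK.
have fi := poly_k_integrable (mk c x) ler01 (fun y => k_kb y bc cb xK).
apply: le_trans (le_normr_Rintegral _ fi) _ => //.
apply: le_Rintegral => //; first exact: (integrable_norm fi).
by move=> y _; rewrite normrM ler_wpM2l//; have := k_kb y bc cb xK; rewrite mul1r.
Qed.

Let H_expansion c c' x x' : b s <= c -> c <= b1 -> b s <= c' -> c' <= b1 ->
  `|x| <= K -> `|x'| <= K ->
  `|H c' x' - H c x - Hx c x * (x' - x)| <= ((x' - x) ^+ 2 + `|c' - c|) * (C1 * L2).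
Proof.
move=> bc cb bc' cb' xK xK'.
have i1 := poly_k_integrable (mk c' x') ler01 (fun y => k_kb y bc' cb' xK').
have i2 := poly_k_integrable (mk c x) ler01 (fun y => k_kb y bc cb xK).
have i3 : mu.-integrable setT (fun y => (F T y * (2 * c * (y - x) * k c x y))%:E).
  apply: (@poly_k_integrable (2 * b1)); last by move=> y; exact: kx_kb.
    by apply: measurable_funM => //; apply: measurable_funM => //; exact: measurable_funB.
  by rewrite mulr_ge0// b00.
have i4 : mu.-integrable setT (fun y => ((F T y * (2 * c * (y - x) * k c x y)) * (x' - x))%:E).
  by under eq_fun do rewrite mulrC; exact: integrable_RZl.
rewrite -addrA -opprD -RintegralZr// -RintegralD//.
rewrite mulrA /L2 -RintegralZl//.
apply: Rintegral_dist_le => //.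
- by apply: eq_integrable (integrableD _ i2 i4) => // y _ /=; rewrite EFinD.
- exact: integrable_RZl.
move=> y /=.
have := kernel_expansion (b00 sT) K0 y bc cb bc' cb' xK xK'; rewrite -/kb => KE.
rewrite (_ : _ - _ = F T y * (k c' x' y - k c x y - 2 * c * (y - x) * k c x y * (x' - x))); last by ring.
rewrite normrM [leRHS]mulrCA ler_wpM2l//.
by apply: le_trans KE _; rewrite mulrA.
Qed.

Let window_b u : s <= u <= t -> b s <= b u /\ b u <= b1.
Proof.
by move=> /andP[su ut]; split; apply: b_le => //; exact: le_lt_trans tT.
Qed.

Let b_lip u v : s <= u <= t -> s <= v <= t -> `|b v - b u| <= `|v - u|.
Proof.
move=> /andP[su ut] /andP[sv vt].
have Tu : 1 <= T - u by rewrite /T; lra.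
have Tv : 1 <= T - v by rewrite /T; lra.
have -> : b v - b u = (v - u) * (2 * (T - u) * (T - v))^-1.
  by rewrite /b; field; rewrite !gt_eqF// (lt_le_trans ltr01).
rewrite normrM ler_piMr// ger0_norm; last by rewrite invr_ge0; nra.
by rewrite invf_le1; nra.
Qed.

Let A0 u : u < T -> 0 < A u.
Proof. by move=> uT; rewrite normal_peak_gt0// gt_eqF// sqrtr_gt0 subr_gt0. Qed.

(** Since A^2 = b / pi, the difference of squares is controlled by [b_lip]; it remains to divide by
    A v + A u >= A s. *)
Let A_lip u v : s <= u <= t -> s <= v <= t -> `|A v - A u| <= `|v - u| / (pi * A s).
Proof.
move=> us vs; have [bu _] := window_b us; have [bv _] := window_b vs.
have uT : u < T by case/andP: us => _ /le_lt_trans; apply.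
have vT : v < T by case/andP: vs => _ /le_lt_trans; apply.
have As v' : v' < T -> b s <= b v' -> A s <= A v'.
  move=> vT' bv'; rewrite -(@ler_pXn2r _ 2)// ?nnegrE; [|exact/ltW/A0|exact/ltW/A0].
  by rewrite !A2// ler_wpM2r// invr_ge0 pi_ge0.
rewrite ler_pdivlMr ?mulr_gt0 ?pi_gt0 ?A0//.
apply: le_trans (_ : _ <= pi * (`|A v - A u| * (A v + A u))) _.
  rewrite mulrCA ler_wpM2l ?pi_ge0// ler_wpM2l//.
  by apply: le_trans (As _ vT bv) _; rewrite lerDl ltW// A0.
rewrite -{1}(gtr0_norm (addr_gt0 (A0 vT) (A0 uT))) -normrM -subr_sqr !A2//.
rewrite -mulrBl normrM (ger0_norm (_ : 0 <= pi^-1)) ?invr_ge0 ?pi_ge0//.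
by rewrite mulrCA divff ?mulr1 ?b_lip// gt_eqF// pi_gt0.
Qed.

Let A_le u : s <= u <= t -> A u <= 1 + b1 / pi.
Proof.
move=> us; have uT : u < T by case/andP: us => _ /le_lt_trans; apply.
have [_ bu] := window_b us.
have AA : A u <= 1 + A u ^+ 2 by have := sqr_ge0 (A u - 1); nra.
by apply: le_trans AA _; rewrite lerD2l A2// ler_wpM2r// invr_ge0 pi_ge0.
Qed.

(** F is the product of [A], Lipschitz in time, and [H], whose expansion is [kernel_expansion]
    integrated against F(T, .). The slope does not involve K; only L does. *)
Lemma heat_window_expansion : exists2 L, 0 <= L & forall u v x y,
    s <= u <= t -> s <= v <= t -> `|x| <= K -> `|y| <= K ->
    `|F v y - F u x - (A u * Hx (b u) x) * (y - x)| <= L * ((y - x) ^+ 2 + `|v - u|).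
Proof.
have b10 : 0 <= b1 by exact: b00.
have C10 : 0 <= C1 by rewrite /C1 !addr_ge0// mulr_ge0// sqr_ge0.
have p0 : 0 <= b1 / pi by rewrite divr_ge0// pi_ge0.
have pA : 0 <= (pi * A s)^-1 by rewrite invr_ge0 mulr_ge0 ?pi_ge0// ltW// A0.
exists ((pi * A s)^-1 * L2 + (1 + b1 / pi) * (C1 * L2)).
  by rewrite addr_ge0 ?mulr_ge0// addr_ge0.
move=> u v x y us vs xK yK.
have uT : u < T by case/andP: us => _ /le_lt_trans; apply.
have vT : v < T by case/andP: vs => _ /le_lt_trans; apply.
have u0 : 0 < u by case/andP: us => /(lt_le_trans s0).
have v0 : 0 < v by case/andP: vs => /(lt_le_trans s0).
have [_ ->] := representation x u0 uT; have [_ ->] := representation y v0 vT.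
rewrite -/(H _ _) -/(H _ _).
have [bu1 bu2] := window_b us; have [bv1 bv2] := window_b vs.
have -> : A v * H (b v) y - A u * H (b u) x - A u * Hx (b u) x * (y - x) =
  (A v - A u) * H (b v) y + A u * (H (b v) y - H (b u) x - Hx (b u) x * (y - x)) by ring.
apply: le_trans (ler_normD _ _) _; rewrite [leRHS]mulrDl lerD//.
  rewrite normrM; apply: le_trans (ler_pM _ _ (A_lip us vs) (H_le bv1 bv2 yK)) _ => //.
  rewrite -mulrA mulrC ler_wpM2l ?(mulr_ge0 pA L20)//.
  by rewrite lerDr sqr_ge0.
rewrite normrM (gtr0_norm (A0 uT)) -mulrA; apply: ler_pM; [exact/ltW/A0|exact: normr_ge0|exact: A_le|].
apply: le_trans (H_expansion bu1 bu2 bv1 bv2 xK yK) _.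
rewrite mulrC ler_wpM2l ?mulr_ge0// lerD2l; exact: b_lip.
Qed.

End window.

(** The slope found on a window is written with its terminal time. Identifying it with the
    derivative in x gives one slope for all windows. *)
Lemma heat_local_expansion s t : 0 < s -> s <= t ->
  local_expansion F (fun u x => 'D_1 (F u) x) s t.
Proof.
move=> s0 st.
have [D FD] : exists D, local_expansion F D s t.
  by eexists => K K0; exact: (heat_window_expansion s0 st K0).
move=> K K0; have [L L0 FL] := FD K K0; exists L => // u v x y us vs xK yK.
have := @local_expansion_derive _ _ _ _ _ FD u x us => /(@derive_val _ _ _ _ _ _ _) ->.
exact: FL.
Qed.

End heat_kernel_representation.

(** * Liouville theorem *)

(** Lagrange interpolation at the points 0, 1, ..., n-1 recovers each u k from its values there, so
    the limit is the interpolation of the limit values. Size 0, without any node, is treated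
    apart. *)
Lemma cvg_poly (R : realType) (n : nat) (u : nat -> {poly R}) (f : R -> R) :
  (forall k, (size (u k) <= n)%N) -> (forall x, (u k).[x] @[k --> \oo] --> f x) ->
  exists2 p : {poly R}, (size p <= n)%N & forall x, f x = p.[x].
Proof.
move=> su uf.
pose x (i : nat) : R := i%:R.
have xI : injective x by move=> i j /eqP; rewrite eqr_nat => /eqP.
case: n su => [|n] su.
  exists 0; first by rewrite size_poly0.
  have u0 k : u k = 0 by apply/eqP; rewrite -size_poly_leq0.
  move=> y; have := uf y; rewrite (_ : (fun k => (u k).[y]) = cst 0).
    by move=> uy; apply: (cvg_unique (@Rhausdorff R) uy); rewrite horner0; exact: cvg_cst.
  by apply/funext => k; rewrite u0 horner0.
exists (\sum_(i < n.+1) (f (x i))%:P * (tnth (lagrange n.+1 x) i : {poly R})).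
  apply: (leq_trans (size_sum _ _ _)); apply/bigmax_leqP => i _.
  by rewrite mul_polyC (leq_trans (size_scale_leq _ _))// size_lagrange_.
move=> y; have := uf y.
rewrite (_ : (fun k => (u k).[y]) = (fun k => \sum_(i < n.+1) (u k).[x i] * (tnth (lagrange n.+1 x) i : {poly R}).[y])); last first.
  apply/funext => k; rewrite {1}(lagrange_gen (ltn0Sn n) xI (su k)) horner_sum.
  by apply: eq_bigr => i _; rewrite hornerM hornerC.
move=> uy; apply: (cvg_unique (@Rhausdorff R) uy).
rewrite horner_sum; apply: cvg_big => [|i _]; first exact: add_continuous.
rewrite hornerM hornerC; apply: cvgMr_tmp; exact: uf.
Qed.

Section heat_liouville.
Variables (R : realType) (F : R -> R -> R).
Hypothesis mF : forall t, 0 < t -> measurable_fun setT (F t).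
Hypothesis hF : heat_mean_value F.

(** The point x leaves the law and reappears in the factor exp (x y / sg^2), so that the Taylor
    expansion in x bears on an exponential and no higher derivative of F is taken. *)
Lemma heat_tilt (s sg x : R) : 0 < s -> 0 < sg ->
  (gauss 0 sg).-integrable setT (fun y => (F (s + sg ^+ 2) y * expR (x / sg ^+ 2 * y))%:E) /\
  (\int[gauss 0 sg]_y (F (s + sg ^+ 2) y * expR (x / sg ^+ 2 * y)))%R =
  expR (x ^+ 2 / sg ^+ 2 / 2) * F s x.
Proof.
move=> s0 g0; set t := s + sg ^+ 2; set m := x / sg ^+ 2.
have g20 : 0 < sg ^+ 2 by rewrite exprn_gt0.
have t0 : 0 < t by rewrite addr_gt0.
have st : s < t by rewrite ltrDl.
have gN : sg != 0 by rewrite gt_eqF.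
have [hi hE] := @hF s t x s0 st.
rewrite {2}/t addrAC subrr add0r sqrtr_sqr (gtr0_norm g0) in hi.
rewrite {1}/t addrAC subrr add0r sqrtr_sqr (gtr0_norm g0) in hE.
have gi := (integrable_gauss_shift x gN (mF t0)).1 hi.
have li := (integrable_gaussP x sg (mF t0)).1 gi.
have mE : m * sg ^+ 2 = x by rewrite /m divfK// gt_eqF.
have tilt y : F t y * expR (m * y) * normal_pdf 0 sg y =
    expR (m ^+ 2 * sg ^+ 2 / 2) * (F t y * normal_pdf x sg y).
  by rewrite -mulrA normal_pdf_tilt// mE mulrCA.
have mFe : measurable_fun setT (fun y => F t y * expR (m * y)).
  by apply: measurable_funM; [exact: mF|apply: measurableT_comp => //; exact: measurable_funM].
have ti : (gauss 0 sg).-integrable setT (EFin \o (fun y => F t y * expR (m * y))).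
  apply/(integrable_gaussP _ _ mFe); under eq_fun do rewrite tilt.
  exact: integrable_RZl.
split => //; rewrite /Rintegral (integral_gauss ti).
under eq_integral do rewrite tilt.
rewrite -/(Rintegral mu setT (fun y => _ * (F t y * normal_pdf x sg y))) RintegralZl//.
congr (expR _ * _).
  by rewrite /m; field.
by rewrite -hE /Rintegral (integral_gauss_shift gN (mF t0) gi) integral_gauss.
Qed.

Variables (n : nat) (C : R).
Hypothesis growth : forall t x, 0 < t -> `|F t x| <= C * (1 + Num.sqrt t + `|x|) ^+ n.

Let C0 : 0 <= C.
Proof.
have := growth 0 ltr01; rewrite sqrtr1 normr0 addr0 => H.
have : 0 <= C * (1 + 1) ^+ n by apply: le_trans H.
by rewrite pmulr_lge0// exprn_gt0.
Qed.

Section approximation.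
Variables (s sg x : R).
Hypotheses (s0 : 0 < s) (sg1 : 1 + Num.sqrt s <= sg) (xsg : `|x| <= sg).

Let t := s + sg ^+ 2.
Let m := x / sg ^+ 2.
Let g0 : 0 < sg. Proof. by rewrite (lt_le_trans _ sg1)// ltr_pwDl. Qed.
Let t0 : 0 < t. Proof. by rewrite addr_gt0// exprn_gt0. Qed.
Let gN : sg != 0. Proof. by rewrite gt_eqF. Qed.

(** From sqrt t <= sqrt s + sg follows 1 + sqrt t + |y| <= 2 sg (1 + |y|/sg). Growth is turned into
    an exponential of |y|/sg because its mean under N(0, sg^2) is bounded independently of sg. *)
Let growth_exp y : `|F t y| <= C * 2 ^+ n * sg ^+ n * expR (n%:R / sg * `|y|).
Proof.
apply: le_trans (growth y t0) _.
have -> : n%:R / sg * `|y| = n%:R * (`|y| / sg) by field.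
rewrite expRM_natl -!mulrA -!exprMn ler_wpM2l//; apply: lerXn2r; rewrite ?nnegrE.
- by rewrite !addr_ge0.
- by rewrite !mulr_ge0 ?expR_ge0 ?(ltW g0).
have tg : Num.sqrt t <= Num.sqrt s + sg.
  rewrite -[leRHS]ger0_norm ?addr_ge0 ?(ltW g0)// -sqrtr_sqr ler_wsqrtr// sqrrD sqr_sqrtr ?(ltW s0)//.
  by rewrite /t -addrA lerD2l lerDr mulrn_wge0// mulr_ge0 ?(ltW g0).
apply: le_trans (_ : _ <= 2 * (sg * (1 + `|y| / sg))) _.
  have -> : 2 * (sg * (1 + `|y| / sg)) = 2 * sg + 2 * `|y| by field.
  apply: lerD; last by rewrite ler_peMl// ler1n.
  have := sg1; lra.
by rewrite !ler_wpM2l ?(ltW g0)// expR_ge1Dx.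
Qed.

Let pow_exp (y : R) : `|y| ^+ n.+1 <= n.+1`!%:R * sg ^+ n.+1 * expR (1 / sg * `|y|).
Proof.
have := @exprn_le_expR R n.+1 (`|y| / sg) (divr_ge0 (normr_ge0 y) (ltW g0)).
rewrite exprMn exprVn ler_pdivrMr ?exprn_gt0// => H; apply: le_trans H _.
by rewrite mulrAC mul1r [sg^-1 * _]mulrC.
Qed.

(** The power of sg is n from the growth, -2(n+1) from m^(n+1) and n+1 from |y|^(n+1), in total -1.
    The rate n+2 in the bound that follows adds n from the growth, 1 from the power of y and 1 from
    exp |m y|. *)
Let err := C * 2 ^+ n * n.+1`!%:R * `|x| ^+ n.+1 / sg.

Let remainder (y : R) : `|F t y| * (`|m * y| ^+ n.+1 * expR `|m * y|) <= err * expR (n.+2%:R / sg * `|y|).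
Proof.
have mx : `|m * y| <= 1 / sg * `|y|.
  rewrite normrM ler_wpM2r// /m normrM normfV normrX (gtr0_norm g0) mul1r expr2 invfM mulrA.
  by rewrite ler_piMl ?invr_ge0 ?(ltW g0)// ler_pdivrMr// mul1r.
have -> : err * expR (n.+2%:R / sg * `|y|) =
  (C * 2 ^+ n * sg ^+ n * expR (n%:R / sg * `|y|)) *
  ((`|m| ^+ n.+1 * (n.+1`!%:R * sg ^+ n.+1 * expR (1 / sg * `|y|))) * expR (1 / sg * `|y|)).
  have -> : expR (n.+2%:R / sg * `|y|) = expR (n%:R / sg * `|y|) * expR (1 / sg * `|y|) * expR (1 / sg * `|y|).
    by rewrite -!expRD; congr expR; rewrite -!natr1; field.
  rewrite /err /m normrM normfV normrX (gtr0_norm g0) exprMn exprVn -exprM mulnC exprM.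
  have -> : (sg ^+ n.+1) ^+ 2 = sg ^+ n * sg * sg ^+ n.+1 by rewrite expr2 {1}exprSr.
  rewrite invfM.
  have : sg ^+ n != 0 by rewrite expf_neq0.
  have : sg ^+ n.+1 != 0 by rewrite expf_neq0.
  move: (sg ^+ n) (sg ^+ n.+1) (`|x| ^+ n.+1) (2 ^+ n) (n.+1`!%:R) (expR (n%:R / sg * `|y|)) (expR (1 / sg * `|y|)).
  by move=> A B D E G H I A0 B0; field; rewrite ?A0 ?B0 ?gN.
apply: ler_pM; [exact: normr_ge0|by rewrite mulr_ge0 ?expR_ge0// exprn_ge0|exact: growth_exp|].
apply: ler_pM; rewrite ?exprn_ge0 ?expR_ge0//; last by rewrite ler_expR.
by rewrite normrM exprMn ler_wpM2l ?exprn_ge0.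
Qed.

Definition heat_taylor : {poly R} :=
  \poly_(k < n.+1) ((\int[gauss 0 sg]_y (F t y * y ^+ k))%R / (k`!%:R * (sg ^+ 2) ^+ k)).

Let Fy_integrable k : (gauss 0 sg).-integrable setT (fun y => (F t y * y ^+ k)%:E).
Proof.
apply: (@gauss_integrable_dominated _ _ gN _ (C * 2 ^+ n * sg ^+ n * k`!%:R) (n%:R / sg + 1)).
- by apply: measurable_funM; [exact: mF|exact: measurable_funX].
- by rewrite addr_ge0// divr_ge0// ltW.
move=> y; rewrite normrM normrX mulrDl expRD mul1r mulrACA.
apply: ler_pM; [exact: normr_ge0|by rewrite exprn_ge0|exact: growth_exp|exact: exprn_le_expR].
Qed.

Lemma heat_taylor_error :
  `|expR (x ^+ 2 / sg ^+ 2 / 2) * F s x - heat_taylor.[x]| <= err * (2 * expR (n.+2%:R ^+ 2 / 2)).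
Proof.
have [ti tE] := heat_tilt x s0 g0; rewrite -/t -/m in ti tE.
have i2 k : (gauss 0 sg).-integrable setT (fun y => (m ^+ k / k`!%:R * (F t y * y ^+ k))%:E).
  exact: integrable_RZl.
have hE : heat_taylor.[x] = (\int[gauss 0 sg]_y (\sum_(0 <= k < n.+1) m ^+ k / k`!%:R * (F t y * y ^+ k)))%R.
  rewrite Rintegral_sum// big_mkord /heat_taylor horner_poly; apply: eq_bigr => k _.
  rewrite RintegralZl//; last exact: Fy_integrable.
  have -> : m ^+ k = x ^+ k / (sg ^+ 2) ^+ k by rewrite -exprVn -exprMn.
  by rewrite invfM; ring.
rewrite -tE hE.
have c0 : 0 <= n.+2%:R / sg by rewrite divr_ge0// ltW.
have ei := gauss_integrable_expR_norm gN c0.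
have err0 : 0 <= err.
  by rewrite /err !mulr_ge0 ?exprn_ge0 ?invr_ge0 ?(ltW g0).
apply: (@le_trans _ _ (\int[gauss 0 sg]_y (err * expR (n.+2%:R / sg * `|y|)))%R).
  apply: Rintegral_dist_le; [exact: ti|exact: integrable_Rsum|exact: integrable_RZl|].
  move=> y; rewrite (_ : _ - _ = F t y * (expR (m * y) - \sum_(0 <= k < n.+1) (m * y) ^+ k / k`!%:R)); last first.
    rewrite mulrBr; congr (_ - _); rewrite mulr_sumr; apply: eq_bigr => k _.
    by rewrite (exprMn k m y); move: (m ^+ k) (y ^+ k) => p q; ring.
  rewrite normrM; apply: le_trans (remainder y); rewrite ler_wpM2l//; exact: expR_taylor.
rewrite RintegralZl// ler_wpM2l// -lee_fin /Rintegral fineK; last exact: integrable_fin_num.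
apply: le_trans (gauss_expR_norm_le gN c0) _; rewrite lee_fin ler_wpM2l// ler_expR.
rewrite le_eqVlt; apply/orP; left; apply/eqP; field.
exact: gN.
Qed.

End approximation.

Lemma heat_liouville s : 0 < s ->
  exists2 r : {poly R}, (size r <= n.+1)%N & forall x, F s x = r.[x].
Proof.
move=> s0; pose sg (k : nat) : R := k%:R + (1 + Num.sqrt s).
pose u k := heat_taylor s (sg k).
apply: (@cvg_poly _ _ u); first by move=> k; exact: size_poly.
move=> x.
(* The first term is the Taylor error, the second the cost of replacing exp (x^2 / (2 sg^2)) by 1;
   both are divided by sg. *)
pose B := C * 2 ^+ n * n.+1`!%:R * `|x| ^+ n.+1 * (2 * expR (n.+2%:R ^+ 2 / 2))
   + `|F s x| * (x ^+ 2 * expR (x ^+ 2)).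
have B0 : 0 <= B.
  apply: addr_ge0; last exact: mulr_ge0 (normr_ge0 _) (mulr_ge0 (sqr_ge0 _) (expR_ge0 _)).
  by rewrite !mulr_ge0 ?exprn_ge0 ?expR_ge0.
apply/cvgrPdist_le => e e0.
near=> k.
have kge : `|x| + B / e <= k%:R by near: k; exact: nbhs_infty_ger.
have sk : k%:R <= sg k by rewrite /sg lerDl addr_ge0.
have sg1 : 1 + Num.sqrt s <= sg k by rewrite /sg lerDr.
have sgx : `|x| <= sg k.
  by apply: le_trans sk; apply: le_trans kge; rewrite lerDl divr_ge0// ltW.
have g1 : 1 <= sg k by apply: le_trans sg1; rewrite lerDl.
have g0 : 0 < sg k by apply: lt_le_trans g1.
have E1 := heat_taylor_error s0 sg1 sgx.
set a := x ^+ 2 / sg k ^+ 2 / 2 in E1.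
have a0 : 0 <= a by rewrite !divr_ge0 ?sqr_ge0.
have ax : a <= x ^+ 2 / sg k.
  have H : (sg k ^+ 2)^-1 / 2 <= (sg k)^-1.
    rewrite -invfM lef_pV2 ?posrE ?mulr_gt0 ?exprn_gt0//.
    by rewrite expr2 -mulrA ler_peMr ?(ltW g0)//; lra.
  by rewrite /a -(mulrA (x ^+ 2)) ler_wpM2l ?sqr_ge0.
have ax2 : a <= x ^+ 2 by apply: le_trans ax _; rewrite ler_pdivrMr// ler_peMr ?sqr_ge0.
have E2 : `|F s x - expR a * F s x| <= `|F s x| * (x ^+ 2 * expR (x ^+ 2)) / sg k.
  rewrite -[X in `|X - _|]mul1r -mulrBl normrM mulrC -mulrA ler_wpM2l// distrC.
  have := expR_taylor 1 a; rewrite big_nat1 expr0 fact0 divr1 expr1 (ger0_norm a0) => H.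
  apply: le_trans H _; rewrite [leRHS]mulrAC.
  by apply: ler_pM => //; rewrite ?expR_ge0 ?ler_expR.
rewrite -(subrKA (expR a * F s x)); apply: le_trans (ler_normD _ _) _.
apply: le_trans (lerD E2 E1) _.
have -> : `|F s x| * (x ^+ 2 * expR (x ^+ 2)) / sg k +
   C * 2 ^+ n * n.+1`!%:R * `|x| ^+ n.+1 / sg k * (2 * expR (n.+2%:R ^+ 2 / 2)) = B / sg k.
  by rewrite /B; ring.
rewrite ler_pdivrMr// mulrC -ler_pdivrMr//; apply: le_trans sk.
by apply: le_trans kge; rewrite lerDr.
Unshelve. all: by end_near. Qed.

End heat_liouville.

(** * Brownian motion *)

Section independent_pair.
Context {R : realType} d d' (Om : measurableType d) (T : measurableType d')
  (P : probability Om R).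
Variables (X : Om -> T) (Y : Om -> R).
Hypotheses (mX : measurable_fun setT X) (mY : measurable_fun setT Y).
Variable (nY : {finite_measure set R -> \bar R}).
Hypothesis XY : forall (A : set T) (B : set R), measurable A -> measurable B ->
  P (X @^-1` A `&` Y @^-1` B) = (P (X @^-1` A) * nY B)%E.

Let nX : probability T R := distribution P (mfun_Sub (mem_set mX)).

Let mXY : measurable_fun setT (fun w => (X w, Y w)).
Proof. exact: measurable_fun_pair. Qed.

Let joint_law (D : set (T * R)) : measurable D ->
  pushforward P (fun w => (X w, Y w)) D = (nX \x nY)%E D.
Proof.
move=> mD; apply/esym.
by apply: (@product_measure_unique _ _ _ _ _ nX nY (pushforward P (fun w => (X w, Y w)))).
Qed.

Let joint_lawE (f : T * R -> \bar R) :
  (\int[nX \x nY]_z f z = \int[pushforward P (fun w => (X w, Y w))]_z f z)%E.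
Proof.
by apply: eq_measure_integral => D mD _; exact/esym/joint_law.
Qed.

(** [XY] says that the joint law of X and Y agrees with the product measure on rectangles, hence
    everywhere; Fubini does the rest. X may take values in any measurable space, so that it can be
    the whole past. *)
Lemma ge0_integral_indep (f : T * R -> \bar R) :
  measurable_fun setT f -> (forall z, 0 <= f z)%E ->
  (\int[P]_w f (X w, Y w) = \int[P]_w \int[nY]_y f (X w, y))%E.
Proof.
move=> mf f0; transitivity (\int[nX]_x \int[nY]_y f (x, y))%E; last first.
  rewrite (ge0_integral_pushforward mX)//.
    exact: measurable_fun_fubini_tonelli_F.
  by move=> x _; apply: integral_ge0.
by rewrite -fubini_tonelli1// joint_lawE ge0_integral_pushforward.
Qed.

Section integrable.
Variable f : T * R -> R.
Hypotheses (mf : measurable_fun setT f)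
  (fi : P.-integrable setT (fun w => (f (X w, Y w))%:E)).

Let pi_ : (nX \x nY)%E.-integrable setT (EFin \o f).
Proof.
have E : (\int[nX \x nY]_z `|(f z)%:E| = \int[P]_w `|(f (X w, Y w))%:E|)%E.
  rewrite joint_lawE ge0_integral_pushforward//.
  by do 2 apply: measurableT_comp => //.
move/integrableP : fi => [_ fin]; apply/integrableP; split => //.
- exact/measurable_EFinP.
- by rewrite E.
Qed.

Lemma integral_indep :
  (\int[P]_w (f (X w, Y w))%:E = \int[P]_w \int[nY]_y (f (X w, y))%:E)%E.
Proof.
transitivity (\int[nX]_x \int[nY]_y (f (x, y))%:E)%E.
  rewrite (@integral12_prod_meas1 _ _ _ _ _ nX nY (EFin \o f) pi_).
  by rewrite joint_lawE integral_pushforward//; exact/measurable_EFinP.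
have FI := @integrable_fubini_F _ _ _ _ _ nX nY (EFin \o f) pi_.
have mF : measurable_fun setT (fun x => \int[nY]_y (f (x, y))%:E)%E by case/integrableP: FI.
rewrite (integral_pushforward mX mF)//.
move/integrableP : FI => [_ FI]; apply/integrableP; split.
  exact: (measurableT_comp mF mX).
by move: FI; rewrite (ge0_integral_pushforward mX)//; exact: measurableT_comp.
Qed.

End integrable.
End independent_pair.

Lemma integral_probability_cst d (T : measurableType d) (R : realType)
  (P : probability T R) (c : \bar R) : (\int[P]_w c = c)%E.
Proof.
have H := @integral_cst _ _ _ P setT measurableT c.
by apply: etrans H _; rewrite [X in (c * X)%E]probability_setT mule1.
Qed.

Section brownian_motion.
Context {R : realType} d (Om : measurableType d) (P : probability Om R) (W : R -> Om -> R).
Hypothesis BM : is_std_BM P W.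

Definition past_generator (s : R) : set (set Om) :=
  [set A | exists u (B : set R), [/\ 0 <= u, u <= s, measurable B & A = W u @^-1` B]].

(* [Om] with the sigma-algebra [nat_filtration W s]: joint measurability on [past s * R]
   expresses adaptedness. *)
Definition past (s : R) : Type := g_sigma_algebraType (past_generator s).

HB.instance Definition _ s := Measurable.on (past s).

Lemma BM_measurable t : 0 <= t -> measurable_fun setT (W t).
Proof. by case: BM => mW _ _ _; exact: mW. Qed.

Lemma nat_filtration_measurable (s : R) A : nat_filtration W s A -> measurable A.
Proof.
apply: smallest_sub; first exact: sigma_algebra_measurable.
move=> _ [u [B [u0 us mB ->]]].
by rewrite -[X in measurable X]setTI; exact: (BM_measurable u0).
Qed.

Lemma past_id_measurable (s : R) : measurable_fun setT (fun w : Om => w : past s).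
Proof. by move=> _ A mA; rewrite setTI; exact: nat_filtration_measurable mA. Qed.

Lemma past_measurable (s u : R) : 0 <= u -> u <= s ->
  measurable_fun setT (fun w : past s => W u w).
Proof.
move=> u0 us _ B mB; rewrite setTI; apply: sub_sigma_algebra.
by exists u, B.
Qed.

Section increment.
Variables (s t : R).
Hypotheses (s0 : 0 <= s) (st : s < t).

Let t0 : 0 <= t. Proof. exact: le_trans (ltW st). Qed.

Let mY : measurable_fun setT (fun w => W t w - W s w).
Proof. by apply: measurable_funB; exact: BM_measurable. Qed.

Let XY (A : set (past s)) (B : set R) : measurable A -> measurable B ->
  P ((fun w : Om => w : past s) @^-1` A `&` (fun w => W t w - W s w) @^-1` B) =
  (P ((fun w : Om => w : past s) @^-1` A) * gauss 0 (Num.sqrt (t - s)) B)%E.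
Proof.
case: BM => _ _ law ind mA mB.
by rewrite (ind s t s0 st A B mA mB) (law s t s0 st B mB).
Qed.

(** Replaces conditioning on the past: the past is frozen and the increment averaged over its
    Gaussian law. X is the identity of [Om] seen as a map into [past s]. *)
Lemma BM_ge0_freeze (f : past s * R -> \bar R) :
  measurable_fun setT f -> (forall z, 0 <= f z)%E ->
  (\int[P]_w f (w, (W t w - W s w)%R) =
   \int[P]_w \int[gauss 0 (Num.sqrt (t - s))]_y f (w, y))%E.
Proof. exact: (ge0_integral_indep (@past_id_measurable s) mY XY). Qed.

Lemma BM_freeze (f : past s * R -> R) : measurable_fun setT f ->
  P.-integrable setT (fun w => (f (w, W t w - W s w))%:E) ->
  (\int[P]_w (f (w, (W t w - W s w)%R))%:E =
   \int[P]_w \int[gauss 0 (Num.sqrt (t - s))]_y (f (w, y))%:E)%E.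
Proof. exact: (integral_indep (@past_id_measurable s) mY XY). Qed.

End increment.

Lemma BM_W0 : {ae P, forall w, W 0 w = 0}.
Proof. by case: BM => _ + _ _; apply: filterS => w []. Qed.

Lemma BM_continuous : {ae P, forall w, {within `[0, +oo[, continuous (fun t => W t w)}}.
Proof. by case: BM => _ + _ _; apply: filterS => w []. Qed.

(** Only increments have a prescribed law, and W t equals the increment from time 0 only almost
    surely. *)
Lemma BM_ge0_marginal t (h : R -> \bar R) : 0 < t -> measurable_fun setT h ->
  (forall x, 0 <= h x)%E ->
  (\int[P]_w h (W t w) = \int[gauss 0 (Num.sqrt t)]_y h y)%E.
Proof.
move=> t0 mh h0.
have mWt := BM_measurable (ltW t0); have mW0 := BM_measurable (lexx 0).
transitivity (\int[P]_w h (W t w - W 0 w)%R)%E.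
  apply: ge0_ae_eq_integral => //.
  - exact: (measurableT_comp mh mWt).
  - by apply: (measurableT_comp mh); exact: measurable_funB.
  - by apply: filterS BM_W0 => w -> _; rewrite subr0.
rewrite (@BM_ge0_freeze 0 t (lexx 0) t0 (fun z : past 0 * R => h z.2))//; last first.
  by apply: measurableT_comp => //.
by rewrite subr0 /= integral_probability_cst.
Qed.

Lemma BM_integrable_marginal t (h : R -> R) : 0 < t -> measurable_fun setT h ->
  P.-integrable setT (fun w => (h (W t w))%:E) <->
  (gauss 0 (Num.sqrt t)).-integrable setT (EFin \o h).
Proof.
move=> t0 mh; have mWt := BM_measurable (ltW t0).
have E : (\int[P]_w `|(h (W t w))%:E| = \int[gauss 0 (Num.sqrt t)]_y `|(h y)%:E|)%E.
  rewrite -(BM_ge0_marginal (h := fun y => `|(h y)%:E|%E) t0)//.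
  by do 2 apply: measurableT_comp => //.
split => /integrableP[_ fin]; apply/integrableP; split.
- exact/measurable_EFinP.
- by rewrite -E.
- by apply/measurable_EFinP; exact: (measurableT_comp mh mWt).
- by rewrite E.
Qed.

Lemma BM_integral_marginal t (h : R -> R) : 0 < t -> measurable_fun setT h ->
  (\int[P]_w (h (W t w))%:E = \int[gauss 0 (Num.sqrt t)]_y (h y)%:E)%E.
Proof.
move=> t0 mh; rewrite integralE [RHS]integralE.
have mhe : measurable_fun setT (EFin \o h) by exact/measurable_EFinP.
congr (_ - _)%E.
- rewrite -(BM_ge0_marginal t0 (measurable_funepos mhe))//.
  by apply: eq_integral => w _; rewrite !funeposE.
- rewrite -(BM_ge0_marginal t0 (measurable_funeneg mhe))//.
  by apply: eq_integral => w _; rewrite !funenegE.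
Qed.

End brownian_motion.

(** * Quadratic variation of Brownian motion *)

Lemma gauss_centered_square (R : realType) (s x : R) : s != 0 ->
  (\int[gauss 0 s]_y ((x + (y ^+ 2 - s ^+ 2)) ^+ 2)%:E = (x ^+ 2 + 2 * s ^+ 4)%:E)%E.
Proof.
move=> s0.
have gi (k : nat) := gauss_integrable_exprn s0 k.
under eq_integral => y _.
  rewrite (_ : (x + (y ^+ 2 - s ^+ 2)) ^+ 2 =
    (x - s ^+ 2) ^+ 2 * y ^+ 0 + (2 * (x - s ^+ 2) * y ^+ 2 + 1 * y ^+ 4)); last by ring.
  rewrite !EFinD (EFinM _ (y ^+ 0)) (EFinM _ (y ^+ 2)) (EFinM _ (y ^+ 4)); over.
rewrite integralD//; last 2 first.
- exact: integrableZl (gi 0).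
- by apply: integrableD => //; [exact: integrableZl (gi 2)|exact: integrableZl (gi 4)].
rewrite integralD//; [|exact: integrableZl (gi 2)|exact: integrableZl (gi 4)].
rewrite !integralZl// !gauss_moment_EFin// !gauss_momentE//= -!EFinM -!EFinD; congr EFin.
rewrite !expr0 !fact0 (_ : 4`! = 24)%N// (_ : 2`! = 2)%N// (_ : 1`! = 1)%N//.
by field.
Qed.

Section quadratic_variation.
Context {R : realType} d (Om : measurableType d) (P : probability Om R) (W : R -> Om -> R).
Hypothesis BM : is_std_BM P W.

Section fixed_interval.
Variables (s t : R).
Hypotheses (s0 : 0 <= s) (st : s < t).

Section fixed_level.
Variable N : nat.
Hypothesis N0 : (0 < N)%N.

Let T (i : nat) : R := s + (t - s) * i%:R / N%:R.
Let dl : R := (t - s) / N%:R.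
Let S (j : nat) (w : Om) : R :=
  \sum_(0 <= i < j) ((W (T i.+1) w - W (T i) w) ^+ 2 - dl).

Let N0R : 0 < (N%:R : R). Proof. by rewrite ltr0n. Qed.
Let dl0 : 0 < dl. Proof. by rewrite divr_gt0// subr_gt0. Qed.

Let TE i : T i = s + dl * i%:R.
Proof. by rewrite /T /dl mulrAC. Qed.

Let T0 i : 0 <= T i.
Proof. by rewrite TE addr_ge0// mulr_ge0// ltW. Qed.

Let Tle i j : (i <= j)%N -> T i <= T j.
Proof. by move=> ij; rewrite !TE lerD2l ler_wpM2l ?(ltW dl0)// ler_nat. Qed.

Let TS i : T i.+1 - T i = dl.
Proof. by rewrite !TE -natr1; ring. Qed.

Let mS j : measurable_fun setT (fun w : past W (T j) => S j w).
Proof.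
have -> : (fun w : past W (T j) => S j w) =
  (fun w => \sum_(i < j) ((W (T i.+1) w - W (T i) w) ^+ 2 - dl)).
  by apply/funext => w; rewrite /S big_mkord.
apply: measurable_sum => i; apply: measurable_funB => //.
apply: measurable_funX; apply: measurable_funB.
  by apply: past_measurable => //; apply: Tle.
by apply: past_measurable => //; apply: Tle; exact: ltnW.
Qed.

(** The last squared increment, frozen against the past, is centred after subtracting [dl] and has
    variance 2 dl^2, so no cross term survives and each step adds 2 dl^2. *)
Lemma BM_qv_second_moment j :
  (\int[P]_w (S j w ^+ 2)%:E = (j%:R * (2 * dl ^+ 2))%:E)%E.
Proof.
elim: j => [|j IH].
  by under eq_integral do rewrite /S big_geq// expr0n/=; rewrite integral0 mul0r.
have Tj : T j < T j.+1 by rewrite -subr_gt0 TS.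
have sq : Num.sqrt (T j.+1 - T j) ^+ 2 = dl by rewrite TS sqr_sqrtr// ltW.
have sn0 : Num.sqrt (T j.+1 - T j) != 0 by rewrite gt_eqF// sqrtr_gt0 TS.
pose f (z : past W (T j) * R) := ((S j z.1 + (z.2 ^+ 2 - dl)) ^+ 2)%:E.
transitivity (\int[P]_w f (w, (W (T j.+1) w - W (T j) w)%R))%E.
  by apply: eq_integral => w _; rewrite /f /S big_nat_recr.
rewrite (BM_ge0_freeze BM (T0 j) Tj); last 2 first.
- apply/measurable_EFinP; apply: measurable_funX; apply: measurable_funD.
    have m1 : measurable_fun setT (fst : past W (T j) * R -> past W (T j)) by exact: measurable_fst.
    have H := measurableT_comp (@mS j) m1. exact: H.
  by apply: measurable_funB => //; apply: measurable_funX.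
- by move=> z; rewrite lee_fin sqr_ge0.
under eq_integral => w _.
  rewrite /f/= -sq gauss_centered_square//; over.
rewrite (_ : Num.sqrt (T j.+1 - T j) ^+ 4 = dl ^+ 2); last by rewrite -sq -exprM.
under eq_integral do rewrite EFinD.
have mSP : measurable_fun setT (fun w : Om => S j w).
  exact: (measurableT_comp (@mS j) (past_id_measurable BM (s := T j))).
rewrite ge0_integralD//=; last 3 first.
- by move=> w _; rewrite lee_fin sqr_ge0.
- by apply/measurable_EFinP; exact: measurable_funX.
- by move=> w _; rewrite lee_fin mulr_ge0// sqr_ge0.
rewrite IH integral_probability_cst -EFinD -natr1; congr EFin; ring.
Qed.

End fixed_level.

Lemma BM_path_qv_second_moment k :
  (\int[P]_w ((path_qv (W ^~ w) s t k - (t - s)) ^+ 2)%:E =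
   (2 * (t - s) ^+ 2 / 2 ^+ k)%:E)%E.
Proof.
have N0 : (0 < 2 ^ k)%N by rewrite expn_gt0.
have := BM_qv_second_moment N0 (2 ^ k).
rewrite (eq_integral (fun w => ((path_qv (W ^~ w) s t k - (t - s)) ^+ 2)%:E)); last first.
  move=> w _; congr (_ ^+ 2)%:E; rewrite sumrB big_mkord; congr (_ - _).
  rewrite sumr_const_nat subn0.
  have N0R : ((2 ^ k)%:R : R) != 0 by rewrite pnatr_eq0 -lt0n.
  by move: (2 ^ k)%N N0R => N N0R; rewrite -[LHS]mulr_natr divfK.
move=> ->; congr EFin; rewrite natrX.
have : (2 ^+ k : R) != 0 by rewrite expf_neq0.
by move: (2 ^+ k) => x x0; field.
Qed.

(** The second moments at dyadic levels form a geometric series, so the sum of the squared errors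
    has finite mean. It is therefore finite almost surely, and its terms tend to 0. *)
Lemma BM_path_qv_ae : {ae P, forall w, path_qv (W ^~ w) s t @ \oo --> t - s}.
Proof.
pose X k w := path_qv (W ^~ w) s t k - (t - s).
have mX k : measurable_fun setT (fun w => (X k w ^+ 2)%:E).
  apply/measurable_EFinP; apply: measurable_funX; apply: measurable_funB => //.
  apply: measurable_sum => i; apply: measurable_funX.
  by apply: measurable_funB; apply: (BM_measurable BM); rewrite addr_ge0// divr_ge0// mulr_ge0// subr_ge0 ltW.
have mX0 k w : setT w -> (0 <= (X k w ^+ 2)%:E)%E by rewrite lee_fin sqr_ge0.
have fin : (\int[P]_w (\sum_(k <oo) (X k w ^+ 2)%:E) < +oo)%E.
  rewrite integral_nneseries//.
  under eq_eseriesr do rewrite BM_path_qv_second_moment.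
  pose a := 2 * (t - s) ^+ 2.
  have cg : series (geometric a 2^-1) @ \oo --> a * (1 - 2^-1)^-1.
    by apply: cvg_geometric_series; rewrite ger0_norm// invf_lt1// ltr1n.
  apply: (@le_lt_trans _ _ (a * (1 - 2^-1)^-1)%:E); last exact: ltry.
  apply: lime_le.
    by apply: is_cvg_nneseries => k _ _; rewrite lee_fin divr_ge0 ?exprn_ge0// mulr_ge0// sqr_ge0.
  apply: nearW => n; rewrite sumEFin lee_fin.
  have -> : \sum_(0 <= k < n) a / 2 ^+ k = series (geometric a 2^-1) n.
    by apply: eq_bigr => k _; rewrite /geometric/= exprVn.
  rewrite -(cvg_lim _ cg)//; apply: nondecreasing_cvgn_le; last by apply/cvg_ex; eexists; exact: cg.
  apply: nondecreasing_series => k _ _; rewrite /geometric/= mulr_ge0 ?exprn_ge0//.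
  by rewrite mulr_ge0// sqr_ge0.
have fi : P.-integrable setT (fun w => \sum_(k <oo) (X k w ^+ 2)%:E)%E.
  apply/integrableP; split.
    by apply: ge0_emeasurable_sum => [k x Dx _|k _]; [exact: mX0|exact: mX].
  rewrite (eq_integral (fun w => \sum_(k <oo) (X k w ^+ 2)%:E)%E)// => w _.
  by rewrite gee0_abs//; apply: nneseries_ge0 => k _ _; exact: mX0.
have := integrable_ae measurableT fi; apply: filterS => w /(_ I) wfin.
pose M := fine (\sum_(k <oo) (X k w ^+ 2)%:E)%E.
have cS : cvgn (series (fun k => X k w ^+ 2)).
  apply: nondecreasing_is_cvgn.
    by apply: nondecreasing_series => k _ _; exact: sqr_ge0.
  exists M => _ [n _ <-]; rewrite -lee_fin /M fineK// /series/= -sumEFin.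
  by apply: nneseries_lim_ge => k _ _; exact: mX0.
have X0 : (fun k => X k w ^+ 2) @ \oo --> 0 by exact: cvg_series_cvg_0 cS.
apply/cvgrPdist_lt => e e0.
have e20 : 0 < e ^+ 2 by rewrite exprn_gt0.
move/cvgrPdist_lt : X0 => /(_ _ e20); apply: filterS => k.
rewrite sub0r normrN ger0_norm ?sqr_ge0// distrC -(real_normK (num_real (X k w))).
by rewrite ltr_pXn2r// nnegrE// ltW.
Qed.

End fixed_interval.

(** [path_qv_cvg] needs one null set for all dyadic subsegments; they are countably many, enumerated
    through [unpickle]. *)
Lemma BM_dyadic_qv_ae (s t : R) : 0 <= s -> s < t ->
  {ae P, forall w, forall l, let I := dyadic_sub (s, t) l in
     path_qv (W ^~ w) I.1 I.2 @ \oo --> I.2 - I.1}.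
Proof.
move=> s0 st.
have H : {ae P, forall w, forall n l, unpickle n = Some l -> let I := dyadic_sub (s, t) l in
     path_qv (W ^~ w) I.1 I.2 @ \oo --> I.2 - I.1}.
  apply: ae_foralln => n; case E : (unpickle n) => [l|]; last exact: nearW.
  have [sI _ II _] := dyadic_sub_bound l st.
  by apply: filterS (BM_path_qv_ae (le_trans s0 sI) II) => w Hw l' [<-].
by apply: filterS H => w Hw l; apply: (Hw (pickle l)); rewrite pickleK.
Qed.

End quadratic_variation.

(** * Martingales and the mean value property *)

Section martingale.
Context {R : realType} d (Om : measurableType d) (P : probability Om R) (W : R -> Om -> R).
Hypothesis BM : is_std_BM P W.
Variable F : R -> R -> R.
Hypothesis mF : forall t, 0 < t -> measurable_fun setT (F t).
Hypothesis iF : forall t, 0 < t -> P.-integrable setT (fun w => (F t (W t w))%:E).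

Let mFW t : 0 < t -> measurable_fun setT (fun w => F t (W t w)).
Proof. by move=> t0; apply: (measurableT_comp (mF t0)); apply: (BM_measurable BM); exact: ltW. Qed.

Lemma integral_past_freeze (s t : R) (A : set Om) : 0 < s -> s < t -> nat_filtration W s A ->
  (\int[P]_(w in A) (F t (W t w))%:E =
   \int[P]_(w in A) \int[gauss 0 (Num.sqrt (t - s))]_y (F t (W s w + y)%R)%:E)%E.
Proof.
move=> s0 st FA; have t0 : 0 < t by exact: lt_trans st.
have mA : measurable A := nat_filtration_measurable BM FA.
pose f (z : past W s * R) := (\1_(A : set (past W s)) z.1 : R) * F t (W s z.1 + z.2).
have mf : measurable_fun setT f.
  apply: measurable_funM.
    apply: (@measurableT_comp _ _ _ _ (past W s) _ (\1_(A : set (past W s)) : past W s -> R)) => //.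
  apply: (measurableT_comp (mF t0)); apply: measurable_funD => //.
  by apply: (@measurableT_comp _ _ _ _ (past W s) _ (fun w : past W s => W s w) setT fst (past_measurable (ltW s0) (lexx s))); exact: measurable_fst.
have fE w : f (w, W t w - W s w) = \1_A w * F t (W t w) by rewrite /f/= addrC subrK.
have fi : P.-integrable setT (fun w => (f (w, W t w - W s w))%:E).
  under eq_fun do rewrite fE.
  apply: (@le_integrable _ _ _ P _ _ _ (fun w => (F t (W t w))%:E)) => //; last exact: iF.
    by apply/measurable_EFinP/measurable_funM; [exact: measurable_indic|exact: mFW].
  move=> w _; rewrite !abse_EFin lee_fin normrM ler_piMl//.
  by rewrite indicE; case: (_ \in _); rewrite ?normr1 ?normr0.
have := BM_freeze BM (ltW s0) st mf fi.
under eq_integral do rewrite fE.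
move=> E; rewrite [LHS]integral_mkcond [RHS]integral_mkcond.
have -> : (\int[P]_w ((fun w0 => (F t (W t w0))%:E) \_ A) w = \int[P]_w (\1_A w * F t (W t w))%:E)%E.
  by apply: eq_integral => w _; rewrite patchE indicE; case: (_ \in _); rewrite ?mul1r ?mul0r.
rewrite E; apply: eq_integral => w _; rewrite patchE /f/= indicE; case: (_ \in _).
  by apply: eq_integral => y _; rewrite mul1r.
by under eq_integral do rewrite mul0r; rewrite integral0.
Qed.

Lemma heat_mean_value_martingale : heat_mean_value F ->
  is_martingale_pos P (nat_filtration W) (fun t w => F t (W t w)).
Proof.
move=> hF; split => //.
- move=> t t0 B mB; apply: sub_sigma_algebra.
  exists t, (F t @^-1` B); split => //; first exact: ltW.
  by rewrite -[X in measurable X]setTI; exact: mF.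
- move=> s t s0; rewrite le_eqVlt => /predU1P[->//|st] A FA.
  rewrite (integral_past_freeze s0 st FA); apply: eq_integral => w _.
  have [hi hE] := hF s t (W s w) s0 st.
  by rewrite -hE /Rintegral fineK//; exact: integrable_fin_num.
Qed.

End martingale.

(** * From almost everywhere to everywhere *)

Lemma gauss_negligible_nbhs (R : realType) (m s x : R) (U : set R) : s != 0 ->
  nbhs x U -> ~ (gauss m s).-negligible U.
Proof.
(* By continuity the density exceeds half its value at x on a small ball, which then has mass at
   least 2 c r. *)
move=> s0 Ux N; pose c := normal_pdf m s x / 2.
have p0 : 0 < normal_pdf m s x.
  by rewrite normal_pdfE// mulr_gt0 ?expR_gt0// normal_peak_gt0.
have c0 : 0 < c by rewrite divr_gt0.
have cp : c < normal_pdf m s x by rewrite ltr_pdivrMr// ltr_pMr// ltr1n.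
have nc : \forall y \near x, c < normal_pdf m s y.
  exact: (@cvgr_gt _ _ _ _ _ _ (@continuous_normal_pdf _ m s s0 x) _ cp).
have Ub : nbhs x (U `&` [set y | c < normal_pdf m s y]) by exact: filterI.
have [r /= r0 rU] := (nbhs_ballP _ _).1 Ub.
have mB : measurable (ball x r) := measurable_ball x r.
have B0 : gauss m s (ball x r) = 0%E.
  by apply/negligibleP => //; apply: negligibleS N => y /rU[].
have : ((c * r *+ 2)%:E <= gauss m s (ball x r))%E.
  rewrite -mulrnAr EFinM -(lebesgue_measure_ball x (ltW r0)) -integral_cst//.
  apply: ge0_le_integral => //.
  - by move=> y _; rewrite lee_fin ltW.
  - apply/measurable_EFinP; apply: measurable_funTS; exact: measurable_normal_pdf.
  - by move=> y /rU[_ /= /ltW]; rewrite lee_fin.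
by rewrite B0 lee_fin leNgt pmulrn_lgt0// mulr_gt0.
Qed.

Section continuity_and_null_sets.
Variables (R : realType) (h : R -> R).
Hypothesis ch : continuous h.

Lemma gauss_ae_ge0 (m s : R) : s != 0 -> {ae gauss m s, forall x, 0 <= h x} ->
  forall x, 0 <= h x.
Proof.
move=> s0 H x; rewrite leNgt; apply/negP => hx.
have hn : \forall y \near x, h y < 0 by apply: (@cvgr_lt _ _ _ _ _ _ (@ch x)).
apply: (gauss_negligible_nbhs s0 hn); apply: negligibleS H => y /= hy.
by rewrite leNgt hy.
Qed.

Lemma BM_ae_ge0 d (Om : measurableType d) (P : probability Om R) (W : R -> Om -> R) t :
  is_std_BM P W -> 0 < t -> {ae P, forall w, 0 <= h (W t w)} -> forall x, 0 <= h x.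
Proof.
move=> BM t0 H; apply: (@gauss_ae_ge0 0 (Num.sqrt t)); first by rewrite gt_eqF// sqrtr_gt0.
have mh : measurable_fun setT h by exact: continuous_measurable_fun.
have mN : measurable (~` [set x | 0 <= h x]).
  rewrite (_ : ~` _ = h @^-1` `]-oo, 0[); first by rewrite -[X in measurable X]setTI; exact: mh.
  by apply/seteqP; split => y /=; rewrite in_itv/= ltNge => /negP.
set N := ~` _ in mN; exists N; split => //.
have mNW : measurable (W t @^-1` N).
  by rewrite -[X in measurable X]setTI; apply: (BM_measurable BM (ltW t0)).
have E : gauss 0 (Num.sqrt t) N = P (W t @^-1` N).
  rewrite -[in LHS](setIT N) -integral_indic// -[in RHS](setIT (W t @^-1` N)) -integral_indic//.
  rewrite -(BM_ge0_marginal BM t0 (h := fun x => (\1_N x)%:E))//.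
  - by apply/measurable_EFinP; exact: measurable_indic.
by rewrite [LHS]E; apply/negligibleP.
Qed.

End continuity_and_null_sets.

Section gauss_average.
Variables (R : realType) (h : R -> R) (s t : R).
Hypotheses (s0 : 0 < s) (st : s < t) (mh : measurable_fun setT h)
  (hi : (gauss 0 (Num.sqrt t)).-integrable setT (EFin \o h)).

Let t0 : 0 < t. Proof. exact: lt_trans st. Qed.
Let ts : 0 < t - s. Proof. by rewrite subr_gt0. Qed.
Let sts : Num.sqrt (t - s) != 0. Proof. by rewrite gt_eqF// sqrtr_gt0. Qed.
Let b := (2 * (t - s))^-1.
Let A := normal_peak (Num.sqrt (t - s)).
Let k x y : R := expR (- (b * (y - x) ^+ 2)).

Let A0 : A != 0. Proof. by rewrite gt_eqF// normal_peak_gt0. Qed.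
Let b0 : 0 <= b. Proof. by rewrite invr_ge0 mulr_ge0// ltW. Qed.

(** h is integrable under the law of variance t, strictly wider than the variance t - s of the
    average; this supplies the domination behind continuity in x. *)
Let kb_integrable K : 0 <= K ->
  mu.-integrable setT (fun y => (`|h y| * kernel_bound b b K y)%:E).
Proof.
move=> K0; apply: (kernel_bound_integrable (b' := (2 * t)^-1) b _ mh).
- by rewrite ltf_pV2 ?posrE ?mulr_gt0// ltr_pM2l// gtrBl.
- have := @integrable_RZl _ _ _ mu _ (normal_peak (Num.sqrt t))^-1 _ measurableT
    ((integrable_gaussP 0 (Num.sqrt t) mh).1 hi).
  apply: eq_integrable => // y _; congr EFin.
  rewrite normal_pdf_kernel// subr0 mulrCA mulKf//.
  by rewrite gt_eqF// normal_peak_gt0// gt_eqF// sqrtr_gt0.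
Qed.

Let mk x : measurable_fun setT (k x).
Proof.
apply: measurableT_comp => //; apply: measurable_funN; apply: measurable_funM => //.
by apply: measurable_funX; exact: measurable_funB.
Qed.

Let k_le K x y : 0 <= K -> `|x| <= K -> `|h y * k x y| <= `|h y| * kernel_bound b b K y.
Proof.
move=> K0 xK; rewrite normrM ler_wpM2l// ger0_norm ?expR_ge0//.
exact: kernel_le_bound.
Qed.

Let k_integrable x : mu.-integrable setT (fun y => (h y * k x y)%:E).
Proof.
apply: (@le_integrable _ _ _ mu _ _ _ (fun y => (`|h y| * kernel_bound b b `|x| y)%:E)) => //.
- by apply/measurable_EFinP; apply: measurable_funM; [exact: mh|exact: mk].
- by move=> y _; rewrite !abse_EFin lee_fin (le_trans (k_le y _ (lexx _)))// ler_norm.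
- exact: kb_integrable.
Qed.

Let gauss_x_integrable x : (gauss x (Num.sqrt (t - s))).-integrable setT (EFin \o h).
Proof.
apply/integrable_gaussP => //.
have := @integrable_RZl _ _ _ mu _ A _ measurableT (k_integrable x).
by apply: eq_integrable => // y _; rewrite normal_pdf_kernel// mulrCA.
Qed.

Lemma gauss_average_integrable x :
  (gauss 0 (Num.sqrt (t - s))).-integrable setT (fun y => (h (x + y))%:E).
Proof. by have [_ +] := integrable_gauss_shift x sts mh; apply; exact: gauss_x_integrable. Qed.

Let averageE x : (\int[gauss 0 (Num.sqrt (t - s))]_y h (x + y))%R =
  A * (\int[mu]_y (h y * k x y))%R.
Proof.
have ki := k_integrable x.
rewrite -RintegralZl//.
rewrite /Rintegral.
have gi := gauss_x_integrable x.
rewrite (integral_gauss_shift sts mh gi).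
rewrite integral_gauss//.
congr fine; apply: eq_integral => y _.
by rewrite normal_pdf_kernel// mulrCA.
Qed.

Lemma gauss_average_continuous :
  continuous (fun x => \int[gauss 0 (Num.sqrt (t - s))]_y h (x + y))%R.
Proof.
move=> x; under eq_fun do rewrite averageE.
apply: cvgM; first exact: cvg_cst.
pose K := `|x| + 1.
have K0 : 0 <= K by rewrite addr_ge0.
have IK z : `]-K, K[%classic z -> `|z| <= K.
  by rewrite /= in_itv/= => zK; rewrite ler_norml; case/andP: zK => /ltW -> /ltW ->.
have := @continuity_under_integral R _ _ mu (fun x y => h y * k x y) setT measurableT (- K) K
  _ _ (fun y => `|h y| * kernel_bound b b K y) (kb_integrable K0) _.
apply.
- by move=> z _; exact: k_integrable.
- apply: aeW => y _ z _; apply: cvgM; first exact: cvg_cst.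
  apply: continuous_comp; last exact: continuous_expR.
  apply: cvgN; apply: cvgM; first exact: cvg_cst.
  by apply: cvgM; apply: cvgB; [exact: cvg_cst|exact: cvg_id|exact: cvg_cst|exact: cvg_id].
- by move=> z /IK zK; apply: aeW => y _; exact: k_le.
- by rewrite inE /= in_itv/= -ltr_norml ltrDl.
Qed.

End gauss_average.

Section heat_mean_value_of_martingale.
Context {R : realType} d (Om : measurableType d) (P : probability Om R) (W : R -> Om -> R).
Hypothesis BM : is_std_BM P W.
Variable F : R -> R -> R.
Hypothesis cF : forall t, 0 < t -> continuous (F t).
Hypothesis MF : is_martingale_pos P (nat_filtration W) (fun t w => F t (W t w)).

Lemma martingale_heat_mean_value : heat_mean_value F.
Proof.
have [iF _ mart] := MF.
have mF t : 0 < t -> measurable_fun setT (F t).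
  by move=> t0; apply: continuous_measurable_fun; exact: cF.
move=> s t x s0 st; have t0 : 0 < t := lt_trans s0 st.
have ht := (BM_integrable_marginal BM t0 (mF _ t0)).1 (iF _ t0).
have hs := (BM_integrable_marginal BM s0 (mF _ s0)).1 (iF _ s0).
have ai y := gauss_average_integrable s0 st (mF _ t0) ht y.
split; first exact: ai.
set E := fun x => (\int[gauss 0 (Num.sqrt (t - s))]_y F t (x + y))%R.
have cE : continuous E by exact: (gauss_average_continuous s0 st (mF _ t0) ht).
have mE : measurable_fun setT E by exact: continuous_measurable_fun.
have EE y : (\int[gauss 0 (Num.sqrt (t - s))]_z (F t (y + z))%:E)%E = (E y)%:E.
  by rewrite /E /Rintegral fineK//; exact: integrable_fin_num.
have marginal (h : R -> R) (B : set R) : measurable_fun setT h -> measurable B ->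
    (\int[P]_(w in W s @^-1` B) (h (W s w))%:E = \int[gauss 0 (Num.sqrt s)]_(y in B) (h y)%:E)%E.
  move=> mh mB; have := BM_integral_marginal BM s0 (h := fun y => h y * \1_B y) _.
  move=> H; rewrite [LHS]integral_mkcond [RHS]integral_mkcond.
  transitivity (\int[P]_w (h (W s w) * \1_B (W s w))%:E)%E.
    apply: eq_integral => w _; rewrite patchE indicE /=.
    have -> : (w \in W s @^-1` B) = (W s w \in B) by apply/idP/idP; rewrite !inE.
    by case: (_ \in _); rewrite ?mulr1 ?mulr0.
  rewrite H; last by apply: measurable_funM => //; exact: measurable_indic.
  by apply: eq_integral => y _; rewrite patchE indicE; case: (_ \in _); rewrite ?mulr1 ?mulr0.
have ae : ae_eq (gauss 0 (Num.sqrt s)) setT (EFin \o F s) (EFin \o E).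
  apply: integral_ae_eq; [exact: measurableT|exact: hs|by apply/measurable_EFinP; exact: mE|].
  move=> B _ mB; rewrite -(marginal _ _ (mF _ s0) mB) -(marginal _ _ mE mB).
  have FB : nat_filtration W s (W s @^-1` B).
    by apply: sub_sigma_algebra; exists s, B; split => //; exact: ltW.
  rewrite -(mart s t s0 (ltW st) _ FB) (integral_past_freeze BM mF iF s0 st FB).
  by apply: eq_integral => w _; rewrite EE.
have ss : Num.sqrt s != 0 by rewrite gt_eqF// sqrtr_gt0.
have ge y : 0 <= E y - F s y.
  apply: (@gauss_ae_ge0 _ (fun y => E y - F s y) _ 0 _ ss).
    by move=> z; apply: cvgB; [exact: cE|exact: cF].
  by apply: filterS ae => z /(_ I) /= [->]; rewrite subrr.
have le y : 0 <= F s y - E y.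
  apply: (@gauss_ae_ge0 _ (fun y => F s y - E y) _ 0 _ ss).
    by move=> z; apply: cvgB; [exact: cF|exact: cE].
  by apply: filterS ae => z /(_ I) /= [->]; rewrite subrr.
by apply/eqP; rewrite eq_le -subr_ge0 le -subr_ge0 ge.
Qed.

End heat_mean_value_of_martingale.

(** * Condition (C) *)

Section convergence_in_probability.
Context {R : realType} d (Om : measurableType d) (P : probability Om R).
Implicit Types (X : nat -> Om -> R) (V L : Om -> R).

Let measurable_far X V k e : (forall k, measurable_fun setT (X k)) -> measurable_fun setT V ->
  measurable [set w | e < `|X k w - V w|].
Proof.
move=> mX mV; rewrite (_ : mkset _ = (fun w => `|X k w - V w|) @^-1` `]e, +oo[).
  rewrite -[X in measurable X]setTI.
  have : measurable_fun setT (fun w => `|X k w - V w|).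
    by apply: measurableT_comp; [exact: normr_measurable|exact: measurable_funB].
  by apply => //; exact: measurable_itv.
by apply/seteqP; split => w; rewrite /= in_itv/= andbT.
Qed.

Lemma ae_cvg_in_prob X V : (forall k, measurable_fun setT (X k)) -> measurable_fun setT V ->
  {ae P, forall w, X ^~ w @ \oo --> V w} -> cvg_in_prob P X V.
Proof.
move=> mX mV XV e e0; have mS k := measurable_far k e mX mV.
pose S k := [set w | e < `|X k w - V w|].
have m1 k : measurable_fun setT (fun w => (\1_(S k) w)%:E : \bar R).
  by apply/measurable_EFinP; apply: (@measurable_indic _ _ R setT (S k)); exact: mS.
have to0 : {ae P, forall w, setT w -> (fun k => (\1_(S k) w)%:E : \bar R) @ \oo --> (cst 0%E : Om -> \bar R) w}.
  apply: filterS XV => w /cvgrPdist_le /(_ _ e0) Xw _.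
  apply: cvg_near_cst; apply: filterS Xw => k Xk; congr EFin.
  by rewrite indicE memNset//= /S/= ltNge distrC Xk.
have le1 : {ae P, forall w k, setT w -> (`|(\1_(S k) w)%:E| <= (cst 1%E : Om -> \bar R) w)%E}.
  apply: aeW => w k _; rewrite gee0_abs ?lee_fin// indicE.
have [_ _] := dominated_convergence measurableT m1 (measurable_cst _) to0
  (finite_measure_integrable_cst P 1 measurableT) le1.
rewrite integral0; apply: cvg_trans; apply: near_eq_cvg; apply: nearW => k /=.
by rewrite integral_indic ?setIT//; exact: mS.
Qed.

(** L is not assumed measurable; the upper limit of the sequence, made real by [fine], is a
    measurable version of it. *)
Lemma ae_cvg_in_prob_exists X L : (forall k, measurable_fun setT (X k)) ->
  {ae P, forall w, X ^~ w @ \oo --> L w} ->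
  exists V, [/\ measurable_fun setT V, cvg_in_prob P X V & {ae P, forall w, V w = L w}].
Proof.
move=> mX XL; pose V w := fine (limn_esup (fun k => (X k w)%:E)).
have mV : measurable_fun setT V.
  apply: (measurableT_comp (fine_measurable measurableT)).
  by apply: measurable_fun_limn_esup => k; apply/measurable_EFinP.
have VL : {ae P, forall w, V w = L w}.
  apply: filterS XL => w Xw; rewrite /V.
  have Xe : (fun k => (X k w)%:E) @ \oo --> (L w)%:E by apply: cvg_EFin; [exact: nearW|exact: Xw].
  by rewrite (cvg_limn_einf_sup Xe).2.
exists V; split => //; apply: ae_cvg_in_prob => //.
by apply: filterS2 XL VL => w + ->.
Qed.

Lemma cvg_in_prob_unique X V L : (forall k, measurable_fun setT (X k)) ->
  measurable_fun setT V -> measurable_fun setT L ->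
  cvg_in_prob P X V -> cvg_in_prob P X L -> {ae P, forall w, V w = L w}.
Proof.
move=> mX mV mL XV XL.
have far e : 0 < e -> P [set w | e < `|V w - L w|] = 0%E.
  move=> e0; have e20 : 0 < e / 2 by rewrite divr_gt0.
  have mVL : measurable [set w | e < `|V w - L w|] := measurable_far 0 e (fun=> mV) mL.
  apply/eqP; rewrite -measure_le0.
  have := cvgeD (isT : (0 +? 0)%E) (XV _ e20) (XL _ e20); rewrite adde0 => /(_ _) S.
  rewrite -(cvg_lim _ S)//; apply: lime_ge; first by apply/cvg_ex; exists 0%E.
  apply: nearW => k; apply: le_trans (measureU2 _ _ _) => //; [|exact: measurable_far..].
  apply: le_measure; rewrite ?inE//; first by apply: measurableU; exact: measurable_far.
  move=> w /= eVL; have [A|A] := leP `|X k w - V w| (e / 2); [right|by left].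
  rewrite ltNge; apply/negP => B.
  move: eVL; apply/negP; rewrite -leNgt (splitr e).
  rewrite (_ : V w - L w = (X k w - L w) - (X k w - V w)); last by ring.
  by apply: le_trans (ler_normB _ _) _; rewrite addrC lerD.
have : {ae P, forall w, forall n : nat, `|V w - L w| <= n.+1%:R^-1}.
  apply: ae_foralln => n; exists [set w | n.+1%:R^-1 < `|V w - L w|]; split.
  - exact: (measurable_far 0 _ (fun=> mV) mL).
  - by apply: far; rewrite invr_gt0 ltr0n.
  - by move=> w /= /negP; rewrite -ltNge.
apply: filterS => w VL; apply/eqP; rewrite -subr_eq0 -normr_le0.
apply/ler_addgt0Pl => e e0; rewrite addr0.
have [n _ ne] := @near_infty_natSinv_lt R (PosNum e0).
by apply: le_trans (VL n) _; apply: ltW; apply: (ne n) => /=.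
Qed.

Lemma cvg_in_prob_ae X V L : (forall k, measurable_fun setT (X k)) ->
  measurable_fun setT V -> cvg_in_prob P X V ->
  {ae P, forall w, X ^~ w @ \oo --> L w} -> {ae P, forall w, V w = L w}.
Proof.
move=> mX mV XV /(ae_cvg_in_prob_exists mX)[Y [mY XY YL]].
by apply: filterS2 (cvg_in_prob_unique mX mV mY XV XY) YL => w ->.
Qed.

End convergence_in_probability.

Section brownian_functional.
Context {R : realType} d (Om : measurableType d) (P : probability Om R) (W : R -> Om -> R).
Hypothesis BM : is_std_BM P W.
Variables (F D : R -> R -> R) (n : nat).
Hypothesis mF : forall t, 0 < t -> measurable_fun setT (F t).
Hypothesis FD : forall s t, 0 < s -> s <= t -> local_expansion F D s t.
Notation M := (fun t w => F t (W t w)).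

Let weight (u x : R) : R := (1 + u + x ^+ 2) ^+ n.-1.

Let mM t : 0 < t -> measurable_fun setT (M t).
Proof.
by move=> t0; apply: (measurableT_comp (mF t0)); apply: (BM_measurable BM); exact: ltW.
Qed.

Let mqv s t k : 0 < s -> s <= t -> measurable_fun setT (qv_sum M s t k).
Proof.
move=> s0 st; apply: measurable_sum => i; apply: measurable_funX.
have T0 (j : nat) : 0 < s + (t - s) * j%:R / (2 ^ k)%:R.
  by rewrite ltr_wpDr// divr_ge0// mulr_ge0// subr_ge0.
by apply: measurable_funB; exact: mM.
Qed.

Let cW : {ae P, forall w, forall s t, 0 < s -> {within `[s, t], continuous (W ^~ w)}}.
Proof.
apply: filterS (BM_continuous BM) => w cw s t s0.
apply: continuous_subspaceW cw => x; rewrite /= !in_itv/= andbT => /andP[sx _].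
exact: ltW (lt_le_trans s0 sx).
Qed.

Let cweight s t w : {within `[s, t], continuous (W ^~ w)} ->
  {within `[s, t], continuous (fun u => weight u (W u w))}.
Proof.
move=> cw x.
have cu : {within `[s, t], continuous (fun u : R => 1 + u)}.
  by apply: continuous_subspaceT => z; apply: cvgD; [exact: cvg_cst|exact: cvg_id].
have H := continuousD (cu x) (continuousM (cw x) (cw x)).
exact: (continuous_comp H (@exprn_continuous R n.-1 _)).
Qed.

Lemma BM_qv_sum_ae s t : 0 < s -> s < t -> {ae P, forall w,
  qv_sum M s t ^~ w @ \oo --> \int[mu]_(u in `[s, t]) (D u (W u w) ^+ 2)}.
Proof.
move=> s0 st; apply: filterS2 cW (BM_dyadic_qv_ae BM (ltW s0) st) => w cw qw.
exact: (path_qv_cvg st (FD s0 (ltW st)) (cw s t s0) qw).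
Qed.

Let cD2 s t w : 0 < s -> s < t -> {within `[s, t], continuous (W ^~ w)} ->
  {within `[s, t], continuous (fun u => D u (W u w) ^+ 2)}.
Proof.
move=> s0 st cw x.
have H := path_derivative_continuous st (FD s0 (ltW st)) cw.
exact: (continuousM (H x) (H x)).
Qed.

Lemma condition_C_of_derivative_bound C : 0 < C ->
  (forall t x, 0 < t -> D t x ^+ 2 <= C * (1 + t + x ^+ 2) ^+ n.-1) ->
  condition_C P W n M.
Proof.
move=> C0 DC; exists C; split => // s t s0; rewrite le_eqVlt => /predU1P[<-|st].
  (* A segment reduced to a point is treated apart, since convergence along paths requires s < t. *)
  exists (cst 0); split; first exact: measurable_cst.
    apply: ae_cvg_in_prob.
    - by move=> k; exact: mqv.
    - exact: measurable_cst.
    - apply: aeW => w; apply: cvg_near_cst; apply: nearW => k.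
      rewrite /qv_sum big1// => i _.
      by rewrite !subrr !mul0r !addr0 subrr expr0n.
  apply: aeW => w /=; rewrite mulr_ge0 ?(ltW C0)//; apply: Rintegral_ge0 => u.
  rewrite /= in_itv/= => /andP[su _]; rewrite exprn_ge0// addr_ge0 ?sqr_ge0// addr_ge0//.
  exact: ltW (lt_le_trans s0 su).
have [V [mV XV VL]] := ae_cvg_in_prob_exists (fun k => mqv k s0 (ltW st)) (BM_qv_sum_ae s0 st).
exists V; split => //; apply: filterS2 VL cW => w -> cw.
have wi := within_continuous_integrable (cweight (cw s t s0)).
rewrite -RintegralZl//; apply: le_Rintegral => //.
- by apply: within_continuous_integrable; apply: cD2 => //; exact: cw.
- exact: integrable_RZl.
- by move=> u; rewrite /= in_itv/= => /andP[su _]; apply: DC; exact: lt_le_trans su.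
Qed.

(** On the countably many segments [s, s + 1/(k+1)], the inequality between integrals holds on a
    common almost sure event. Dividing by the length gives the bound at (s, W_s), and [BM_ae_ge0]
    carries it to every x. *)
Lemma condition_C_derivative_bound : condition_C P W n M ->
  exists2 C, 0 < C & forall t x, 0 < t -> D t x ^+ 2 <= C * (1 + t + x ^+ 2) ^+ n.-1.
Proof.
move=> [C [C0 HC]]; exists C => // s x s0; rewrite -subr_ge0; move: x.
have ss1 k : s < s + k.+1%:R^-1 by rewrite ltrDl invr_gt0 ltr0n.
apply: (BM_ae_ge0 _ BM s0).
  move=> x.
  have cy : {for x, continuous (fun y : R => 1 + s + y ^+ 2)}.
    by apply: continuousD; [exact: cst_continuous|exact: exprn_continuous].
  have cwt := continuous_comp cy (@exprn_continuous R n.-1 _).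
  have cD : {for x, continuous (D s)}.
    have [L L0 DL] := local_expansion_modulus (FD s0 (lexx s)) (addr_ge0 (normr_ge0 x) ler01).
    have L1 : 0 < L + 1 by rewrite ltr_wpDl.
    apply/cvgrPdist_lt => e e0; apply/nbhs_ballP.
    exists (Num.min 1 (e / (L + 1))); first by rewrite /= lt_min ltr01 divr_gt0.
    move=> y; rewrite /ball/= lt_min => /andP[y1 ye].
    have s_s : s <= s <= s by rewrite lexx.
    have yx : `|y| <= `|x| + 1.
      rewrite -[y](subrK x) addrC (le_trans (ler_normD _ _))// lerD2l distrC; exact: ltW.
    have := DL s s y x s_s s_s _ yx _.
    rewrite subrr normr0 sqrtr0 addr0 => /(_ ler01); rewrite lerDl => /(_ ler01) H.
    apply: le_lt_trans H _; move: ye; rewrite ltr_pdivlMr//.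
    have := normr_ge0 (x - y); nra.
  have cC : {for x, continuous (fun=> C)} by exact: cst_continuous.
  exact: (continuousB (continuousM cC cwt) (continuousM cD cD)).
have bnd : {ae P, forall w, forall k : nat,
    \int[mu]_(u in `[s, (s + k.+1%:R^-1)]) (D u (W u w) ^+ 2) <=
    C * \int[mu]_(u in `[s, (s + k.+1%:R^-1)]) weight u (W u w)}.
  apply: ae_foralln => k; have [V [mV XV VC]] := HC s _ s0 (ltW (ss1 k)).
  have VL := cvg_in_prob_ae (fun k' => mqv k' s0 (ltW (ss1 k))) mV XV (BM_qv_sum_ae s0 (ss1 k)).
  by apply: filterS2 VC VL => w + <-.
apply: filterS2 bnd cW => w Hw cw; rewrite subr_ge0; apply/ler_addgt0Pl => e e0.
(* The two averages cost e' for the slope and C e' for the weight, in total e. *)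
pose e' := e / (1 + C); have C1 : 0 < 1 + C by rewrite ltr_wpDr// ltW.
have e'0 : 0 < e' by rewrite divr_gt0.
have cw1 := cw s (s + 1) s0.
have s1 : s < s + 1 by rewrite ltrDl.
have ss : s <= s <= s + 1 by rewrite lexx ltW.
have [d1 d10 d1P] := (within_itv_continuousP _ _ _).1 (cD2 s0 s1 cw1) s ss e' e'0.
have [d2 d20 d2P] := (within_itv_continuousP _ _ _).1 (cweight cw1) s ss e' e'0.
have d0 : 0 < Num.min d1 d2 by rewrite lt_min d10.
have [k _ kd] := @near_infty_natSinv_lt R (PosNum d0).
have := kd k (leqnn k); rewrite /= lt_min => /andP[kd1 kd2].
set h := k.+1%:R^-1 in kd1 kd2; have h0 : 0 < h by rewrite invr_gt0 ltr0n.
have h1 : h <= 1 by rewrite invf_le1 ?ltr0n// ler1n.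
have sh : s <= s + h by rewrite lerDl ltW.
have inI u : s <= u <= s + h -> (s <= u <= s + 1) /\ `|u - s| <= h.
  move=> /andP[su uh]; split; first by rewrite su (le_trans uh)// lerD2l.
  by rewrite ger0_norm ?subr_ge0// lerBlDl.
have cwh := cw s (s + h) s0.
have I1 := Rintegral_segment_close sh (cD2 s0 (ss1 k) cwh) (c := D s (W s w) ^+ 2) (e := e') _.
have I2 := Rintegral_segment_close sh (cweight cwh) (c := weight s (W s w)) (e := e') _.
have {}I1 : `|\int[mu]_(u in `[s, (s + h)]) (D u (W u w) ^+ 2) - D s (W s w) ^+ 2 * h| <= e' * h.
  have := I1; rewrite addrAC subrr add0r; apply => u /inI[us uh].
  by apply/ltW/d1P => //; exact: le_lt_trans kd1.
have {}I2 : `|\int[mu]_(u in `[s, (s + h)]) weight u (W u w) - weight s (W s w) * h| <= e' * h.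
  have := I2; rewrite addrAC subrr add0r; apply => u /inI[us uh].
  by apply/ltW/d2P => //; exact: le_lt_trans kd2.
have := Hw k; rewrite -/h; move: I1 I2; rewrite -/(weight s (W s w)).
move: (Rintegral _ _ _) => J1; move: (Rintegral _ _ _) (D _ _ ^+ 2) (weight _ _) => J2 a b.
rewrite !ler_norml => /andP[A1 _] /andP[_ A2] J12.
have -> : e = e' + C * e' by rewrite /e'; field; rewrite gt_eqF.
rewrite -(ler_pM2r h0).
have : C * (J2 - b * h) <= C * (e' * h) by rewrite ler_wpM2l// ltW.
lra.
Qed.

End brownian_functional.

(** * Polynomial growth *)

Lemma derivative_bound_dist (R : realType) (f df : R -> R) (x B : R) :
  (forall y : R, is_derive y (1 : R) f (df y)) -> (forall y, `|y| <= `|x| -> `|df y| <= B) ->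
  `|f x - f 0| <= B * `|x|.
Proof.
move=> fD dfB.
have cf a b : {within `[a, b], continuous f}.
  apply: derivable_within_continuous => y _; exact: (@ex_derive _ _ _ _ _ _ _ (fD y)).
have [x0|x0] := leP 0 x.
  have [c] := MVT_segment x0 (fun y _ => fD y) (cf 0 x).
  rewrite in_itv/= => /andP[c0 cx] ->; rewrite subr0 normrM ler_wpM2r//.
  by apply: dfB; rewrite !ger0_norm.
have [c] := MVT_segment (ltW x0) (fun y _ => fD y) (cf x 0).
rewrite in_itv/= => /andP[c0 cx] E; rewrite distrC E sub0r normrM normrN ler_wpM2r//.
by apply: dfB; rewrite !ler0_norm ?lerN2// ltW.
Qed.

Section heat_polynomial_representation.
Variables (R : realType) (F : R -> R -> R) (n : nat).
Hypothesis mF : forall t, 0 < t -> measurable_fun setT (F t).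
Hypothesis hF : heat_mean_value F.

Section growth.
Variable C : R.
Hypotheses (C0 : 0 < C) (n0 : (0 < n)%N)
  (DC : forall t x, 0 < t -> ('D_1 (F t) x) ^+ 2 <= C * (1 + t + x ^+ 2) ^+ n.-1)
  (F0 : forall t, 0 < t -> (gauss 0 (Num.sqrt t)).-integrable setT (EFin \o F t) /\
     (\int[gauss 0 (Num.sqrt t)]_y F t y = 0)%R).

Let S := Num.sqrt C.
Let G (t x : R) := 1 + Num.sqrt t + `|x|.

Let S0 : 0 <= S. Proof. exact: sqrtr_ge0. Qed.
Let G1 t x : 1 <= G t x. Proof. by rewrite /G -addrA lerDl addr_ge0// sqrtr_ge0. Qed.
Let G0 t x : 0 <= G t x. Proof. exact: le_trans (G1 t x). Qed.

Let D_le t x : 0 < t -> `|'D_1 (F t) x| <= S * G t x ^+ n.-1.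
Proof.
move=> t0; rewrite -(@ler_pXn2r _ 2)// ?nnegrE ?mulr_ge0 ?exprn_ge0//.
rewrite real_normK ?num_real//; apply: le_trans (DC x t0) _.
rewrite [leRHS](_ : _ = C * (G t x ^+ 2) ^+ n.-1); last first.
  by rewrite exprMn sqr_sqrtr ?(ltW C0)// -!exprM mulnC.
rewrite ler_wpM2l ?(ltW C0)// lerXn2r ?nnegrE ?exprn_ge0//.
  by rewrite addr_ge0 ?sqr_ge0// addr_ge0// ltW.
rewrite /G; have := sqrtr_ge0 t; have := sqr_sqrtr (ltW t0).
rewrite -(real_normK (num_real x)); have := normr_ge0 x.
move: (Num.sqrt t) `|x| => p q q0 <- p0.
have := mulr_ge0 p0 q0; lra.
Qed.

Let dist0 t x : 0 < t -> `|F t x - F t 0| <= S * G t x ^+ n.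
Proof.
move=> t0.
have FD (y : R) : is_derive y (1 : R) (F t) ('D_1 (F t) y).
  have := @local_expansion_derive _ _ _ _ _ (heat_local_expansion mF hF t0 (lexx t)) t y.
  by rewrite lexx; apply.
have DB y : `|y| <= `|x| -> `|'D_1 (F t) y| <= S * G t x ^+ n.-1.
  move=> yx; apply: le_trans (D_le y t0) _; rewrite ler_wpM2l//.
  by rewrite lerXn2r ?nnegrE// /G lerD2l.
apply: le_trans (derivative_bound_dist FD DB) _.
rewrite -mulrA ler_wpM2l// -[in leRHS](prednK n0) exprSr ler_wpM2l ?exprn_ge0//.
by rewrite /G lerDr addr_ge0// sqrtr_ge0.
Qed.

Let E0 := 2 * expR (n%:R ^+ 2 / 2) : R.

(** As F(t, .) has mean zero under N(0, t), F(t,0) is the mean of F(t,0) - F(t,Y), which [dist0]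
    controls. [E0] bounds the mean of exp (n |Y| / sqrt t) and does not depend on t. *)
Let F0_le t : 0 < t -> `|F t 0| <= S * E0 * (1 + Num.sqrt t) ^+ n.
Proof.
move=> t0; have [fi fE] := F0 t0; set s := Num.sqrt t.
have s0 : 0 < s by rewrite sqrtr_gt0.
have sN : s != 0 by rewrite gt_eqF.
have c0 : 0 <= n%:R / s by rewrite divr_ge0// ltW.
have ei := gauss_integrable_expR_norm sN c0.
have Gexp y : G t y ^+ n <= (1 + s) ^+ n * expR (n%:R / s * `|y|).
  have -> : expR (n%:R / s * `|y|) = expR (`|y| / s) ^+ n.
    by rewrite -expRM_natl; congr expR; ring.
  rewrite -exprMn lerXn2r ?nnegrE ?mulr_ge0 ?expR_ge0 ?addr_ge0 ?(ltW s0)//.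
  apply: le_trans (_ : _ <= (1 + s) * (1 + `|y| / s)) _; last first.
    by rewrite ler_wpM2l ?addr_ge0 ?(ltW s0)// expR_ge1Dx.
  rewrite mulrDr mulr1 /G lerD2l.
  have -> : (1 + s) * (`|y| / s) = `|y| + `|y| / s by field.
  by rewrite lerDl divr_ge0// ltW.
have ci : (gauss 0 s).-integrable setT (EFin \o (fun=> F t 0)).
  exact: (finite_measure_integrable_cst (gauss 0 s) (F t 0) measurableT).
have ti := @integrable_RZl _ _ _ (gauss 0 s) _ (S * (1 + s) ^+ n) _ measurableT ei.
have := Rintegral_dist_le ci fi ti _.
have cE : (\int[gauss 0 s]_y F t 0 = F t 0)%R.
  rewrite Rintegral_cst//.
  by rewrite [X in fine X]probability_setT mulr1.
rewrite cE fE subr0 => H; apply: le_trans (H _) _.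
  move=> y /=; rewrite distrC; apply: le_trans (dist0 y t0) _.
  by rewrite -mulrA ler_wpM2l.
rewrite RintegralZl//.
have -> : S * E0 * (1 + s) ^+ n = S * (1 + s) ^+ n * E0 by ring.
rewrite ler_wpM2l ?mulr_ge0 ?exprn_ge0 ?addr_ge0 ?(ltW s0)//.
rewrite -lee_fin /Rintegral fineK; last exact: integrable_fin_num.
apply: le_trans (gauss_expR_norm_le sN c0) _; rewrite lee_fin ler_wpM2l// ler_expR.
by rewrite le_eqVlt; apply/orP; left; apply/eqP; field.
Qed.

Lemma heat_growth t x : 0 < t -> `|F t x| <= S * (1 + E0) * (1 + Num.sqrt t + `|x|) ^+ n.
Proof.
move=> t0; rewrite -[F t x](subrK (F t 0)); apply: le_trans (ler_normD _ _) _.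
rewrite mulrDr mulr1 mulrDl lerD//; first exact: dist0.
apply: le_trans (F0_le t0) _.
rewrite ler_wpM2l ?mulr_ge0 ?expR_ge0// lerXn2r ?nnegrE ?addr_ge0 ?sqrtr_ge0//.
by rewrite lerDl.
Qed.

End growth.

(** The final value at time T determines F before T. The extensions from the times 2 and t + 2 both
    represent F on ]0, 1]; for fixed x they are polynomials in time, hence equal, so the extension
    from 2 also gives F at t, however large t is. *)
Lemma heat_poly_of_slices :
  (forall s, 0 < s -> exists2 r : {poly R}, (size r <= n.+1)%N & forall x, F s x = r.[x]) ->
  exists p, [/\ heat_poly p, bideg_le p n & forall t x, 0 < t -> F t x = bipoly_eval p t x].
Proof.
move=> FP.
have ext T r s x : (forall y, F T y = r.[y]) -> 0 < s -> s < T ->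
    F s x = bipoly_eval (heat_extension T r) s x.
  move=> FT s0 sT; have [_ <-] := hF x s0 sT.
  under eq_Rintegral do rewrite FT.
  rewrite (@gauss_poly _ _ _ _ (size r)) ?gt_eqF ?sqrtr_gt0 ?subr_gt0//; last first.
    by rewrite -addnn leq_addr.
  by rewrite bipoly_eval_heat_extension sqr_sqrtr// subr_ge0 ltW.
have [r2 sr2 F2] := FP 2 (ltr0Sn _ 1).
exists (heat_extension 2 r2); split; [exact: heat_extension_heat|exact: heat_extension_bideg|].
move=> t x t0; have T2 : 2 < t + 2 by rewrite ltrDr.
have [r sr FT] := FP (t + 2) (lt_trans (ltr0Sn _ 1) T2).
rewrite (ext (t + 2) r t x FT t0) ?ltrDl//; rewrite /bipoly_eval.
apply/eqP; rewrite -subr_eq0 -hornerN -hornerD; apply/eqP.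
set q := _ - _; suff -> : q = 0 by rewrite horner0.
apply: (@poly_eq0_small _ (size q) q 0) => // u u0 u1.
rewrite mul0r /q hornerD hornerN -!/(bipoly_eval _ _ _).
rewrite -(ext 2 r2 u x F2 u0); last by rewrite (le_lt_trans u1)// ltr1n.
rewrite -(ext (t + 2) r u x FT u0) ?subrr ?normr0//.
by rewrite (le_lt_trans u1)// (lt_trans _ T2)// ltr1n.
Qed.

End heat_polynomial_representation.

(** * The two implications *)

Section theorem5_setting.
Context {R : realType} d (Om : measurableType d) (P : probability Om R) (W : R -> Om -> R).
Hypothesis BM : is_std_BM P W.
Variables (n : nat) (f : R -> R -> R).
Hypotheses (n0 : (0 < n)%N) (cf : forall t, 0 < t -> continuous (f t))
  (fi : forall t, 0 < t -> P.-integrable setT (fun w => (f t (W t w))%:E)).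

Let g t := Rintegral P setT (fun w => f t (W t w)).
Let F t x := f t x - g t.

Let cF t : 0 < t -> continuous (F t).
Proof. by move=> t0 x; apply: cvgB; [exact: cf|exact: cvg_cst]. Qed.

Let mf t : 0 < t -> measurable_fun setT (f t).
Proof. by move=> t0; apply: continuous_measurable_fun; exact: cf. Qed.

Let mF t : 0 < t -> measurable_fun setT (F t).
Proof. by move=> t0; apply: continuous_measurable_fun; exact: cF. Qed.

Let iF t : 0 < t -> P.-integrable setT (fun w => (F t (W t w))%:E).
Proof.
move=> t0; have ci := finite_measure_integrable_cst P (g t) measurableT.
by apply: eq_integrable (integrableB _ (fi t0) ci) => // w _; rewrite /F EFinB.
Qed.

Let gE t : 0 < t -> g t = (\int[gauss 0 (Num.sqrt t)]_y f t y)%R.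
Proof. by move=> t0; rewrite /g /Rintegral (BM_integral_marginal BM t0 (mf t0)). Qed.

Let gauss_fi t : 0 < t -> (gauss 0 (Num.sqrt t)).-integrable setT (EFin \o f t).
Proof. by move=> t0; apply/(BM_integrable_marginal BM t0 (mf t0)); exact: fi. Qed.

Let F0 t : 0 < t -> (gauss 0 (Num.sqrt t)).-integrable setT (EFin \o F t) /\
  (\int[gauss 0 (Num.sqrt t)]_y F t y = 0)%R.
Proof.
move=> t0; have ci := finite_measure_integrable_cst (gauss 0 (Num.sqrt t)) (g t) measurableT.
have gi := gauss_fi t0; split.
  by apply: eq_integrable (integrableB _ gi ci) => // w _; rewrite /F EFinB.
by rewrite /F RintegralB// -gE// Rintegral_cst// [X in fine X]probability_setT mulr1 subrr.
Qed.

Lemma centered_martingale_condition_C_heat_poly :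
  is_martingale_pos P (nat_filtration W) (fun t w => F t (W t w)) ->
  condition_C P W n (fun t w => F t (W t w)) ->
  exists (p : {poly {poly R}}) (c : R -> R),
     [/\ heat_poly p, bideg_le p n & forall t x, 0 < t -> f t x = bipoly_eval p t x + c t].
Proof.
move=> mart FC; have hF := martingale_heat_mean_value BM cF mart.
have FD := heat_local_expansion mF hF.
have [C C0 DC] := condition_C_derivative_bound BM mF FD FC.
have growth := heat_growth mF hF C0 n0 DC F0.
have [p [hp bp Fp]] := heat_poly_of_slices hF (heat_liouville mF hF growth).
by exists p, g; split => // t x t0; rewrite -Fp// subrK.
Qed.

Lemma heat_poly_centered_martingale_condition_C (p : {poly {poly R}}) (c : R -> R) :
  heat_poly p -> bideg_le p n -> (forall t x, 0 < t -> f t x = bipoly_eval p t x + c t) ->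
  is_martingale_pos P (nat_filtration W) (fun t w => F t (W t w)) /\
  condition_C P W n (fun t w => F t (W t w)).
Proof.
move=> hp bp fE; pose k := bipoly_eval p 0 0.
have pi_ s t x : s < t -> (gauss 0 (Num.sqrt (t - s))).-integrable setT
    (fun y => (bipoly_eval p t (x + y))%:E) by exact: gauss_integrable_heat_poly.
have ci s a : (gauss 0 s).-integrable setT (EFin \o (fun=> a : R)).
  exact: (finite_measure_integrable_cst (gauss 0 s) a measurableT).
have cE s a : (\int[gauss 0 s]_y a = a)%R.
  by rewrite Rintegral_cst// [X in fine X]probability_setT mulr1.
(* The mean value identity from time 0 gives E p(t, W_t) = p(0, 0) = k, so centring removes c(t) and
   leaves a constant independent of t. *)
have FE t x : 0 < t -> F t x = bipoly_eval p t x - k.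
  move=> t0; have pE : (\int[gauss 0 (Num.sqrt t)]_y bipoly_eval p t y = k)%R.
    rewrite /k -(gauss_heat_poly 0 hp t0) subr0.
    by apply: eq_Rintegral => y _; rewrite add0r.
  have ip : (gauss 0 (Num.sqrt t)).-integrable setT (EFin \o bipoly_eval p t).
    have := pi_ 0 t 0 t0; rewrite subr0; apply: eq_integrable => // y _.
    by rewrite /= add0r.
  rewrite /F gE// fE//.
  under eq_Rintegral do rewrite fE//.
  by rewrite (RintegralD _ ip (ci _ _))// pE cE /k opprD addrACA subrr addr0.
have hF : heat_mean_value F.
  move=> s t x s0 st; have t0 := lt_trans s0 st; have ip := pi_ s t x st; split.
    apply: eq_integrable (integrableB _ ip (ci _ k)) => // y _.
    by rewrite /= FE// EFinB.
  under eq_Rintegral do rewrite FE//.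
  by rewrite (RintegralB _ ip (ci _ _))// cE gauss_heat_poly// FE.
split; first exact: (heat_mean_value_martingale BM mF iF hF).
have [C C0 DC] := heat_poly_deriv_bound hp bp n0.
apply: (condition_C_of_derivative_bound BM mF (heat_local_expansion mF hF) C0) => t x t0.
have -> : 'D_1 (F t) x = bipoly_eval p^`() t x.
  have -> : F t = bipoly_eval p t - cst k by apply/funext => y; rewrite FE.
  have := is_deriveB (bipoly_eval_derive p t x) (is_derive_cst k x 1).
  by move=> /(@derive_val _ _ _ _ _ _ _) ->; rewrite subr0.
by apply: DC; exact: ltW.
Qed.

End theorem5_setting.

Theorem theorem5 (R : realType) (d : measure_display) (Om : measurableType d)
  (P : probability Om R) (W : R -> Om -> R) (n : nat) (f : R -> R -> R) :
  measure_is_complete P ->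
  is_std_BM P W ->
  (1 <= n)%N ->
  (forall q : R * R, 0 < q.1 -> {for q, continuous (fun z : R * R => f z.1 z.2)}) ->
  (forall t, 0 < t -> P.-integrable setT (fun w => (f t (W t w))%:E)) ->
  let g := fun t => Rintegral P setT (fun w => f t (W t w)) in
  let M := fun t w => f t (W t w) - g t in
  (is_martingale_pos P (nat_filtration W) M /\ condition_C P W n M) <->
  (exists (p : {poly {poly R}}) (c : R -> R),
     [/\ heat_poly p, bideg_le p n &
         forall t x, 0 < t -> f t x = bipoly_eval p t x + c t]).
Proof.
move=> _ BM n0 jf fi g M.
have cf t : 0 < t -> continuous (f t).
  move=> t0 x; have cx : {for x, continuous (fun y : R => (t, y))}.
    exact: (cvg_pair (cvg_cst t) (@cvg_id _ (nbhs x))).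
  exact: (continuous_comp cx (jf (t, x) t0)).
split=> [[mart MC]|[p [c [hp bp fE]]]].
  exact: (centered_martingale_condition_C_heat_poly BM n0 cf fi mart MC).
exact: (heat_poly_centered_martingale_condition_C BM n0 cf fi hp bp fE).
Qed.
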